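(* Let $\varepsilon>0$. There exists a constant $C>0$ such that the following holds for every $f_0\in H^{\frac32}(\mathbb{T})\cap H^{\frac32+\varepsilon}(\mathbb{T})$. If $$\|f_0\|_{H^{\frac32}}<\min\left\{1,\ \frac{\varepsilon^2}{C\left(\|f_0\|_{H^{\frac32+\varepsilon}}\log\|f_0\|_{H^{\frac32+\varepsilon}}+1\right)^2}\right\},$$ then the Cauchy problem $$\partial_t f+\Lambda f=\Lambda(f\,\Lambda f)+\partial_x(f\,\partial_x f),\qquad f|_{t=0}=f_0,$$ is globally well-posed, in the sense that it admits a unique solution $f$ such that for any $T>0$ $$f\in C^{0,\frac12-\vartheta}\big([0,T);H^{1+\vartheta(\varepsilon+1)}\big)\cap L^\infty\big([0,T);H^{\frac32+\varepsilon}\big)\cap L^2\big([0,T);H^{2+\varepsilon}\big)$$ for $\frac{1}{2(\varepsilon+1)}\le\vartheta<\frac12$.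
   Context: $\mathbb{T}=\mathbb{R}/2\pi\mathbb{Z}$. For a function $u$ on $\mathbb{T}$ the Fourier coefficients are $\hat u(n)=\frac{1}{\sqrt{2\pi}}\int_{\mathbb{T}}u(x)e^{-inx}\,dx$. The operator $\Lambda$ is the Fourier multiplier $\widehat{\Lambda u}(n)=|n|\hat u(n)$. All functions are real-valued and have zero average (the equation conserves the average). For $s\ge0$ the Sobolev space $H^s(\mathbb{T})=\dot H^s(\mathbb{T})$ consists of the zero-average functions $u$ with $\|u\|_{H^s}^2=\sum_{k\in\mathbb{Z}}|k|^{2s}|\hat u(k)|^2<\infty$. $C^{0,\gamma}([0,T);X)$ denotes the space of $\gamma$-Hölder continuous functions of time with values in $X$. A solution is understood in the sense of distributions with the initial datum attained at $t=0$. The convention $0\log 0=0$ is used. *)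

(* Defs.v *)
From mathcomp Require Import all_boot all_order all_algebra.
From mathcomp Require Import all_classical all_reals all_analysis.
From mathcomp.real_closed Require Import complex.
Set Implicit Arguments.
Unset Strict Implicit.
Unset Printing Implicit Defensive.
Import Order.TTheory GRing.Theory Num.Theory.
Import numFieldNormedType.Exports.
Local Open Scope classical_set_scope.
Local Open Scope ring_scope.
Local Open Scope complex_scope.

Section Torus.
Context {R : realType}.
Implicit Types (u v : R -> R) (s : R).

Notation mu := (@lebesgue_measure R).

Definition period : set R := `[0, pi *+ 2].

(* Functions on R / 2 pi Z are 2 pi-periodic functions on R; functions that
   agree almost everywhere represent the same element of L^1. *)
Definition torus_L1 u : Prop :=
  periodic u (pi *+ 2) /\ mu.-integrable period (EFin \o u).

Definition ae_equal u v : Prop := {ae mu, forall x, u x = v x}.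

Definition complex_integral (D : set R) (F : R -> R[i]) : R[i] :=
  (\int[mu]_(x in D) complex.Re (F x))
    +i* (\int[mu]_(x in D) complex.Im (F x)).

Definition expi (y : R) : R[i] := cos y +i* sin y.

Definition fourier u (n : int) : R[i] :=
  ((Num.sqrt (pi *+ 2))^-1)%:C *
  complex_integral period (fun x => (u x)%:C * expi (- (n%:~R * x))).

Definition zero_average u : Prop := \int[mu]_(x in period) u x = 0.

Definition sobolev_norm2 s u : \bar R :=
  \esum_(k in [set: int])
    ((`|k|%:~R `^ (2 * s)) * ComplexField.Normc.normc (fourier u k) ^+ 2)%:E.

Definition sobolev s u : Prop :=
  [/\ torus_L1 u, zero_average u & (sobolev_norm2 s u < +oo)%E].

(* Meaningful when [sobolev s u] holds. *)
Definition sobolev_norm s u : R := Num.sqrt (fine (sobolev_norm2 s u)).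

(* [Lambda u] is determined up to a.e. equality whenever some L^1 function has
   the Fourier coefficients |n| u^(n), e.g. when u is in H^1; otherwise it is
   a dummy. The same remark applies to [weak_deriv] below. *)
Definition is_Lambda u v : Prop :=
  torus_L1 v /\ forall n : int, fourier v n = (`|n|%:~R)%:C * fourier u n.

Definition Lambda u : R -> R := xget (cst 0) [set v | is_Lambda u v].

Definition smooth_torus (psi : R -> R) : Prop :=
  periodic psi (pi *+ 2) /\ forall n x, derivable (derive1n n psi) x 1.

Definition is_weak_deriv u v : Prop :=
  torus_L1 v /\
  forall psi, smooth_torus psi ->
    \int[mu]_(x in period) (u x * derive1 psi x) =
    - \int[mu]_(x in period) (v x * psi x).

Definition weak_deriv u : R -> R := xget (cst 0) [set v | is_weak_deriv u v].

End Torus.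

Section Distributions.
Context {R : realType}.
Implicit Types (f g phi : R -> R -> R).

Notation mu := (@lebesgue_measure R).

Definition dt phi : R -> R -> R := fun t x => derive1 (phi^~ x) t.
Definition dx phi : R -> R -> R := fun t x => derive1 (phi t) x.

Fixpoint Ck (k : nat) phi : Prop :=
  continuous (fun p : R * R => phi p.1 p.2) /\
  if k is k'.+1 then
    [/\ forall t x, derivable (phi^~ x) t 1 /\ derivable (phi t) x 1,
        Ck k' (dt phi) & Ck k' (dx phi)]
  else True.

(* C_c^oo((0, +oo) x T) *)
Definition test_function phi : Prop :=
  [/\ forall k, Ck k phi,
      forall t, periodic (phi t) (pi *+ 2) &
      exists a b : R, 0 < a /\
        forall t x, ~ (a <= t <= b) -> phi t x = 0].

Definition functional := (R -> R -> R) -> R.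

Definition of_fun g : functional := fun phi =>
  \int[mu]_(t in `]0, +oo[) \int[mu]_(x in period) (g t x * phi t x).

Definition Dt (S : functional) : functional := fun phi => - S (dt phi).
Definition Dx (S : functional) : functional := fun phi => - S (dx phi).

(* Lambda is self-adjoint: its symbol |n| is real and even. *)
Definition DLambda (S : functional) : functional :=
  fun phi => S (fun t => Lambda (phi t)).

(* L^1_loc((0, +oo); L^1(T)), so that [of_fun g] is a genuine distribution. *)
Definition L1_loc_in_time g : Prop :=
  [/\ forall t, 0 < t -> torus_L1 (g t),
      forall phi, test_function phi ->
        measurable_fun (`]0, +oo[ : set R)
          (fun t => \int[mu]_(x in period) (g t x * phi t x)) &
      forall a b : R, 0 < a ->
        (\int[mu]_(t in `[a, b]) \int[mu]_(x in period) `|g t x|%:E < +oo)%E].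

Definition is_solution (f0 : R -> R) f : Prop :=
  let Lf := fun t => Lambda (f t) in
  let f_x := fun t => weak_deriv (f t) in
  let f_Lf := fun t x => f t x * Lf t x in
  let f_f_x := fun t x => f t x * f_x t x in
  [/\ forall t, 0 <= t -> sobolev 1 (f t),
      [/\ L1_loc_in_time f, L1_loc_in_time f_Lf
        & L1_loc_in_time f_f_x],
      forall phi, test_function phi ->
        Dt (of_fun f) phi + DLambda (of_fun f) phi =
        DLambda (of_fun f_Lf) phi + Dx (of_fun f_f_x) phi &
      ae_equal (f 0) f0].

End Distributions.

(* Curves with values in H^s are given as f : R -> R -> R, [f t] being the
   value at time t. *)
Section Bochner.
Context {R : realType}.
Implicit Types (s T gamma : R) (f g : R -> R -> R).

Notation mu := (@lebesgue_measure R).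

Definition holder_in_time gamma T s f : Prop :=
  (forall t, 0 <= t < T -> sobolev s (f t)) /\
  exists K : R, forall t t', 0 <= t < T -> 0 <= t' < T ->
    sobolev_norm s (f t \- f t') <= K * `|t - t'| `^ gamma.

Definition simple_curve s g : Prop :=
  exists (m : nat) (A : 'I_m -> set R) (u : 'I_m -> R -> R),
    (forall i, measurable (A i) /\ sobolev s (u i)) /\
    forall t x, g t x = \sum_(i < m) \1_(A i) t * u i x.

Definition bochner_measurable T s f : Prop :=
  {ae mu, forall t, 0 <= t < T -> sobolev s (f t)} /\
  exists g : nat -> R -> R -> R, (forall n, simple_curve s (g n)) /\
    {ae mu, forall t, 0 <= t < T ->
       (fun n => sobolev_norm2 s (g n t \- f t)) @ \oo --> 0%E}.

Definition Linfty_in_time T s f : Prop :=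
  bochner_measurable T s f /\
  exists K : R, {ae mu, forall t, 0 <= t < T -> sobolev_norm s (f t) <= K}.

Definition L2_in_time T s f : Prop :=
  bochner_measurable T s f /\
  (\int[mu]_(t in `[0%R, T[) sobolev_norm2 s (f t) < +oo)%E.

Definition solution_class (eps : R) f : Prop :=
  forall T, 0 < T ->
    [/\ forall theta, (2 * (eps + 1))^-1 <= theta -> theta < 2^-1 ->
          holder_in_time (2^-1 - theta) T (1 + theta * (eps + 1)) f,
        Linfty_in_time T (3 / 2 + eps) f &
        L2_in_time T (2 + eps) f].

End Bochner.

(* Main.v *)
(* Write f as a sum over n > 0 of x_{0,n} cos nx + x_{1,n} sin nx.  The addition
   formulas show that only pairs of frequencies m, m + n contribute to mode n of
   Lambda (f Lambda f) + (f f_x)_x, and the equation becomes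
     x_{b,n}' = n (N_{b,n}(x) - x_{b,n}),
     N_{b,n}(x) = sum_m m (x_{0,m} x_{b,m+n} + (-1)^b x_{1,m} x_{1-b,m+n}).

   The hypothesis on f_0 makes sum_n n |x_n(0)| small: by Cauchy-Schwarz and
   interpolation its square is at most a constant times the product of the two
   Sobolev norms, and y log y + 1 >= y.  Since damping and nonlinearity carry
   the same factor n, Duhamel's formula loses nothing, and Picard iteration
   converges under the time-independent majorants
     A^{k+1}_n = |x_n(0)| + 2 sum_m m A^k_m A^k_{m+n}.
   As the indices m + n exceed n, Young's inequality bounds the limit A in every
   weighted l^2 space with nondecreasing weights, hence f in L^oo H^{3/2+eps};
   |x_n(t) - x_n(t')| <= 2 A_n min(1, n |t - t'|) gives the Hoelder bounds, and
   the energy identity mode by mode gives L^2 H^{2+eps}.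

   For uniqueness, testing the weak formulation against chi(t) cos nx and
   chi(t) sin nx shows that the coefficients of any solution of the class solve
   the same system.  With d the difference of two solutions and la large, the
   quantity sum_n n int e^{-la t} |d_n| is at most 3/4 of itself. *)
Require Import Defs.
From mathcomp Require Import all_boot all_order all_algebra.
From mathcomp Require Import all_classical all_reals all_analysis.
From mathcomp.real_closed Require Import complex.
From mathcomp Require Import measurable_realfun.
From mathcomp Require Import ring lra.
Import Order.TTheory GRing.Theory Num.Theory.
Import numFieldNormedType.Exports.
Local Open Scope classical_set_scope.
Local Open Scope ring_scope.
Set Implicit Arguments.
Unset Strict Implicit.
Unset Printing Implicit Defensive.

(** * Series *)

(** The majorant recursion sends a bound a of sum_n n A_n to de + 2 a^2, so [0, 2 de] is preserved
    as soon as 8 de <= 1; this 8 is what the constant C has to secure. The resulting bound a = 1/4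
    is used twice more, in the energy estimate and for uniqueness.

    Two obstacles shape the rest. A quantity absorbed into itself must first be known to be finite;
    hence a priori bounds precede each absorption. And a competing solution carries neither
    smallness nor a time-independent majorant: all that is drawn from the class is the Hoelder
    clause, with theta strictly between its bounds, which controls H^s for some s > 3/2 at every
    time and makes each mode continuous. The room above 3/2 is an extra factor n^rho, and the weight
    e^(-la t) turns the factor n of the equation into n^2 / (n + la); a large la makes the part
    without smallness cost 1/8, the small part costs a = 1/4, and 3/4 = 2 (1/8 + 1/4).

    [Lambda] and [weak_deriv] are chosen separately at each time and only up to null sets, so
    integrals are transferred to explicit series before anything is said about the dependence on
    time. *)

Section Series.
Context {R : realType}.
Implicit Types (u v a b : nat -> R) (B r : R).

Definition tsum u : R := limn (series u).
(** For nonnegative terms this is summability with an explicit bound. Being a condition on partial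
    sums only, it passes through termwise limits and finite interchanges of sums. *)
Definition sumby u B : Prop := forall N, series u N <= B.

Lemma seriesE u N : series u N = \sum_(k < N) u k.
Proof. by rewrite /series/= big_mkord. Qed.

Lemma seriesrS u N : series u N.+1 = series u N + u N.
Proof. by rewrite !seriesE big_ord_recr. Qed.

Lemma series0n u : series u 0 = 0.
Proof. by rewrite seriesE big_ord0. Qed.

Lemma sumby_ge0 u B : sumby u B -> 0 <= B.
Proof. by move=> /(_ 0%N); rewrite series0n. Qed.

Lemma series_ge0 u N : (forall n, 0 <= u n) -> 0 <= series u N.
Proof. by move=> u0; rewrite seriesE sumr_ge0. Qed.

Lemma ler_series u v N : (forall n, u n <= v n) -> series u N <= series v N.
Proof. by move=> uv; rewrite !seriesE ler_sum. Qed.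

Lemma sumby_le u v B : (forall n, u n <= v n) -> sumby v B -> sumby u B.
Proof. by move=> uv vB N; apply: le_trans (vB N); exact: ler_series. Qed.

Lemma sumbyZ u B r : 0 <= r -> sumby u B -> sumby (fun n => r * u n) (r * B).
Proof. by move=> r0 uB N; rewrite seriesE -mulr_sumr -seriesE ler_wpM2l. Qed.

Lemma sumbyD u v B B' : sumby u B -> sumby v B' ->
  sumby (fun n => u n + v n) (B + B').
Proof. by move=> uB vB N; rewrite seriesE big_split -!seriesE lerD. Qed.

Lemma sumby_cvg u B : (forall n, 0 <= u n) -> sumby u B -> cvgn (series u).
Proof.
move=> u0 uB; apply: nondecreasing_is_cvgn.
  by apply/nondecreasing_seqP => n; rewrite seriesrS lerDl.
by exists B => _ [n _ <-].
Qed.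

Lemma le_series_tsum u B N : (forall n, 0 <= u n) -> sumby u B ->
  series u N <= tsum u.
Proof.
move=> u0 uB; apply: nondecreasing_cvgn_le (sumby_cvg u0 uB) _.
by apply/nondecreasing_seqP => n; rewrite seriesrS lerDl.
Qed.

Lemma tsum_le u B : cvgn (series u) -> sumby u B -> tsum u <= B.
Proof. by move=> cu uB; apply: limr_le => //; exact: nearW. Qed.

Lemma term_le_sumby u B n : (forall n, 0 <= u n) -> sumby u B -> u n <= B.
Proof.
move=> u0 uB; apply: le_trans (uB n.+1).
by rewrite seriesrS lerDr series_ge0.
Qed.

Lemma dom_cvg u v B : (forall n, `|u n| <= v n) -> sumby v B ->
  cvgn (series u).
Proof.
move=> uv vB; apply: normed_cvg; apply: (@sumby_cvg _ B) => [n|].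
  exact: normr_ge0.
exact: sumby_le vB.
Qed.

Lemma dom_tail u v B N : (forall n, `|u n| <= v n) -> sumby v B ->
  `|tsum u - series u N| <= tsum v - series v N.
Proof.
move=> uv vB; have v0 n : 0 <= v n by apply: le_trans (uv n).
have cu := dom_cvg uv vB; have cv := sumby_cvg v0 vB.
have cu' : (fun M => `|series u M - series u N|) @ \oo --> `|tsum u - series u N|.
  by apply: cvg_norm; apply: cvgB => //; exact: cvg_cst.
have cv' : (fun M => series v M - series v N) @ \oo --> tsum v - series v N.
  by apply: cvgB => //; exact: cvg_cst.
rewrite -(cvg_lim _ cu')// -(cvg_lim _ cv')//.
apply: ler_lim; [exact: cvgP cu'|exact: cvgP cv'|].
exists N => // M /= NM; rewrite !sub_series_geq//.
by apply: le_trans (ler_norm_sum _ _ _) _; exact: ler_sum.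
Qed.

Lemma tsum_norm u v B : (forall n, `|u n| <= v n) -> sumby v B ->
  `|tsum u| <= tsum v.
Proof. by move=> uv vB; have := dom_tail 0 uv vB; rewrite !series0n !subr0. Qed.

Lemma tsum_norm_le u v B : (forall n, `|u n| <= v n) -> sumby v B ->
  `|tsum u| <= B.
Proof.
move=> uv vB; apply: le_trans (tsum_norm uv vB) _; apply: tsum_le => //.
by apply: sumby_cvg vB => n; exact: le_trans (uv n).
Qed.

Lemma tsumB u v : cvgn (series u) -> cvgn (series v) ->
  tsum (fun n => u n - v n) = tsum u - tsum v.
Proof. exact: lim_seriesB. Qed.

Lemma tsumZ r u : cvgn (series u) -> tsum (fun n => r * u n) = r * tsum u.
Proof.
move=> cu; apply: cvg_lim => //.
rewrite (_ : series _ = fun N => r * series u N); last first.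
  by apply/funext => N; rewrite !seriesE mulr_sumr.
exact: cvgMl_tmp.
Qed.

Lemma eq_tsum u v : u =1 v -> tsum u = tsum v.
Proof. by move=> /funext ->. Qed.

Lemma tsum_single n u : (forall k, k != n -> u k = 0) -> tsum u = u n.
Proof.
move=> u0; apply: cvg_lim => //; apply: cvg_near_cst.
exists n.+1 => // N /= nN; rewrite seriesE (bigD1 (Ordinal nN))//= big1 ?addr0//.
by move=> i iN; apply: u0; apply: contra iN => /eqP iN; apply/eqP/val_inj.
Qed.

Lemma tail_small v B (e : R) : (forall n, 0 <= v n) -> sumby v B -> 0 < e ->
  exists N, forall M, (N <= M)%N -> tsum v - series v M < e.
Proof.
move=> v0 vB e0; have cv := sumby_cvg v0 vB.
have /cvgrPdist_lt/(_ _ e0) [N _ H] : series v @ \oo --> tsum v by [].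
by exists N => M NM; apply: le_lt_trans (H M NM); exact: ler_norm.
Qed.

(** Weierstrass test. The domain is a general topological space because it serves both for functions
    of time or space alone and for series in (t, x) jointly. *)
Lemma mtest_continuous (T : topologicalType) (f : nat -> T -> R) v B :
  (forall n, continuous (f n)) -> (forall n x, `|f n x| <= v n) ->
  sumby v B -> continuous (fun x => tsum (f^~ x)).
Proof.
move=> cf fv vB x.
have v0 n : 0 <= v n by apply: le_trans (fv n x).
have cser N : continuous (fun y => series (f^~ y) N).
  elim: N => [|N IH] y.
    under eq_fun do rewrite series0n; exact: cvg_cst.
  under eq_fun do rewrite seriesrS; apply: cvgD; [exact: IH|exact: cf].
apply/cvgrPdist_lt => e e0.
have e3 : 0 < e / 3 by rewrite divr_gt0.
have [N /(_ N (leqnn N)) HN] := tail_small v0 vB e3.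
have /cvgrPdist_lt/(_ _ e3) := cser N x.
apply: filterS => y /= Hy.
have H z : `|tsum (f^~ z) - series (f^~ z) N| < e / 3.
  by apply: le_lt_trans HN; apply: dom_tail vB.
have := H x; have := H y; move: Hy.
set a := tsum _; set b := tsum _; set a' := series _ _; set b' := series _ _.
rewrite !ltr_norml => /andP[? ?] /andP[? ?] /andP[? ?]; apply/andP; split; lra.
Qed.

(** Fatou's lemma for sequences. It removes the truncation from estimates proved on finite double
    sums. *)
Lemma sumby_lim (u_ : nat -> nat -> R) u B :
  (forall n, u_^~ n @ \oo --> u n) -> (forall k, sumby (u_ k) B) -> sumby u B.
Proof.
move=> cu uB N; have c : (fun k => series (u_ k) N) @ \oo --> series u N.
  elim: N => [|N IH].
    under eq_fun do rewrite series0n; rewrite series0n; exact: cvg_cst.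
  by under eq_fun do rewrite seriesrS; rewrite seriesrS; exact: cvgD.
rewrite -(cvg_lim _ c)//; apply: limr_le; first exact: cvgP c.
by apply: nearW => k; exact: uB.
Qed.

Lemma weighted_cauchy_schwarz (w c : nat -> R) M : (forall n, 0 <= w n) ->
  (series (fun n => w n * c n) M) ^+ 2 <=
  series w M * series (fun n => w n * c n ^+ 2) M.
Proof.
move=> w0; elim: M => [|M IH]; first by rewrite !series0n expr0n/= mul0r.
rewrite !seriesrS; move: IH.
have : 0 <= series w M by exact: series_ge0.
have : 0 <= series (fun n => w n * c n ^+ 2) M.
  by apply: series_ge0 => n; rewrite mulr_ge0// sqr_ge0.
move: (w0 M); move: (series _ M) (series w M) (series _ M) (w M) (c M).
move=> b a d x y x0 d0 a0 bad.
(* The inductive step reduces to this quadratic in y, nonnegative because its discriminant b^2 - a d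
   is at most 0; if a = 0 then b = 0 as well. *)
have H : 0 <= x * (a * y ^+ 2 - 2 * (b * y) + d).
  apply: mulr_ge0 => //; have [a1|a1] := ltP 0 a.
    rewrite -(pmulr_rge0 _ a1); have := sqr_ge0 (a * y - b); nra.
  have a2 : a = 0 by apply: le_anti; rewrite a0 a1.
  have b2 : b = 0.
    by apply/eqP; rewrite -sqrf_eq0 eq_le sqr_ge0 andbT (le_trans bad)// a2 mul0r.
  by rewrite a2 b2 !mul0r mulr0 subr0 add0r.
nra.
Qed.

Lemma cauchy_schwarz_series a b M :
  (series (fun n => a n * b n) M) ^+ 2 <=
  series (fun n => a n ^+ 2) M * series (fun n => b n ^+ 2) M.
Proof.
rewrite !seriesE; elim: M => [|M IH]; first by rewrite !big_ord0 expr0n/= mul0r.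
rewrite !big_ord_recr/=; move: IH.
have : 0 <= \sum_(i < M) a i ^+ 2 by apply: sumr_ge0 => i _; exact: sqr_ge0.
have : 0 <= \sum_(i < M) b i ^+ 2 by apply: sumr_ge0 => i _; exact: sqr_ge0.
set A := \sum_(i < M) a i ^+ 2; set D := \sum_(i < M) b i ^+ 2.
set Q := \sum_(i < M) _; move: (a M) (b M) => x y D0 A0 QAD.
suff : 2 * (Q * x * y) <= A * y ^+ 2 + D * x ^+ 2 by nra.
suff H : `|Q * x * y| * 2 <= A * y ^+ 2 + D * x ^+ 2.
  by apply: le_trans H; rewrite mulrC ler_wpM2r// ler_norm.
have H1 : (2 * `|Q * x * y|) ^+ 2 <= (A * y ^+ 2 + D * x ^+ 2) ^+ 2.
  rewrite exprMn real_normK ?num_real//.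
  have := sqr_ge0 (A * y ^+ 2 - D * x ^+ 2).
  have : Q ^+ 2 * (x * y) ^+ 2 <= A * D * (x * y) ^+ 2.
    by rewrite ler_wpM2r// sqr_ge0.
  nra.
have H2 : 0 <= A * y ^+ 2 + D * x ^+ 2.
  by apply: addr_ge0; apply: mulr_ge0 => //; exact: sqr_ge0.
have H3 : 0 <= 2 * `|Q * x * y| by rewrite mulr_ge0.
by rewrite mulrC -ler_sqr.
Qed.

Lemma shift_sumby (v : nat -> R) B m : (forall n, 0 <= v n) -> sumby v B ->
  sumby (fun n => v (m + n)%N) B.
Proof.
move=> v0 vB N; apply: le_trans (vB (m + N)%N).
elim: N => [|N IH]; first by rewrite series0n series_ge0.
by rewrite addnS !seriesrS lerD2r.
Qed.

(** Cauchy-Schwarz in m with respect to the weights m A_m, of total mass at most a, then exchange of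
    the sums. Monotonicity of W moves the weight from n to m + n, where D lives, and the shifted sum
    is at most B. Both sums are truncated, so no convergence is involved. *)
Lemma young_l2 (W A D : nat -> R) (a B : R) M N :
  (forall n, 0 <= W n) -> (forall m n, W n <= W (m + n)%N) ->
  (forall n, 0 <= A n) -> sumby (fun m => m%:R * A m) a ->
  sumby (fun n => W n * D n ^+ 2) B ->
  series (fun n => W n * (series (fun m => m%:R * A m * D (m + n)%N) M) ^+ 2) N
  <= a ^+ 2 * B.
Proof.
move=> W0 Wm A0 Aa DB; have a0 := sumby_ge0 Aa; have B0 := sumby_ge0 DB.
have mA0 m : 0 <= m%:R * A m by rewrite mulr_ge0.
have WD0 n : 0 <= W n * D n ^+ 2 by rewrite mulr_ge0// sqr_ge0.
apply: (@le_trans _ _ (series (fun n => a *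
    (series (fun m => m%:R * A m * (W (m + n)%N * D (m + n)%N ^+ 2)) M)) N)).
  apply: ler_series => n.
  apply: (@le_trans _ _ (W n * (series (fun m => m%:R * A m) M *
      series (fun m => m%:R * A m * D (m + n)%N ^+ 2) M))).
    by rewrite ler_wpM2l// weighted_cauchy_schwarz.
  rewrite mulrCA; apply: ler_pM => //; first exact: series_ge0.
    rewrite mulr_ge0//; apply: series_ge0 => m.
    by rewrite mulr_ge0// sqr_ge0.
  rewrite !seriesE mulr_sumr ler_sum// => m _.
  by rewrite mulrCA ler_wpM2l// ler_wpM2r// sqr_ge0.
rewrite [X in X <= _]seriesE -mulr_sumr expr2 -mulrA ler_wpM2l//.
under eq_bigr do rewrite seriesE.
rewrite exchange_big/=.
apply: (@le_trans _ _ (\sum_(m < M) m%:R * A m * B)); last first.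
  by rewrite -mulr_suml -(seriesE (fun m => m%:R * A m)) ler_wpM2r.
apply: ler_sum => m _; rewrite -mulr_sumr ler_wpM2l//.
rewrite -(seriesE (fun i => W (m + i)%N * D (m + i)%N ^+ 2)).
exact: (@shift_sumby (fun n => W n * D n ^+ 2)).
Qed.

(** The factor n is at most m + n, so it can be charged to D at the higher index. *)
Lemma young_l1 (A D : nat -> R) (a d : R) M N :
  (forall n, 0 <= A n) -> (forall n, 0 <= D n) ->
  sumby (fun m => m%:R * A m) a -> sumby (fun m => m%:R * D m) d ->
  series (fun n => n%:R * series (fun m => m%:R * A m * D (m + n)%N) M) N
  <= a * d.
Proof.
move=> A0 D0 Aa Dd; have d0 := sumby_ge0 Dd.
have mA0 m : 0 <= m%:R * A m by rewrite mulr_ge0.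
rewrite seriesE; under eq_bigr do rewrite seriesE mulr_sumr.
rewrite exchange_big/=.
apply: (@le_trans _ _ (\sum_(m < M) m%:R * A m * d)); last first.
  by rewrite -mulr_suml -(seriesE (fun m => m%:R * A m)) ler_wpM2r.
apply: ler_sum => m _; under eq_bigr do rewrite mulrCA.
rewrite -mulr_sumr ler_wpM2l//.
apply: (@le_trans _ _ (\sum_(i < N) (m + i)%:R * D (m + i)%N)).
  by apply: ler_sum => i _; rewrite ler_wpM2r// ler_nat leq_addl.
rewrite -(seriesE (fun i => (m + i)%:R * D (m + i)%N)).
by apply: (@shift_sumby (fun n => n%:R * D n)) => // n; rewrite mulr_ge0.
Qed.

(* Telescoping: r / n ^ (1 + r) <= (n - 1) ^ - r - n ^ - r. *)
Lemma pseries_sumby r : 0 < r ->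
  sumby (fun n => n%:R `^ (- (1 + r))) (1 + r^-1).
Proof.
move=> r0.
have step n : r * n.+2%:R `^ (- (1 + r)) <= n.+1%:R `^ (- r) - n.+2%:R `^ (- r).
  have n1 : 0 < n.+1%:R :> R by [].
  have n2 : 0 < n.+2%:R :> R by [].
  (* After division by (n + 2)^-r the claim reads r y <= (1 - y)^-r - 1 with y = 1 / (n + 2); it
     follows from ln (1 - y) <= - y and 1 + x <= exp x. *)
  have -> : n.+1%:R = n.+2%:R * (1 - n.+2%:R^-1) :> R.
    by rewrite mulrBr mulr1 divff// -[in X in _ = X - _]natr1 addrK.
  have y1 : 0 < 1 - n.+2%:R^-1 :> R.
    by rewrite subr_gt0 invf_lt1// ltr1n.
  rewrite powRM ?(ltW y1)//.
  rewrite (_ : - (1 + r) = - r + - 1); last by ring.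
  rewrite powRD; last by rewrite pnatr_eq0 implybT.
  rewrite powR_inv1// mulrCA -[X in _ <= _ - X]mulr1 -mulrBr ler_wpM2l ?powR_ge0//.
  rewrite /powR gt_eqF//.
  apply: (@le_trans _ _ (- r * ln (1 - n.+2%:R^-1))).
    rewrite mulNr -mulrN ler_wpM2l ?(ltW r0)//.
    rewrite lerNr; apply: le_trans (le_ln1Dx _) _ => //.
    by rewrite ltrN2 invf_lt1// ltr1n.
  by rewrite lerBrDl expR_ge1Dx.
(* The terms 0 and 1 are set apart: the first is 0, the second is the 1 of the bound, and the
   telescoping starts at 2. *)
suff H N : series (fun n => n%:R `^ (- (1 + r))) N.+2 <=
    1 + r^-1 * (1 - N.+1%:R `^ (- r)).
  move=> N; have : series (fun n => n%:R `^ (- (1 + r))) N <=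
      series (fun n => n%:R `^ (- (1 + r))) N.+2.
    by rewrite !seriesrS -addrA lerDl addr_ge0// powR_ge0.
  move/le_trans; apply; apply: le_trans (H N) _.
  by rewrite lerD2l ler_piMr ?invr_ge0 ?(ltW r0)// gerBl powR_ge0.
elim: N => [|N IH].
  rewrite !seriesrS series0n add0r powR0 ?lt_eqF//; last lra.
  by rewrite !powR1 subrr mulr0 add0r addr0.
rewrite seriesrS; apply: le_trans (lerD IH (lexx _)) _.
rewrite -addrA lerD2l -lerBrDl -mulrBr.
by rewrite ler_pdivlMl// (le_trans (step N))//; lra.
Qed.

End Series.

(** * Integration on the line *)

Section Integration.
Context {R : realType}.
Notation mu := (@lebesgue_measure R).
Implicit Types (D : set R) (f g u w : R -> R) (K : R).

Notation integrable_on D f := (mu.-integrable D (EFin \o f)).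

Lemma ae_imp (P Q : R -> Prop) : (forall x, P x -> Q x) ->
  {ae mu, forall x, P x} -> {ae mu, forall x, Q x}.
Proof.
move=> PQ; apply: negligibleS => x /= nQ Px; exact/nQ/PQ.
Qed.

Lemma ae_and (P Q : R -> Prop) : {ae mu, forall x, P x} ->
  {ae mu, forall x, Q x} -> {ae mu, forall x, P x /\ Q x}.
Proof.
move=> aP aQ; rewrite /almost_everywhere.
apply: negligibleS (negligibleU aP aQ) => x /= nPQ.
by apply: contrapT => /not_orP[/contrapT Px /contrapT Qx]; exact: nPQ.
Qed.

Lemma integrable_meas D f : integrable_on D f -> measurable_fun D f.
Proof. by move=> /measurable_int/measurable_EFinP. Qed.

Lemma mEFin D f : measurable_fun D f ->
  measurable_fun (D : set (measurableTypeR R)) (EFin \o f).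
Proof. by move=> mf; apply/measurable_EFinP. Qed.

Lemma integrable_dom D f g : measurable D -> measurable_fun D f ->
  (forall x, D x -> `|f x| <= g x) -> integrable_on D g -> integrable_on D f.
Proof.
move=> mD mf fg ig; apply: le_integrable ig => //; first exact: mEFin.
move=> x Dx /=; rewrite lee_fin; apply: le_trans (fg _ Dx) _; exact: ler_norm.
Qed.

Lemma integrableZ D f K : measurable D -> integrable_on D f ->
  integrable_on D (fun x => K * f x).
Proof. by move=> mD fi; have := @integrableZl _ (measurableTypeR R) _ mu D mD K _ fi. Qed.

Lemma integrable_add D f g : measurable D -> integrable_on D f ->
  integrable_on D g -> integrable_on D (fun x => f x + g x).
Proof.
by move=> mD fi gi; have := @integrableD _ (measurableTypeR R) _ mu D mD _ _ fi gi.
Qed.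

Lemma integrable_sub D f g : measurable D -> integrable_on D f ->
  integrable_on D g -> integrable_on D (fun x => f x - g x).
Proof.
by move=> mD fi gi; have := @integrableB _ (measurableTypeR R) _ mu D mD _ _ fi gi.
Qed.

Lemma integrable_norm D f : integrable_on D f ->
  integrable_on D (fun x => `|f x|).
Proof. by move=> /integrable_abse. Qed.

Lemma integrable_mul_bounded D u w K : measurable D -> integrable_on D u ->
  measurable_fun D w -> (forall x, D x -> `|w x| <= K) ->
  integrable_on D (fun x => u x * w x).
Proof.
move=> mD iu mw wK; apply: (@integrable_dom _ _ (fun x => K * `|u x|)) => //.
- by apply: measurable_funM => //; exact: integrable_meas.
- by move=> x Dx; rewrite normrM mulrC ler_wpM2r ?wK.
- by apply: integrableZ => //; exact: integrable_norm.
Qed.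

Lemma Rdominated_convergence D (f_ : nat -> R -> R) f g : measurable D ->
  (forall n, measurable_fun D (f_ n)) -> measurable_fun D f ->
  {ae mu, forall x, D x -> f_ ^~ x @ \oo --> f x} ->
  integrable_on D g -> (forall n x, D x -> `|f_ n x| <= g x) ->
  integrable_on D f /\
  (fun n => \int[mu]_(x in D) f_ n x) @ \oo --> \int[mu]_(x in D) f x.
Proof.
move=> mD mf_ mf cf ig fg.
have [||||| i _ c] := @dominated_convergence _ (measurableTypeR R) _ mu D mD
  (fun n => EFin \o f_ n) (EFin \o f) (EFin \o g).
- by move=> n; exact: mEFin.
- exact: mEFin.
- by apply: ae_imp cf => x /[apply] cx; apply/fine_cvgP; split; [exact: nearW|].
- exact: ig.
- by apply: aeW => x n Dx; rewrite lee_fin fg.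
split=> //; have /fine_cvgP[_] : (fun n => \int[mu]_(x in D) (f_ n x)%:E)%E @ \oo -->
    (\int[mu]_(x in D) f x)%:E.
  by rewrite /Rintegral fineK; [exact: c|exact: integrable_fin_num].
by [].
Qed.

(** Dominated convergence for the partial sums, with majorant B |g|. The product form of the
    domination lets g be an integrable function or a constant while v carries the summability. *)
Lemma Rintegral_tsum D (f : nat -> R -> R) (v : nat -> R) B g : measurable D ->
  (forall n, measurable_fun D (f n)) ->
  (forall n x, D x -> `|f n x| <= v n * g x) -> (forall n, 0 <= v n) ->
  sumby v B -> integrable_on D g ->
  integrable_on D (fun x => tsum (f^~ x)) /\
  \int[mu]_(x in D) tsum (f^~ x) = tsum (fun n => \int[mu]_(x in D) f n x).
Proof.
move=> mD mf fv v0 vB ig.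
have g0 x n : D x -> 0 <= v n * g x by move=> Dx; apply: le_trans (fv n x Dx).
have mS N : measurable_fun D (fun x => series (f^~ x) N).
  elim: N => [|N IH]; first by under eq_fun do rewrite series0n; exact: measurable_cst.
  by under eq_fun do rewrite seriesrS; exact: measurable_funD.
have vgB x : D x -> sumby (fun n => v n * g x) (B * `|g x|).
  move=> Dx; apply: (@sumby_le _ _ (fun n => `|g x| * v n)) => [n|].
    by rewrite mulrC ler_wpM2r// ler_norm.
  by rewrite mulrC; exact: sumbyZ.
have fi n : integrable_on D (f n).
  by apply: integrable_dom (fv n) _ => //; exact: integrableZ.
have cS x : D x -> series (f^~ x) @ \oo --> tsum (f^~ x).
  by move=> Dx; apply: (@dom_cvg _ _ (fun n => v n * g x) (B * `|g x|)) => // n;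
    [exact: fv|exact: vgB].
have [||||| i c] := @Rdominated_convergence D (fun N x => series (f^~ x) N)
  (fun x => tsum (f^~ x)) (fun x => B * `|g x|) mD.
- exact: mS.
- by apply: (@measurable_fun_cvg _ _ _ D (fun N x => series (f^~ x) N)).
- by apply: aeW => x Dx; exact: cS.
- by apply: integrableZ => //; exact: integrable_norm.
- move=> N x Dx; apply: le_trans (vgB x Dx N); rewrite !seriesE.
  by apply: le_trans (ler_norm_sum _ _ _) _; apply: ler_sum => n _; exact: fv.
split=> //; apply/esym; apply: cvg_lim => //.
rewrite (_ : series _ = fun N => \int[mu]_(x in D) series (f^~ x) N)//.
apply/funext; elim=> [|N IH].
  rewrite series0n; under eq_Rintegral do rewrite series0n.
  by rewrite Rintegral_cst// mul0r.
rewrite seriesrS IH; under [RHS]eq_Rintegral do rewrite seriesrS.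
rewrite RintegralD//.
apply: (@integrable_dom _ _ (fun x => B * `|g x|)) => //.
  move=> x Dx; apply: le_trans (vgB x Dx N); rewrite !seriesE.
  by apply: le_trans (ler_norm_sum _ _ _) _; apply: ler_sum => n _; exact: fv.
by apply: integrableZ => //; exact: integrable_norm.
Qed.

Lemma ae_Rintegral D f g : measurable D -> measurable_fun D f ->
  measurable_fun D g -> {ae mu, forall x, D x -> f x = g x} ->
  \int[mu]_(x in D) f x = \int[mu]_(x in D) g x.
Proof.
move=> mD mf mg fg; congr fine; apply: ae_eq_integral => //.
- exact: mEFin.
- exact: mEFin.
by apply: ae_imp fg => x /= H Dx; rewrite H.
Qed.

Lemma continuous_meas D f : measurable D -> continuous f -> measurable_fun D f.
Proof.
move=> mD cf; apply: measurable_funS (continuous_measurable_fun cf) => //.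
Qed.

Lemma continuous_integrable_itv f (a b : R) : continuous f ->
  integrable_on `[a, b] f.
Proof.
move=> cf; apply: continuous_compact_integrable; first exact: segment_compact.
exact: continuous_subspaceT.
Qed.

(** Translation invariance, from the uniqueness of Lebesgue measure: the translated measure has the
    same values on half-open intervals. *)
Lemma translate_negligible (A : set R) (c : R) :
  mu.-negligible A -> mu.-negligible [set x | A (x - c)].
Proof.
move=> [B [mB B0 AB]]; exists [set x | B (x - c)].
have mt (r : R) : measurable_fun setT ((fun x => x + r) : R -> measurableTypeR R).
  by apply: continuous_meas => // x; apply: cvgD; [exact: cvg_id|exact: cvg_cst].
split; last by move=> x /= /AB.
- by rewrite -[X in measurable X]setTI; exact: mt.
rewrite -B0; apply/esym.
pose m : {measure set (measurableTypeR R) -> \bar R} :=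
  @pushforward _ _ (measurableTypeR R) (measurableTypeR R) _ mu (fun x => x - c).
apply: (@lebesgue_measure_unique R (m (mt (- c)))) => // _ [[a b] _ <-].
rewrite /m/= /pushforward.
rewrite (_ : (fun x => x - c) @^-1` _ = `]a + c, b + c]%classic).
  rewrite !lebesgue_measure_itv/= !lte_fin ltrD2r -!EFinB.
  by rewrite (_ : b + c - (a + c) = b - a)//; ring.
by apply/seteqP; split=> x /=; rewrite !in_itv/= ltrBrDr lerBlDr.
Qed.

Lemma ae_translate (P : R -> Prop) (c : R) : {ae mu, forall x, P x} ->
  {ae mu, forall x, P (x - c)}.
Proof. by move=> aP; exact: (@translate_negligible (~` [set x | P x]) c). Qed.

Lemma periodicZ f (T : R) : periodic f T -> forall (z : int) x, f (x + z%:~R * T) = f x.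
Proof.
move=> pf [n|n] x.
  by rewrite -pmulrn mulr_natl periodicn.
by rewrite NegzE mulrNz mulNr -pmulrn mulr_natl -[in RHS](subrK (T *+ n.+1) x) periodicn.
Qed.

(** The exceptional set on the line is covered by the translates, by multiples of 2 pi, of the
    exceptional set of one period. The two unions are over the nonnegative and the nonpositive
    multiples. *)
Lemma ae_periodic u v : periodic u (pi *+ 2) -> periodic v (pi *+ 2) ->
  {ae mu, forall x, period x -> u x = v x} -> ae_equal u v.
Proof.
move=> pu pv uv.
have T0 : 0 < pi *+ 2 :> R by rewrite pmulrn_lgt0// pi_gt0.
pose A (c : R) : set R := [set x | ~ (period (x - c) -> u (x - c) = v (x - c))].
have An c : mu.-negligible (A c) by exact: ae_translate uv.
have H1 := @negligible_bigcup _ _ _ mu (fun n : nat => A (n%:R * (pi *+ 2))) (fun n => An _).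
have H2 := @negligible_bigcup _ _ _ mu (fun n : nat => A (- (n%:R * (pi *+ 2)))) (fun n => An _).
rewrite /ae_equal /almost_everywhere.
apply: negligibleS (negligibleU H1 H2) => x /= nuv.
have [z zx] : exists z : int, period (x - z%:~R * (pi *+ 2)).
  exists (Num.floor (x / (pi *+ 2))); rewrite /period/= in_itv/=.
  set z := Num.floor _; have /andP[z1 z2] : z%:~R <= x / (pi *+ 2) < z%:~R + 1.
    by rewrite -(intrD _ z 1) ge_floor lt_succ_floor.
  rewrite ler_pdivlMr// in z1; rewrite ltr_pdivrMr// mulrDl mul1r in z2.
  by rewrite subr_ge0 z1 lerBlDl ltW.
have ne : ~ (period (x - z%:~R * (pi *+ 2)) ->
    u (x - z%:~R * (pi *+ 2)) = v (x - z%:~R * (pi *+ 2))).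
  move=> /(_ zx) e; apply: nuv; move: e.
  by rewrite -mulNr -mulrNz !periodicZ.
case: z zx ne => n zx ne; first by left; exists n.
right; exists n.+1 => //; move: ne.
by rewrite /A/= NegzE mulrNz mulNr.
Qed.

End Integration.

(** * Trigonometric functions *)

Section Calculus.
Context {R : realType}.
Notation mu := (@lebesgue_measure R).
Implicit Types f F : R -> R.

Lemma is_derive_continuous f (x df : R) : is_derive x 1 f df ->
  {for x, continuous f}.
Proof. by case=> df1 _; apply: differentiable_continuous; exact/derivable1_diffP. Qed.

Lemma Rintegral_ftc f F (a b : R) : a <= b ->
  (forall x, a < x < b -> is_derive x 1 F (f x)) -> continuous F ->
  continuous f -> \int[mu]_(x in `[a, b]) f x = F b - F a.
Proof.
rewrite le_eqVlt => /predU1P[-> _ _ _|ab dF cF cf].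
  by rewrite set_itv1 Rintegral_set1 subrr.
rewrite /Rintegral (@continuous_FTC2 _ _ F)//.
- exact: continuous_subspaceT.
- split; [|by apply: cvg_at_right_filter; exact: cF
          |by apply: cvg_at_left_filter; exact: cF].
  by move=> x; rewrite in_itv/= => /dF[].
- by move=> x; rewrite in_itv/= => /dF[_ <-]; rewrite derive1E.
Qed.

End Calculus.

Section Trig.
Context {R : realType}.
Notation mu := (@lebesgue_measure R).
Implicit Types (u v w : R -> R) (c : bool -> nat -> R).
Notation integrable_on D f := (mu.-integrable D (EFin \o f)).

Definition tb (b : bool) (n : nat) (x : R) : R :=
  if b then sin (n%:R * x) else cos (n%:R * x).

(** Sines as shifted cosines: the boolean becomes a phase, so that both families are treated by one
    computation. *)
Lemma tb_phase b n x : tb b n x = cos (n%:R * x - b%:R * (pi / 2)).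
Proof.
case: b => /=; last by rewrite mul0r subr0.
by rewrite mul1r cosB cos_pihalf sin_pihalf mulr0 add0r mulr1.
Qed.

Lemma measurable_period : measurable (period : set R).
Proof. exact: measurable_itv. Qed.

Lemma continuous_phase (a th : R) : continuous (fun x : R => cos (a * x + th)).
Proof.
move=> x; apply: (@continuous_comp _ _ _ (fun x => a * x + th) cos).
  by apply: cvgD; [apply: cvgMl_tmp; exact: cvg_id|exact: cvg_cst].
exact: continuous_cos.
Qed.

Lemma continuous_tb b n : continuous (tb b n).
Proof.
rewrite (_ : tb b n = fun x => cos (n%:R * x + - (b%:R * (pi / 2)))).
  exact: continuous_phase.
by apply/funext => x; rewrite tb_phase.
Qed.

Lemma tb_le1 b n x : `|tb b n x| <= 1.
Proof. by rewrite tb_phase cos_max. Qed.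

Lemma tb_periodic b n : periodic (tb b n) (pi *+ 2).
Proof.
move=> x; rewrite !tb_phase mulrDr addrAC.
by rewrite [X in _ + X]mulr_natl (periodicn (@cosD2pi R)).
Qed.

Lemma integral_phase (a th : R) : a != 0 ->
  \int[mu]_(x in period) cos (a * x + th) =
  (sin (a * (pi *+ 2) + th) - sin th) / a.
Proof.
move=> a0; have T0 : 0 < pi *+ 2 :> R by rewrite pmulrn_lgt0// pi_gt0.
have dF (x : R) : is_derive x 1 (fun x : R => sin (a * x + th) / a) (cos (a * x + th)).
  apply: is_derive_eq; rewrite /GRing.scale/= ?mulr0 ?addr0 ?mulr1 ?add0r.
  by rewrite mulrCA mulVf// mulr1.
rewrite /period (Rintegral_ftc (F := fun x => sin (a * x + th) / a))//.
- by rewrite mulr0 add0r mulrBl.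
- exact: ltW.
- by move=> x; apply: is_derive_continuous (dF x).
- exact: continuous_phase.
Qed.

Lemma integral_cos_nat n (th : R) : (0 < n)%N ->
  \int[mu]_(x in period) cos (n%:R * x + th) = 0.
Proof.
move=> n0; rewrite integral_phase ?pnatr_eq0 -?lt0n//.
by rewrite [X in sin X - _]addrC mulr_natl (periodicn (@sinD2pi R)) subrr mul0r.
Qed.

Definition fc u b n : R := \int[mu]_(x in period) (u x * tb b n x).

Lemma mu_period : mu period = (pi *+ 2 : R)%:E.
Proof.
have T0 : 0 < pi *+ 2 :> R by rewrite pmulrn_lgt0// pi_gt0.
by rewrite /period lebesgue_measure_itv/= lte_fin T0 -EFinB subr0.
Qed.

Lemma integrable_period u : continuous u -> integrable_on period u.
Proof. exact: continuous_integrable_itv. Qed.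

Lemma tb_orthogonal b b' m n : (0 < n)%N ->
  \int[mu]_(x in period) (tb b m x * tb b' n x) =
  if (b == b') && (m == n) then pi else 0.
Proof.
move=> n0;
have prod (x y : R) : cos x * cos y = 2^-1 * cos (x + y) + 2^-1 * cos (x - y).
  by rewrite cosD cosB; lra.
have iph a th : integrable_on period (fun x : R => cos (a * x + th)).
  by apply: integrable_period; exact: continuous_phase.
have mP := measurable_period.
have cph a th : integrable_on period (fun x : R => 2^-1 * cos (a * x + th)).
  exact: integrableZ.
pose sg (b1 : bool) : R := b1%:R * (pi / 2).
have E x : tb b m x * tb b' n x = 2^-1 * cos ((m + n)%:R * x + (- sg b - sg b')) +
   2^-1 * cos ((m%:R - n%:R) * x + (- sg b + sg b')).
  rewrite !tb_phase prod natrD -/(sg b) -/(sg b').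
  by congr (2^-1 * cos _ + 2^-1 * cos _); ring.
under eq_Rintegral do rewrite E.
rewrite RintegralD// !RintegralZl//.
rewrite integral_cos_nat ?addn_gt0 ?n0 ?orbT// mulr0 add0r.
have [mn|mn] := eqVneq m n; rewrite ?andbT ?andbF.
  under eq_Rintegral do rewrite mn subrr mul0r add0r.
  rewrite Rintegral_cst// (_ : fine _ = pi * 2); last first.
    by rewrite mulr_natr; exact: (congr1 fine mu_period).
  rewrite /sg; case: b E => _; case: b' => /=;
  rewrite ?mul1r ?mul0r ?oppr0 ?addr0 ?add0r ?addNr ?cosN ?cos_pihalf ?cos0 ?mul0r ?mulr0//;
  by rewrite mul1r mulrCA mulVf// mulr1.
have [lmn|lmn] := ltnP n m.
  by rewrite -natrB ?(ltnW lmn)// integral_cos_nat ?subn_gt0// mulr0.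
have -> : (fun x : R => cos ((m%:R - n%:R) * x + (- sg b + sg b'))) =
    (fun x : R => cos ((n - m)%:R * x + (sg b - sg b'))).
  by apply/funext => x; rewrite natrB// -cosN; congr cos; ring.
by rewrite integral_cos_nat ?mulr0// subn_gt0 ltn_neqAle mn.
Qed.

End Trig.

(** * Uniqueness of Fourier coefficients *)

Section FourierUniqueness.
Context {R : realType}.
Notation mu := (@lebesgue_measure R).
Notation integrable_on D f := (mu.-integrable D (EFin \o f)).
Implicit Types (u v w : R -> R).

Lemma continuous_itv_bounded w (a b : R) : continuous w ->
  exists2 K, 0 <= K & forall x, a <= x <= b -> `|w x| <= K.
Proof.
move=> cw; have [ab|ba] := leP a b; last first.
  by exists 0 => // x /andP[ax xb]; have := lt_le_trans ba (le_trans ax xb); rewrite ltxx.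
have [|m mab M] := @EVT_max R (fun x => `|w x|) a b ab.
  apply: continuous_subspaceT => x.
  by apply: (@continuous_comp _ _ _ w); [exact: cw|exact: norm_continuous].
by exists `|w m| => // x xab; apply: M; rewrite in_itv.
Qed.

Lemma integrable_mul_continuous u w : integrable_on period u -> continuous w ->
  integrable_on period (fun x => u x * w x).
Proof.
move=> iu cw; have [K _ wK] := continuous_itv_bounded 0 (pi *+ 2) cw.
have mP := @measurable_period R.
apply: (@integrable_mul_bounded _ _ _ _ K) => //.
exact: continuous_meas.
Qed.

Section Annihilator.
Variable u : R -> R.
Hypothesis iu : integrable_on period u.
Hypothesis u0 : forall b n, fc u b n = 0.

Let mP := @measurable_period R.

(** Quantifying over all frequencies and phases makes this class of w stable under multiplication by
    shifted cosines. Vanishing coefficients thereby become orthogonality to every polynomial in cos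
    (x - c). *)
Definition annihilated w : Prop := continuous w /\
  forall n th, \int[mu]_(x in period) (u x * (w x * cos (n%:R * x + th))) = 0.

Let ic w a th : continuous w ->
  integrable_on period (fun x => u x * (w x * cos (a * x + th))).
Proof.
move=> cw; apply: integrable_mul_continuous => // x.
by apply: cvgM; [exact: cw|exact: continuous_phase].
Qed.

Lemma annihilated1 : annihilated (cst 1).
Proof.
split=> [x|n th]; first exact: cvg_cst.
have i b r : integrable_on period (fun x => u x * tb b n x * r).
  have := integrableZ r mP (integrable_mul_continuous iu (@continuous_tb R b n)).
  by congr (is_true (_.-integrable _ _)); apply/funext => x /=; rewrite mulrC.
have i' b : integrable_on period (fun x => u x * tb b n x).
  exact: (integrable_mul_continuous iu (@continuous_tb R b n)).
have E x : u x * (cst 1 x * cos (n%:R * x + th)) =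
    u x * tb false n x * cos th - u x * tb true n x * sin th.
  by rewrite /= mul1r cosD; ring.
under eq_Rintegral do rewrite E.
by rewrite RintegralB// !RintegralZr// -!/(fc _ _ _) !u0 !mul0r subrr.
Qed.

Lemma annihilatedZ r w : annihilated w -> annihilated (fun x => r * w x).
Proof.
move=> [cw aw]; split=> [x|n th]; first by apply: cvgMl_tmp; exact: cw.
under eq_Rintegral do rewrite -mulrA mulrCA.
by rewrite RintegralZl ?aw ?mulr0//; exact: ic.
Qed.

Lemma annihilatedD w w' : annihilated w -> annihilated w' ->
  annihilated (fun x => w x + w' x).
Proof.
move=> [cw aw] [cw' aw']; split=> [x|n th].
  by apply: cvgD; [exact: cw|exact: cw'].
under eq_Rintegral do rewrite mulrDl mulrDr.
by rewrite RintegralD ?aw ?aw' ?addr0//; exact: ic.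
Qed.

Lemma annihilated_cos c w : annihilated w ->
  annihilated (fun x => w x * cos (x - c)).
Proof.
move=> [cw aw]; have cc : continuous (fun x : R => cos (x - c)).
  by rewrite (_ : (fun _ => _) = fun x => cos (1 * x + - c));
    [exact: continuous_phase|apply/funext => x; rewrite mul1r].
split=> [x|n th]; first by apply: cvgM; [exact: cw|exact: cc].
have i a t : integrable_on period
    (fun x => 2^-1 * (u x * (w x * cos (a * x + t)))).
  by apply: integrableZ => //; exact: ic.
have E x : u x * (w x * cos (x - c) * cos (n%:R * x + th)) =
    2^-1 * (u x * (w x * cos (n.+1%:R * x + (th - c)))) +
    2^-1 * (u x * (w x * cos ((n%:R - 1) * x + (th + c)))).
  have -> : n.+1%:R * x + (th - c) = (n%:R * x + th) + (x - c).
    by rewrite -natr1; ring.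
  have -> : (n%:R - 1) * x + (th + c) = (n%:R * x + th) - (x - c) by ring.
  by rewrite [cos (_ + (x - c))]cosD [cos (_ - (x - c))]cosB; field.
under eq_Rintegral do rewrite E.
rewrite RintegralD// !RintegralZl//; try exact: ic.
(* For n = 0 the difference frequency is -1; evenness of the cosine brings it back to frequency 1
   with the opposite phase. *)
rewrite aw mulr0 add0r; case: n {E} => [|n].
  under eq_Rintegral => x _.
    have -> : (0%:R - 1) * x + (th + c) = - (1%:R * x + (- th - c)) by ring.
    rewrite cosN; over.
  by rewrite aw mulr0.
under eq_Rintegral => x _ do rewrite -natr1 addrK.
by rewrite aw mulr0.
Qed.

Lemma annihilated_pow z N w :
  (forall w, annihilated w -> annihilated (fun x => w x * z x)) ->
  annihilated w -> annihilated (fun x => w x * z x ^+ N).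
Proof.
move=> az aw; elim: N => [|N IH].
  by under eq_fun do rewrite expr0 mulr1.
by under eq_fun do rewrite exprSr mulrA; exact: az.
Qed.

Lemma annihilated_bump c (al be : R) k N :
  \int[mu]_(x in period)
     (u x * (1 - (al + be * cos (x - c)) ^+ k) ^+ N) = 0.
Proof.
have az w : annihilated w -> annihilated (fun x => w x * (al + be * cos (x - c))).
  move=> aw; under eq_fun do rewrite mulrDr mulrC mulrCA.
  by apply: annihilatedD; apply: annihilatedZ => //; exact: annihilated_cos.
have azk w : annihilated w ->
    annihilated (fun x => w x * (1 - (al + be * cos (x - c)) ^+ k)).
  move=> aw; under eq_fun do rewrite mulrBr mulr1 -mulN1r.
  by apply: annihilatedD => //; apply: annihilatedZ; exact: annihilated_pow.
have [_ /(_ 0%N 0)] := annihilated_pow N azk annihilated1.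
by under eq_Rintegral do rewrite mul0r addr0 cos0 mulr1 mul1r.
Qed.

End Annihilator.

(* The polynomials (1 - z ^ k) ^ (2 ^ k) tend boundedly to a step function on
   [0, 1], which allows indicators of arcs to be approximated. *)
Lemma step_poly_cvg1 (z : R) : 0 <= z -> z < 2^-1 ->
  (fun k => (1 - z ^+ k) ^+ (2 ^ k)) @ \oo --> (1 : R).
Proof.
move=> z0 z1; have zk k : 0 <= z ^+ k <= 1.
  by rewrite exprn_ge0// exprn_ile1// (le_trans (ltW z1))// invf_le1// ler1n.
apply: (@squeeze_cvgr _ _ _ _ (fun k => 1 - (2 * z) ^+ k) (cst 1)).
- near=> k; have /andP[y0 y1] := zk k; apply/andP; split; last first.
    by rewrite exprn_ile1// ?subr_ge0// gerBl.
  (* Bernoulli's inequality (1 - y)^N >= 1 - N y for y = z^k and N = 2^k, where N y = (2 z)^k tends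
     to 0. *)
  rewrite exprMn -natrX; move: (2 ^ k)%N => N.
  elim: N => [|N IH]; first by rewrite mul0r subr0 expr0.
  rewrite exprSr; apply: (@le_trans _ _ ((1 - N%:R * z ^+ k) * (1 - z ^+ k))).
    rewrite -natr1; have : 0 <= N%:R * z ^+ k * z ^+ k by rewrite !mulr_ge0.
    by move: (z ^+ k) (N%:R : R) => y a; lra.
  by rewrite ler_wpM2r// subr_ge0.
- rewrite -[X in _ --> X](subr0 1); apply: cvgB; first exact: cvg_cst.
  by apply: cvg_expr; rewrite ger0_norm ?mulr_ge0//; lra.
- exact: cvg_cst.
Unshelve. all: by end_near. Qed.

Lemma step_poly_cvg0 (z : R) : 2^-1 < z -> z <= 1 ->
  (fun k => (1 - z ^+ k) ^+ (2 ^ k)) @ \oo --> (0 : R).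
Proof.
move=> z1 z2; have z0 : 0 < z by apply: lt_trans z1; rewrite invr_gt0.
have zk k : 0 <= z ^+ k <= 1 by rewrite exprn_ge0 ?exprn_ile1// ltW.
apply: (@squeeze_cvgr _ _ _ _ (cst 0) (fun k => ((2 * z)^-1) ^+ k)).
- near=> k; have /andP[y0 y1] := zk k; apply/andP; split.
    by rewrite exprn_ge0// subr_ge0.
  (* Multiply (1 - y)^N by (1 + y)^N >= 1 + N y >= (2 z)^k; the product (1 - y^2)^N is at most 1. *)
  rewrite exprVn -[X in _ <= X]mul1r ler_pdivlMr ?exprn_gt0 ?mulr_gt0//.
  apply: (@le_trans _ _ ((1 - z ^+ k) ^+ (2 ^ k) * (1 + z ^+ k) ^+ (2 ^ k))).
    rewrite ler_wpM2l ?exprn_ge0 ?subr_ge0//.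
    rewrite exprMn -natrX; move: (2 ^ k)%N => N.
    suff : 1 + N%:R * z ^+ k <= (1 + z ^+ k) ^+ N by apply: le_trans; rewrite lerDr.
    elim: N => [|N IH]; first by rewrite mul0r addr0 expr0.
    rewrite exprSr; apply: (@le_trans _ _ ((1 + N%:R * z ^+ k) * (1 + z ^+ k))).
      rewrite -natr1; have : 0 <= N%:R * z ^+ k * z ^+ k by rewrite !mulr_ge0.
      by move: (z ^+ k) (N%:R : R) => y a; lra.
    by rewrite ler_wpM2r ?addr_ge0.
  by rewrite -exprMn exprn_ile1//; move: (z ^+ k) y0 y1 => y; nra.
- exact: cvg_cst.
- by apply: cvg_expr; rewrite ger0_norm ?invr_ge0 ?mulr_ge0 ?(ltW z0)// invf_lt1 ?mulr_gt0//; lra.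
Unshelve. all: by end_near. Qed.

Lemma cos_lt_arc (b x : R) : 0 < b < pi *+ 2 -> b < x < pi *+ 2 ->
  cos (x - b / 2) < cos (b / 2).
Proof.
have E : pi *+ 2 = pi * 2 :> R by rewrite mulr_natr.
rewrite E => /andP[b0 b1] /andP[x0 x1].
have [y|y] := leP (x - b / 2) pi.
  by rewrite ltr_cos ?in_itv/=; [lra|apply/andP; split; lra|apply/andP; split; lra].
rewrite -[cos (x - b / 2)]cosN -(@cosD2pi R) E.
by rewrite ltr_cos ?in_itv/=; [lra|apply/andP; split; lra|apply/andP; split; lra].
Qed.

Lemma cos_gt_arc (b x : R) : 0 < b < pi *+ 2 -> 0 < x < b ->
  cos (b / 2) < cos (x - b / 2).
Proof.
have E : pi *+ 2 = pi * 2 :> R by rewrite mulr_natr.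
rewrite E => /andP[b0 b1] /andP[x0 x1].
have [y|y] := leP 0 (x - b / 2); last rewrite -[cos (x - _)]cosN.
  by rewrite ltr_cos ?in_itv/=; [lra|apply/andP; split; lra|apply/andP; split; lra].
by rewrite ltr_cos ?in_itv/=; [lra|apply/andP; split; lra|apply/andP; split; lra].
Qed.

Lemma ae_neq (a : R) : {ae mu, forall x, x <> a}.
Proof.
exists [set a]; split; [exact: measurable_set1|exact: lebesgue_measure_set1|].
by move=> x /= /contrapT.
Qed.

Lemma continuous_cosB (c : R) : continuous (fun x : R => cos (x - c)).
Proof.
rewrite (_ : (fun _ => _) = fun x : R => cos (1 * x + - c)).
  exact: continuous_phase.
by apply/funext => x; rewrite mul1r.
Qed.

Section Uniqueness.
Variable u : R -> R.
Hypothesis iu : integrable_on period u.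
Hypothesis u0 : forall b n, fc u b n = 0.

Let mP := @measurable_period R.

Lemma integral_arc0 (b : R) : 0 < b < pi *+ 2 ->
  \int[mu]_(x in `[0, b]) u x = 0.
Proof.
move=> hb; have /andP[b0 b1] := hb.
(* An affine function of cos (x - b / 2) with values in [0, 1], equal to 1/2 at the two ends of the
   arc from 0 to b, larger inside and smaller outside. The step polynomials in z therefore tend to
   the indicator of the complementary arc. *)
pose z (x : R) := (2^-1 - cos (b / 2) / 4) + 4^-1 * cos (x - b / 2).
have z01 x : 0 <= z x <= 1.
  have := cos_max (b / 2); have := cos_max (x - b / 2).
  by rewrite !ler_norml /z => /andP[? ?] /andP[? ?]; apply/andP; split; lra.
have cz : continuous z.
  move=> x; apply: cvgD; first exact: cvg_cst.
  by apply: cvgMl_tmp; exact: continuous_cosB.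
have cstep k : continuous (fun x => (1 - z x ^+ k) ^+ (2 ^ k)).
  move=> x; apply: (@continuous_comp _ _ _ (fun x => 1 - z x ^+ k) (fun y => y ^+ (2 ^ k))).
    apply: cvgB; first exact: cvg_cst.
    by apply: (@continuous_comp _ _ _ z (fun y => y ^+ k)); [exact: cz|exact: exprn_continuous].
  exact: exprn_continuous.
have u00 : \int[mu]_(x in period) u x = 0.
  have := u0 false 0; rewrite /fc; congr (_ = _); apply: eq_Rintegral => x _.
  by rewrite /tb mul0r cos0 mulr1.
have mu_ : measurable_fun period u by exact: integrable_meas.
have [|||||_ c] := @Rdominated_convergence R period
  (fun k x => u x * (1 - z x ^+ k) ^+ (2 ^ k)) (u \_ `]b, pi *+ 2])
  (fun x => `|u x|) mP.
- by move=> k; apply: measurable_funM => //; exact: continuous_meas.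
- apply/measurable_restrict => //; apply: measurable_funS mu_ => //.
- apply: ae_imp (ae_and (ae_neq 0) (ae_and (ae_neq b) (ae_neq (pi *+ 2)))).
  move=> x [/eqP x0 [/eqP xb /eqP xp]]; rewrite /period/= in_itv/= => /andP[x0' xp'].
  have lx0 : 0 < x by rewrite lt_neqAle eq_sym x0.
  have lxp : x < pi *+ 2 by rewrite lt_neqAle xp.
  have /andP[z0 z1] := z01 x; rewrite patchE.
  have [xltb|bltx] := ltP x b.
    rewrite memNset/=; last by rewrite in_itv/= ltNge (ltW xltb).
    rewrite -[X in _ --> X](mulr0 (u x)); apply: cvgMl_tmp; apply: step_poly_cvg0 => //.
    by have := @cos_gt_arc b x hb; rewrite lx0 xltb => /(_ isT); rewrite /z; lra.
  have lbx : b < x by rewrite lt_neqAle eq_sym xb.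
  rewrite mem_set/=; last by rewrite in_itv/= lbx.
  rewrite -[X in _ --> X](mulr1 (u x)); apply: cvgMl_tmp; apply: step_poly_cvg1 => //.
  by have := @cos_lt_arc b x hb; rewrite lxp lbx => /(_ isT); rewrite /z; lra.
- exact: integrable_norm.
- move=> k x _; rewrite normrM ler_piMr//.
  have /andP[z0 z1] := z01 x.
  by rewrite ger0_norm ?exprn_ge0 ?subr_ge0 ?exprn_ile1// ?subr_ge0 ?exprn_ile1// gerBl exprn_ge0.
(* Every term of the converging sequence is 0. The integral over the whole period vanishes too,
   which leaves 0 for the arc from 0 to b. *)
have : \int[mu]_(x in period) (u \_ `]b, pi *+ 2]) x = 0.
  rewrite -(cvg_lim _ c)//; apply: cvg_lim => //.
  under eq_fun do rewrite annihilated_bump//.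
  exact: cvg_cst.
rewrite -Rintegral_mkcondr.
have -> : period `&` `]b, pi *+ 2] = `]b, pi *+ 2]%classic.
  apply/seteqP; split=> x /=; first by case.
  by rewrite /period/= !in_itv/= => /andP[bx xp]; rewrite bx xp !andbT (le_trans (ltW b0))// ltW.
have := @Rintegral_itvB R u (BLeft 0) (BRight (pi *+ 2)) b iu.
rewrite !bnd_simp => /(_ (ltW b0) (ltW b1)) <-.
by rewrite [X in X - _]u00 sub0r => /eqP; rewrite oppr_eq0 => /eqP.
Qed.

(** The primitive of u vanishes on the open period, and by Lebesgue differentiation its derivative
    is u almost everywhere. *)
Lemma fourier_zero : {ae mu, forall x, period x -> u x = 0}.
Proof.
have li := integrable_locally mP iu.
apply: ae_imp (ae_and (lebesgue_differentiation li) (ae_and (ae_neq 0) (ae_neq (pi *+ 2)))).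
move=> x [Lx [/eqP x0 /eqP xp]]; rewrite /period/= in_itv/= => /andP[x0' xp'].
have lx0 : 0 < x by rewrite lt_neqAle eq_sym x0.
have lxp : x < pi *+ 2 by rewrite lt_neqAle xp.
pose f := u \_ period.
have fE (y : R) : 0 < y < pi *+ 2 -> \int[mu]_(t in `[0, y]) f t = 0.
  move=> hy; transitivity (\int[mu]_(t in `[0, y]) u t); last exact: integral_arc0.
  apply: eq_Rintegral => t; rewrite inE/= in_itv/= => /andP[t0 ty].
  rewrite /f patchE mem_set// /period/= in_itv/= t0 (le_trans ty)// ltW//.
  by case/andP: hy.
have if_ : integrable_on `[0, pi *+ 2] f.
  apply: eq_integrable iu => //= t; rewrite inE/= => tp.
  by rewrite /f patchE mem_set.
have [_] := FTC1_lebesgue_pt lxp if_ lx0 Lx.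
rewrite /f patchE mem_set/=; last by rewrite /period/= in_itv/= x0' xp'.
move=> <-; rewrite derive1E; apply: derive_val; apply: (@near_eq_is_derive _ _ _ (cst 0)).
  exists (Num.min x (pi *+ 2 - x)) => /=; first by rewrite lt_min lx0 subr_gt0.
  move=> y /=; rewrite lt_min !ltr_distlC => /andP[/andP[y1 y2] /andP[y3 y4]].
  by apply/esym/fE; apply/andP; split; lra.
Qed.
End Uniqueness.

Lemma fourier_unique u v : torus_L1 u -> torus_L1 v ->
  (forall b n, fc u b n = fc v b n) -> ae_equal u v.
Proof.
move=> [pu iu] [pv iv] uv; apply: ae_periodic => //.
have iuv : integrable_on period (fun x => u x - v x).
  exact: (integrable_sub (@measurable_period R)).
have H : {ae mu, forall x, period x -> u x - v x = 0}.
  apply: fourier_zero => // b n; rewrite /fc.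
  under eq_Rintegral do rewrite mulrBl.
  rewrite RintegralB ?[X in X - _]uv ?subrr//; first exact: measurable_period.
    exact: integrable_mul_continuous (@continuous_tb R b n).
  exact: integrable_mul_continuous (@continuous_tb R b n).
by apply: ae_imp H => x H /H /eqP; rewrite subr_eq0 => /eqP.
Qed.
End FourierUniqueness.

(** * Trigonometric series and Sobolev norms *)

Section TrigSeries.
Context {R : realType}.
Notation mu := (@lebesgue_measure R).
Notation integrable_on D f := (mu.-integrable D (EFin \o f)).
Implicit Types (u v w : R -> R) (c d : bool -> nat -> R).

Definition coef u b n : R := fc u b n / pi.

Definition cterm c n (x : R) : R := c false n * tb false n x + c true n * tb true n x.

Definition trig c (x : R) : R := tsum (fun n => cterm c n x).

Definition absm c n : R := `|c false n| + `|c true n|.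

Let mP := @measurable_period R.

Lemma absm_ge0 c n : 0 <= absm c n.
Proof. by rewrite addr_ge0. Qed.

Lemma fc_coef u b n : fc u b n = pi * coef u b n.
Proof. by rewrite /coef mulrCA divff ?mulr1// gt_eqF// pi_gt0. Qed.

Lemma cterm_le c n x : `|cterm c n x| <= absm c n.
Proof.
apply: le_trans (ler_normD _ _) _; apply: lerD; rewrite normrM ler_piMr//;
exact: tb_le1.
Qed.

Lemma continuous_cterm c n : continuous (cterm c n).
Proof. by move=> x; apply: cvgD; apply: cvgMl_tmp; exact: continuous_tb. Qed.

Lemma continuous_trig c B : sumby (absm c) B -> continuous (trig c).
Proof.
move=> cB; apply: mtest_continuous cB; first exact: continuous_cterm.
by move=> n x; exact: cterm_le.
Qed.

Lemma trig_le c B x : sumby (absm c) B -> `|trig c x| <= B.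
Proof. by move=> cB; apply: tsum_norm_le cB => n; exact: cterm_le. Qed.

Lemma trig_periodic c : periodic (trig c) (pi *+ 2).
Proof.
by move=> x; apply: eq_tsum => n; rewrite /cterm !tb_periodic.
Qed.

Lemma trig_torus_L1 c B : sumby (absm c) B -> torus_L1 (trig c).
Proof.
move=> cB; split; first exact: trig_periodic.
exact: integrable_period (continuous_trig cB).
Qed.

Lemma integrable_tb w b n : integrable_on period w ->
  integrable_on period (fun x => w x * tb b n x).
Proof. by move=> iw; exact: (integrable_mul_continuous iw (@continuous_tb R b n)). Qed.

(** Parseval's identity. As one factor is an absolutely convergent series, the other one may be any
    integrable function. *)
Lemma integral_trig w c B : integrable_on period w -> sumby (absm c) B ->
  \int[mu]_(x in period) (w x * trig c x) =
  tsum (fun n => c false n * fc w false n + c true n * fc w true n).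
Proof.
move=> iw cB.
have E x : w x * trig c x = tsum (fun n => w x * cterm c n x).
  by rewrite tsumZ//; apply: (dom_cvg (fun n => cterm_le c n x) cB).
under eq_Rintegral do rewrite E.
have [|||||_ ->] := @Rintegral_tsum R period (fun n x => w x * cterm c n x)
    (absm c) B (fun x => `|w x|) mP.
- move=> n; apply: measurable_funM; first exact: integrable_meas.
  by apply: continuous_meas => //; exact: continuous_cterm.
- by move=> n x _; rewrite normrM mulrC ler_wpM2r// cterm_le.
- by move=> n; exact: absm_ge0.
- exact: cB.
- exact: integrable_norm.
apply: eq_tsum => n; rewrite /cterm.
have Ew x : w x * (c false n * tb false n x + c true n * tb true n x) =
  c false n * (w x * tb false n x) + c true n * (w x * tb true n x) by ring.
under eq_Rintegral do rewrite Ew.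
by rewrite RintegralD// ?RintegralZl//; try apply: integrableZ => //; exact: integrable_tb.
Qed.

(** Orthogonality; mode 0 is excluded because the constant function has square integral 2 pi instead
    of pi. *)
Lemma fc_trig c B b n : sumby (absm c) B -> (forall b, c b 0%N = 0) ->
  fc (trig c) b n = pi * c b n.
Proof.
move=> cB c0; rewrite /fc; under eq_Rintegral do rewrite mulrC.
rewrite (integral_trig _ cB); last exact: integrable_period (@continuous_tb R b n).
have fctb b' k : (0 < k)%N -> fc (tb b n) b' k = if (b == b') && (n == k) then pi else 0.
  exact: tb_orthogonal.
rewrite (@tsum_single _ n) => [|k kn].
  have [->|n0] := posnP n; first by rewrite !c0 !mul0r mulr0 addr0.
  by rewrite !fctb// eqxx !andbT; case: b {fctb} => /=; rewrite mulr0 ?addr0 ?add0r mulrC.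
have [->|k0] := posnP k; first by rewrite !c0 !mul0r addr0.
by rewrite !fctb// [n == k]eq_sym (negbTE kn) !andbF !mulr0 addr0.
Qed.

Lemma coef_trig c B b n : sumby (absm c) B -> (forall b, c b 0%N = 0) ->
  coef (trig c) b n = c b n.
Proof.
by move=> cB c0; rewrite /coef (fc_trig _ _ cB)// mulrAC divff ?mul1r// gt_eqF// pi_gt0.
Qed.

Lemma fc0 u : zero_average u -> forall b, fc u b 0 = 0.
Proof.
move=> u0 [|]; rewrite /fc /tb.
  under eq_Rintegral do rewrite mul0r sin0 mulr0.
  by rewrite Rintegral_cst// mul0r.
by under eq_Rintegral do rewrite mul0r cos0 mulr1.
Qed.

Lemma coef0 u : zero_average u -> forall b, coef u b 0 = 0.
Proof. by move=> u0 b; rewrite /coef fc0// mul0r. Qed.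

Lemma zero_average_trig c B : sumby (absm c) B -> (forall b, c b 0%N = 0) ->
  zero_average (trig c).
Proof.
move=> cB c0; have := fc_trig false 0 cB c0; rewrite c0 mulr0 /fc /tb.
by under eq_Rintegral do rewrite mul0r cos0 mulr1.
Qed.

Lemma fourier_expansion u v B : torus_L1 u -> torus_L1 v -> zero_average u ->
  sumby (absm (coef u)) B -> ae_equal u (trig (coef u)).
Proof.
move=> u1 v1 u0 uB; apply: fourier_unique => //; first exact: trig_torus_L1 uB.
by move=> b n; rewrite (fc_trig _ _ uB) ?fc_coef//; exact: coef0.
Qed.

Lemma ae_trig u c B : torus_L1 u -> sumby (absm c) B -> (forall b, c b 0%N = 0) ->
  (forall b n, fc u b n = pi * c b n) -> ae_equal u (trig c).
Proof.
move=> u1 cB c0 uc; apply: fourier_unique => //; first exact: trig_torus_L1 cB.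
by move=> b n; rewrite (fc_trig _ _ cB).
Qed.

Lemma ae_fc u v : torus_L1 u -> torus_L1 v -> ae_equal u v ->
  forall b n, fc u b n = fc v b n.
Proof.
move=> [_ iu] [_ iv] uv b n; apply: ae_Rintegral => //.
- by apply: integrable_meas; exact: integrable_tb.
- by apply: integrable_meas; exact: integrable_tb.
by apply: ae_imp uv => x ->.
Qed.

End TrigSeries.

(** * Sobolev norms in terms of cosine and sine coefficients *)

Section SobolevCoefficients.
Context {R : realType}.
Notation mu := (@lebesgue_measure R).
Notation integrable_on D f := (mu.-integrable D (EFin \o f)).
Implicit Types (u v w : R -> R) (c d : bool -> nat -> R) (s B : R).
Local Open Scope complex_scope.

Let k0 : R := (Num.sqrt (pi *+ 2))^-1.

(** The sign is -1 for z >= 0 and 1 for z < 0, so one formula in |z| covers both; at z = 0 the sine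
    coefficient is 0 and the sign is immaterial. *)
Lemma fourierE u (z : int) : integrable_on period u -> fourier u z =
  (k0 * fc u false `|z|%N) +i* (k0 * ((-1) ^+ (0 <= z)%R * fc u true `|z|%N)).
Proof.
move=> iu; rewrite /fourier /complex_integral -/k0.
have Re x : complex.Re ((u x)%:C * expi (- (z%:~R * x))) = u x * tb false `|z|%N x.
  rewrite /expi /= mul0r subr0 cosN; congr (_ * _); rewrite /tb.
  by case: z => n//; rewrite NegzE mulrNz mulNr cosN.
have Im x : complex.Im ((u x)%:C * expi (- (z%:~R * x))) =
    (-1) ^+ (0 <= z)%R * (u x * tb true `|z|%N x).
  rewrite /expi /= mul0r addr0 sinN /tb.
  case: z {Re} => n /=; first by rewrite expr1 mulN1r mulrN.
  by rewrite NegzE mulrNz mulNr sinN opprK expr0 mul1r.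
under eq_Rintegral do rewrite Re.
have -> : \int[mu]_(x in period) complex.Im ((u x)%:C * expi (- (z%:~R * x))) =
    (-1) ^+ (0 <= z)%R * fc u true `|z|%N.
  under eq_Rintegral do rewrite Im.
  by rewrite RintegralZl//; [exact: measurable_period|exact: integrable_tb].
by apply/eqP; rewrite eq_complex /= !mul0r subr0 addr0 !eqxx.
Qed.

(** The integers are counted as two copies of the naturals. The index 0 then occurs twice,
    harmlessly since its term is 0. *)
Lemma int_esum (a : int -> \bar R) : (forall z, 0 <= a z)%E ->
  a 0%Z = 0%E -> (forall n : nat, a (- n%:Z) = a n%:Z) ->
  (\esum_(k in [set: int]) a k = 2%:E * \sum_(n <oo) a n%:Z)%E.
Proof.
move=> a0 az aN.
rewrite (esumID (range Posz))// !setTI.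
have -> : (~` range Posz) = [set - n%:Z | n in [set n : nat | (0 < n)%N]].
  apply/seteqP; split=> [[n|n] /= |_ [n n0 <-] [m _]].
  - by move=> H; exfalso; apply: H; exists n.
  - by move=> _; exists n.+1 => //; rewrite NegzE.
  - by case: n n0 => // n _ /eqP; rewrite -NegzE.
rewrite esum_image; last by move=> m n _ _ [].
rewrite esum_image; last by move=> m n _ _ /oppr_inj [].
rewrite -nneseries_esumT//.
under [X in (_ + X)%E]eq_esum do rewrite aN.
rewrite [X in (_ + X)%E]esum_mkcond.
have -> : (\esum_(i in [set: nat]) (if i \in [set n : nat | (0 < n)%N] then a i%:Z else 0) =
    \sum_(n <oo) a n%:Z)%E.
  rewrite nneseries_esumT//; apply: eq_esum => -[|i] _.
    by rewrite memNset.
  by rewrite mem_set.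
by rewrite -[2%R]/(1 + 1)%R EFinD ge0_muleDl// !mul1e.
Qed.

(** Share of the frequencies n and -n in the squared H^s norm, up to the factor pi: each has squared
    modulus pi / 2 times the sum of the two squares. *)
Definition hs s c n : R := n%:R `^ (2 * s) * (c false n ^+ 2 + c true n ^+ 2).

Lemma hs_ge0 s c n : 0 <= hs s c n.
Proof. by rewrite mulr_ge0 ?powR_ge0// addr_ge0// sqr_ge0. Qed.

Lemma normc_fourier u (z : int) : integrable_on period u ->
  ComplexField.Normc.normc (fourier u z) ^+ 2 =
  (pi / 2) * (coef u false `|z|%N ^+ 2 + coef u true `|z|%N ^+ 2).
Proof.
move=> iu; rewrite fourierE//= sqr_sqrtr ?addr_ge0 ?sqr_ge0//.
rewrite !exprMn sqrr_sign mul1r !fc_coef !exprMn exprVn sqr_sqrtr; last first.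
  by rewrite mulrn_wge0// pi_ge0.
rewrite -[pi *+ 2]mulr_natr; have := @pi_gt0 R.
by move: (pi : R) => p p0; field; rewrite gt_eqF.
Qed.

Lemma sobolev_norm2E s u : 0 < s -> torus_L1 u ->
  sobolev_norm2 s u = (pi%:E * \sum_(n <oo) (hs s (coef u) n)%:E)%E.
Proof.
move=> s0 [_ iu]; rewrite /sobolev_norm2 int_esum.
- rewrite -!nneseriesZl//; try by move=> n _; rewrite lee_fin ?hs_ge0// mulr_ge0 ?powR_ge0// sqr_ge0.
  apply: eq_eseriesr => n _; rewrite normc_fourier// -!EFinM /hs; congr EFin.
  by rewrite absz_nat; field.
- by move=> z; rewrite lee_fin mulr_ge0 ?powR_ge0// sqr_ge0.
(* Frequency 0 drops out because s > 0; for s = 0 the weight would be 0 to the power 0, that is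
   1. *)
- by rewrite powR0 ?mul0r// mulf_neq0// gt_eqF.
- by move=> n; rewrite !normc_fourier// normrN abszN.
Qed.

Lemma nneseries_sumby (a : nat -> R) B : (forall n, 0 <= a n) ->
  (\sum_(n <oo) (a n)%:E <= B%:E)%E <-> sumby a B.
Proof.
move=> a0; split=> [H N|H].
  rewrite -lee_fin; apply: le_trans H.
  rewrite /series/= -sumEFin; apply: nneseries_lim_ge => n _ _.
  by rewrite lee_fin.
apply: lime_le; first by apply: is_cvg_nneseries => n _ _; rewrite lee_fin.
by apply: nearW => N /=; rewrite sumEFin lee_fin; exact: H.
Qed.

Lemma nneseries_tsum (a : nat -> R) B : (forall n, 0 <= a n) -> sumby a B ->
  (\sum_(n <oo) (a n)%:E = (tsum a)%:E)%E.
Proof.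
move=> a0 aB; apply/eqP; rewrite eq_le; apply/andP; split.
  by apply/(nneseries_sumby _ a0) => N; exact: le_series_tsum aB.
rewrite leNgt; apply/negP => H.
have f0 : (0 <= \sum_(n <oo) (a n)%:E)%E by apply: nneseries_ge0 => n _ _; rewrite lee_fin.
have fE : (\sum_(n <oo) (a n)%:E)%E = (fine (\sum_(n <oo) (a n)%:E))%:E.
  by rewrite fineK// ge0_fin_numE// (lt_trans H)// ltry.
move: H; rewrite fE lte_fin ltNge => /negP; apply.
apply: tsum_le; first exact: sumby_cvg aB.
by apply/(nneseries_sumby _ a0); rewrite -fE.
Qed.

Lemma sobolev_normE s u B : 0 < s -> torus_L1 u -> sumby (hs s (coef u)) B ->
  sobolev_norm s u = Num.sqrt (pi * tsum (hs s (coef u))).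
Proof.
move=> s0 u1 uB; rewrite /sobolev_norm sobolev_norm2E//.
by rewrite (nneseries_tsum (hs_ge0 s _) uB) -EFinM.
Qed.

Lemma sumby_sobolev s u : 0 < s -> sobolev s u ->
  sumby (hs s (coef u)) (sobolev_norm s u ^+ 2 / pi).
Proof.
move=> s0 [u1 u0]; rewrite sobolev_norm2E// => fin.
have [B uB] : exists B, sumby (hs s (coef u)) B.
  have f0 : (0 <= \sum_(n <oo) (hs s (coef u) n)%:E)%E.
    by apply: nneseries_ge0 => n _ _; rewrite lee_fin hs_ge0.
  exists (fine (\sum_(n <oo) (hs s (coef u) n)%:E)).
  apply/(nneseries_sumby _ (hs_ge0 s _)); rewrite fineK// ge0_fin_numE//.
  move: fin; case: (\sum_(n <oo) _)%E f0 => [r _ _||]//; first exact: ltry.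
  by rewrite gt0_muley ?lte_fin ?pi_gt0.
have t0 : 0 <= tsum (hs s (coef u)).
  by apply: le_trans (le_series_tsum 0 (hs_ge0 s _) uB); rewrite series0n.
rewrite (sobolev_normE s0 u1 uB) sqr_sqrtr ?mulr_ge0 ?pi_ge0//.
rewrite mulrAC divff ?mul1r ?gt_eqF ?pi_gt0// => N.
exact: le_series_tsum (hs_ge0 s _) uB.
Qed.

Lemma sobolev_sumby s u B : 0 < s -> torus_L1 u -> zero_average u ->
  sumby (hs s (coef u)) B ->
  sobolev s u /\ sobolev_norm s u <= Num.sqrt (pi * B).
Proof.
move=> s0 u1 u0 uB; split.
  split=> //; rewrite sobolev_norm2E// (nneseries_tsum (hs_ge0 s _) uB).
  by rewrite -EFinM ltry.
rewrite (sobolev_normE s0 u1 uB) ler_wsqrtr// ler_wpM2l ?pi_ge0//.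
by apply: (tsum_le _ uB); exact: sumby_cvg (hs_ge0 s _) uB.
Qed.

End SobolevCoefficients.

(** * The nonlinearity in Fourier coefficients *)

Section Operators.
Context {R : realType}.
Notation mu := (@lebesgue_measure R).
Notation integrable_on D f := (mu.-integrable D (EFin \o f)).
Implicit Types (u v w : R -> R) (c d : bool -> nat -> R) (s B : R).
Local Open Scope complex_scope.

Let mP := @measurable_period R.

(* The coefficients of Lambda u and u_x when those of u are c. *)
Definition nc c b n : R := n%:R * c b n.
Definition dc c b n : R := if b then - (n%:R * c false n) else n%:R * c true n.

Lemma absm_nc c n : absm (nc c) n = n%:R * absm c n.
Proof. by rewrite /absm /nc !normrM !normr_nat mulrDr. Qed.

Lemma absm_dc c n : absm (dc c) n = n%:R * absm c n.
Proof. by rewrite /absm /dc normrN !normrM !normr_nat addrC mulrDr. Qed.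

Lemma nc0 c b : nc c b 0 = 0.
Proof. by rewrite /nc mul0r. Qed.

Lemma dc0 c b : dc c b 0 = 0.
Proof. by case: b; rewrite /dc mul0r ?oppr0. Qed.

Lemma absm_le_nc c : (forall b, c b 0%N = 0) -> forall n, absm c n <= n%:R * absm c n.
Proof.
move=> c0 [|n]; first by rewrite /absm !c0 normr0 addr0 mulr0.
by rewrite ler_peMl ?absm_ge0// ler1n.
Qed.

Lemma sumby_absm c B : (forall b, c b 0%N = 0) ->
  sumby (fun n => n%:R * absm c n) B -> sumby (absm c) B.
Proof. by move=> c0; apply: sumby_le; exact: absm_le_nc. Qed.

(** Cauchy-Schwarz for n |c_n| = n^(1 - s) (n^s |c_n|). As 2 (s - 1) = 1 + (2 s - 3), the first
    factor is controlled by [pseries_sumby]; the 2 comes from (x + y)^2 <= 2 (x^2 + y^2). *)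
Lemma sobolev_embedding s c B N : 3 / 2 < s -> sumby (hs s c) B ->
  (series (fun n => n%:R * absm c n) N) ^+ 2 <= 2 * (1 + (2 * s - 3)^-1) * B.
Proof.
move=> s32 cB; have r0 : 0 < 2 * s - 3 by lra.
have B0 := sumby_ge0 cB.
have H := @cauchy_schwarz_series R (fun n => n%:R `^ (- (s - 1)))
  (fun n => n%:R `^ s * absm c n) N.
have e : series (fun n => n%:R * absm c n) N =
    series (fun n => n%:R `^ (- (s - 1)) * (n%:R `^ s * absm c n)) N.
  rewrite !seriesE; apply: eq_bigr => -[[|n] /= _] _.
    by rewrite mul0r (@powR0 _ s) ?mul0r ?mulr0// gt_eqF//; lra.
  rewrite mulrA -powRD; last by rewrite pnatr_eq0 implybT.
  by rewrite (_ : - (s - 1) + s = 1) ?powRr1//; ring.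
rewrite e; apply: le_trans H _.
rewrite -mulrA [X in _ <= X]mulrCA; apply: ler_pM.
- by apply: series_ge0 => n; exact: sqr_ge0.
- by apply: series_ge0 => n; exact: sqr_ge0.
- apply: le_trans (pseries_sumby r0 N); apply: ler_series => n.
  rewrite -powR_mulrn ?powR_ge0// -powRrM.
  by rewrite (_ : - (s - 1) * 2%:R = - (1 + (2 * s - 3)))//; ring.
apply: (@le_trans _ _ (series (fun n => 2 * hs s c n) N)).
  apply: ler_series => n; rewrite exprMn -powR_mulrn ?powR_ge0// -powRrM.
  rewrite /hs [s * _]mulrC [X in _ <= X]mulrCA ler_wpM2l ?powR_ge0//.
  rewrite /absm -(real_normK (num_real (c false n))) -(real_normK (num_real (c true n))).
  move: `|c false n| `|c true n| => x y; have := sqr_ge0 (x - y); lra.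
exact: (sumbyZ _ cB).
Qed.

Lemma sobolev_sumby_absm s c B : 3 / 2 < s -> sumby (hs s c) B ->
  sumby (fun n => n%:R * absm c n) (Num.sqrt (2 * (1 + (2 * s - 3)^-1) * B)).
Proof.
move=> s32 cB N.
have n0 : 0 <= series (fun n => n%:R * absm c n) N.
  by apply: series_ge0 => n; rewrite mulr_ge0// absm_ge0.
rewrite -[X in X <= _]ger0_norm// -sqrtr_sqr ler_wsqrtr//.
exact: sobolev_embedding.
Qed.

Lemma is_LambdaP u v : integrable_on period u -> torus_L1 v ->
  is_Lambda u v <-> forall b n, fc v b n = n%:R * fc u b n.
Proof.
move=> iu [pv iv]; have k0 : (Num.sqrt (pi *+ 2 : R))^-1 != 0.
  by rewrite invr_neq0// gt_eqF// sqrtr_gt0 pmulrn_lgt0// pi_gt0.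
have an (n : nat) : (`|n%:Z|)%:~R = n%:R :> R by rewrite ger0_norm.
split=> [[_ H] b n|H].
  have := H n%:Z; rewrite !fourierE//= => /eqP; rewrite eq_complex /=.
  rewrite !mul0r subr0 addr0 expr1 an => /andP[/eqP e1 /eqP e2].
  apply: (mulfI k0); case: b; last by rewrite e1 mulrCA.
  apply: oppr_inj; rewrite -mulrN -mulN1r e2; ring.
split=> // z; rewrite !fourierE// !H; apply/eqP; rewrite eq_complex /=.
rewrite !mul0r subr0 addr0 -abszE natr_absz; apply/andP; split; apply/eqP; ring.
Qed.

(** The trigonometric series is a witness, so the choice in [Lambda] is not the default; the chosen
    function agrees with it almost everywhere by uniqueness of Fourier coefficients. *)
Lemma Lambda_spec u B : torus_L1 u ->
  sumby (fun n => n%:R * absm (coef u) n) B ->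
  torus_L1 (Lambda u) /\ ae_equal (Lambda u) (trig (nc (coef u))).
Proof.
move=> u1 uB; have ncB : sumby (absm (nc (coef u))) B.
  by apply: sumby_le uB => n; rewrite absm_nc.
have t1 := trig_torus_L1 ncB.
have ex : is_Lambda u (trig (nc (coef u))).
  apply/(is_LambdaP (proj2 u1) t1) => b n.
  rewrite (fc_trig _ _ ncB) => [|b']; last exact: nc0.
  by rewrite /nc fc_coef mulrCA.
have := xgetPex (cst 0) (ex_intro _ _ ex : exists v, [set v | is_Lambda u v] v).
rewrite -/(Lambda u) => -[L1 Lf]; split=> //.
apply: (ae_trig L1 ncB) => b; first exact: nc0.
move=> n; have /(is_LambdaP (proj2 u1) L1) -> : is_Lambda u (Lambda u) by split.
by rewrite /nc fc_coef mulrCA.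
Qed.

Lemma is_derive_phase (r a th x : R) :
  is_derive x 1 (fun x : R => r * cos (a * x + th)) (- (r * a * sin (a * x + th))).
Proof.
apply: is_derive_eq; rewrite /GRing.scale/= ?mulr0 ?addr0 ?mulr1 ?add0r.
ring.
Qed.

Lemma derive_tb b n (x : R) :
  is_derive x 1 (tb b n : R -> R) (- ((-1) ^+ b * (n%:R * tb (~~ b) n x))).
Proof.
rewrite (_ : tb b n = fun x => 1 * cos (n%:R * x + - (b%:R * (pi / 2)))); last first.
  by apply/funext => y; rewrite tb_phase mul1r.
apply: is_derive_eq (is_derive_phase _ _ _ _) _.
case: b => /=; rewrite ?mul1r ?mul0r ?subr0 /tb ?expr1 ?expr0 ?mulN1r ?opprK ?mul1r//.
by rewrite sinBpihalf mulrN opprK.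
Qed.

Lemma derive1n_phase (r a th : R) k :
  derive1n k (fun x : R => r * cos (a * x + th)) =
  (fun x => r * a ^+ k * cos (a * x + (th + k%:R * (pi / 2)))).
Proof.
elim: k => [|k IH]; first by apply/funext => x; rewrite derive1n0 expr0 mulr1 mul0r addr0.
rewrite derive1nS IH; apply/funext => x; rewrite derive1E.
have [_ ->] := is_derive_phase (r * a ^+ k) a (th + k%:R * (pi / 2)) x.
have -> : a * x + (th + k.+1%:R * (pi / 2)) = a * x + (th + k%:R * (pi / 2)) + pi / 2.
  by rewrite -natr1; ring.
by rewrite cosDpihalf exprSr; ring.
Qed.

Lemma smooth_torus_tb b n : smooth_torus (tb b n : R -> R).
Proof.
split; first exact: tb_periodic.
move=> k x; rewrite (_ : tb b n = fun x => 1 * cos (n%:R * x + - (b%:R * (pi / 2)))); last first.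
  by apply/funext => y; rewrite tb_phase mul1r.
by rewrite derive1n_phase; case: (is_derive_phase (1 * n%:R ^+ k) n%:R (- (b%:R * (pi / 2)) + k%:R * (pi / 2)) x).
Qed.

(** Integration by parts over a period, where the boundary terms cancel. *)
Lemma fc_derive (psi psi' : R -> R) b n : periodic psi (pi *+ 2) ->
  (forall x : R, is_derive x 1 psi (psi' x)) -> continuous psi' ->
  fc psi' b n = (-1) ^+ b * (n%:R * fc psi (~~ b) n).
Proof.
move=> ppsi dpsi cpsi'; have cpsi : continuous psi.
  by move=> x; apply: is_derive_continuous (dpsi x).
have ctb := @continuous_tb R.
pose g x := psi' x * tb b n x - (-1) ^+ b * (n%:R * (psi x * tb (~~ b) n x)).
have cg : continuous g.
  move=> x; apply: cvgB; first by apply: cvgM; [exact: cpsi'|exact: ctb].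
  by do 2 apply: cvgMl_tmp; apply: cvgM; [exact: cpsi|exact: ctb].
have T0 : 0 <= pi *+ 2 :> R by rewrite mulrn_wge0// pi_ge0.
have : \int[mu]_(x in period) g x = 0.
  transitivity (psi (pi *+ 2) * tb b n (pi *+ 2) - psi 0 * tb b n 0); last first.
    by rewrite -[pi *+ 2]add0r ppsi (@tb_periodic R) subrr.
  apply: (@Rintegral_ftc R g (fun x => psi x * tb b n x)) => //.
  - move=> x _; apply: is_derive_eq (is_deriveM (dpsi x) (derive_tb b n x)) _.
    by rewrite /g /GRing.scale/=; ring.
  - by move=> x; apply: cvgM; [exact: cpsi|exact: ctb].
have i1 : integrable_on period (fun x => psi' x * tb b n x).
  by apply: integrable_tb; exact: integrable_period.
have i2 : integrable_on period (fun x => psi x * tb (~~ b) n x).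
  by apply: integrable_tb; exact: integrable_period.
rewrite RintegralB//; [|by apply: integrableZ => //; exact: integrableZ].
rewrite !RintegralZl//; last exact: integrableZ.
by move/eqP; rewrite subr_eq0 => /eqP.
Qed.

Lemma smooth_torus_derive (psi : R -> R) : smooth_torus psi ->
  (forall x : R, is_derive x 1 psi (derive1 psi x)) /\ continuous (derive1 psi : R -> R).
Proof.
move=> [_ H]; split=> x.
  by rewrite derive1E; apply: derivableP; have := H 0%N x; rewrite derive1n0.
apply: differentiable_continuous; apply/derivable1_diffP.
by have := H 1%N x; rewrite derive1n1.
Qed.

(** Parseval's identity and [fc_derive] show that the series with coefficients [dc] is a weak
    derivative. Conversely any weak derivative, tested against the functions [tb b n], has these
    coefficients. *)
Lemma weak_deriv_spec u B : torus_L1 u -> zero_average u ->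
  sumby (fun n => n%:R * absm (coef u) n) B ->
  torus_L1 (weak_deriv u) /\ ae_equal (weak_deriv u) (trig (dc (coef u))).
Proof.
move=> u1 u0 uB; have dB : sumby (absm (dc (coef u))) B.
  by apply: sumby_le uB => n; rewrite absm_dc.
have cB := sumby_absm (coef0 u0) uB.
have t1 := trig_torus_L1 dB; have c1 := trig_torus_L1 cB.
have uE := fourier_expansion u1 u1 u0 cB.
have ex : is_weak_deriv u (trig (dc (coef u))).
  split=> // psi sp; have [dpsi cpsi'] := smooth_torus_derive sp.
  have cpsi : continuous psi by move=> x; apply: is_derive_continuous (dpsi x).
  have -> : \int[mu]_(x in period) (u x * derive1 psi x) =
      \int[mu]_(x in period) (derive1 psi x * trig (coef u) x).
    apply: ae_Rintegral => //.
    - by apply: measurable_funM; [exact: integrable_meas (proj2 u1)|exact: continuous_meas].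
    - by apply: measurable_funM; [exact: continuous_meas|exact: integrable_meas (proj2 c1)].
    by apply: ae_imp uE => x -> _; rewrite mulrC.
  under [in RHS]eq_Rintegral do rewrite mulrC.
  rewrite (integral_trig _ cB)//; last exact: integrable_period.
  rewrite (integral_trig _ dB)//; last exact: integrable_period.
  rewrite -[RHS]mulN1r -tsumZ.
    apply: eq_tsum => n; rewrite !(fc_derive _ _ (proj1 sp) dpsi cpsi') /dc /=.
    by rewrite expr0 expr1; ring.
  apply: (@dom_cvg _ _ (fun n => (\int[mu]_(x in period) `|psi x|) * absm (dc (coef u)) n)
    ((\int[mu]_(x in period) `|psi x|) * B)); last first.
    by apply: sumbyZ => //; apply: Rintegral_ge0.
  move=> n; have fcle b : `|fc psi b n| <= \int[mu]_(x in period) `|psi x|.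
    apply: le_trans (le_normr_Rintegral _ _) _ => //.
      by apply: integrable_tb; exact: integrable_period.
    apply: le_Rintegral => //.
    - by apply: integrable_norm; apply: integrable_tb; exact: integrable_period.
    - by apply: integrable_norm; exact: integrable_period.
    - by move=> x _; rewrite normrM ler_piMr// tb_le1.
  rewrite /absm mulrDr; apply: le_trans (ler_normD _ _) _.
  by apply: lerD; rewrite normrM mulrC ler_wpM2r.
have := xgetPex (cst 0) (ex_intro _ _ ex : exists v, [set v | is_weak_deriv u v] v).
rewrite -/(weak_deriv u) => -[L1 Lf]; split=> //.
apply: (ae_trig L1 dB) => b; first exact: dc0.
move=> n; have := Lf _ (smooth_torus_tb b n).
have dE (x : R) : derive1 (tb b n : R -> R) x = - ((-1) ^+ b * n%:R) * tb (~~ b) n x.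
  by rewrite derive1E; have [_ ->] := derive_tb b n x; rewrite mulrA mulNr.
under eq_Rintegral do rewrite dE mulrCA.
rewrite RintegralZl//; last by apply: integrable_tb; case: u1.
rewrite -/(fc u (~~ b) n) -/(fc _ b n) fc_coef mulNr => /oppr_inj <-.
by case: b {dE}; rewrite /dc /= ?expr1 ?expr0; ring.
Qed.

(* [n * NL c b n] is the coefficient on [tb b n] of the right-hand side of the
   equation for [trig c]; see [nonlinear_coef]. *)
Definition NL c b n : R := tsum (fun m =>
  m%:R * (c false m * c b (m + n)%N + (-1) ^+ b * (c true m * c (~~ b) (m + n)%N))).

Definition NLt c b n m : R :=
  m%:R * (c false m * c b (m + n)%N + (-1) ^+ b * (c true m * c (~~ b) (m + n)%N)).

Lemma NLt_le c b n m : `|NLt c b n m| <= m%:R * absm c m * absm c (m + n)%N.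
Proof.
rewrite /NLt normrM normr_nat -mulrA ler_wpM2l//.
apply: le_trans (ler_normD _ _) _; rewrite !normrM normrX normrN1 expr1n mul1r.
by rewrite /absm mulrDl; apply: lerD; rewrite ler_wpM2l// ; case: b => /=; rewrite ?lerDl ?lerDr.
Qed.

Lemma convol_sumby c B B' n : sumby (fun m => m%:R * absm c m) B ->
  (forall k, absm c k <= B') -> sumby (fun m => m%:R * absm c m * absm c (m + n)%N) (B * B').
Proof.
move=> cB cB' N; apply: le_trans (_ : series (fun m => B' * (m%:R * absm c m)) N <= _).
  by apply: ler_series => m; rewrite mulrC ler_wpM2r ?mulr_ge0 ?absm_ge0.
by rewrite mulrC; apply: sumbyZ => //; apply: le_trans (cB' 0%N); exact: absm_ge0.
Qed.

(** [nc] and [dc] are harmonic conjugates of each other: in this combination the difference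
    frequencies m - n cancel. This cancellation is the reason why N_n only involves pairs m, m +
    n. *)
Lemma addition_formula c b n (x : R) m :
  cterm (nc c) m x * tb b n x + (-1) ^+ b * (cterm (dc c) m x * tb (~~ b) n x) =
  m%:R * (c false m * tb b (m + n)%N x + (-1) ^+ b * (c true m * tb (~~ b) (m + n)%N x)).
Proof.
have E : (m + n)%:R * x = m%:R * x + n%:R * x by rewrite natrD mulrDl.
by rewrite /cterm /nc /dc; case: b; rewrite /tb /= ?expr1 ?expr0 E sinD cosD; ring.
Qed.

(* Rather than expanding triple products of trigonometric functions, combine
   the two nonlinear terms first: the addition formulas turn
   v cos nx + w sin nx into a series of frequencies m + n only. *)
Lemma nonlinear_coef u v w b n B : torus_L1 u -> zero_average u ->
  sumby (fun n => n%:R * absm (coef u) n) B ->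
  torus_L1 v -> ae_equal v (trig (nc (coef u))) ->
  torus_L1 w -> ae_equal w (trig (dc (coef u))) ->
  \int[mu]_(x in period) (u x * (v x * tb b n x + (-1) ^+ b * (w x * tb (~~ b) n x)))
  = pi * NL (coef u) b n.
Proof.
move=> u1 u0 uB v1 vE w1 wE; set c := coef u.
have nB : sumby (absm (nc c)) B by apply: sumby_le uB => k; rewrite absm_nc.
have dB : sumby (absm (dc c)) B by apply: sumby_le uB => k; rewrite absm_dc.
pose z (x : R) := tsum (fun m =>
  m%:R * (c false m * tb b (m + n)%N x + (-1) ^+ b * (c true m * tb (~~ b) (m + n)%N x))).
have zt m x : `|m%:R * (c false m * tb b (m + n)%N x +
    (-1) ^+ b * (c true m * tb (~~ b) (m + n)%N x))| <= m%:R * absm c m.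
  rewrite normrM normr_nat ler_wpM2l// (le_trans (ler_normD _ _))// /absm.
  rewrite !normrM normrX normrN1 expr1n mul1r.
  by apply: lerD; rewrite ler_piMr// tb_le1.
have ct m : continuous (fun x : R => m%:R * (c false m * tb b (m + n)%N x +
    (-1) ^+ b * (c true m * tb (~~ b) (m + n)%N x))).
  move=> x; apply: cvgMl_tmp; apply: cvgD; first by apply: cvgMl_tmp; exact: continuous_tb.
  by do 2 apply: cvgMl_tmp; exact: continuous_tb.
have cz : continuous z by exact: (mtest_continuous ct zt uB).
have zE x : trig (nc c) x * tb b n x + (-1) ^+ b * (trig (dc c) x * tb (~~ b) n x) = z x.
  have c1 := dom_cvg (fun k => cterm_le (nc c) k x) nB.
  have c2 := dom_cvg (fun k => cterm_le (dc c) k x) dB.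
  apply/esym/cvg_lim => //.
  rewrite (_ : series _ = fun N => series (fun k => cterm (nc c) k x) N * tb b n x +
      (-1) ^+ b * (series (fun k => cterm (dc c) k x) N * tb (~~ b) n x)).
    by apply: cvgD; [apply: cvgMr_tmp|apply: cvgMl_tmp; apply: cvgMr_tmp].
  apply/funext => N; rewrite !seriesE !mulr_suml mulr_sumr -big_split/=.
  by apply: eq_bigr => k _; rewrite addition_formula.
have iu := proj2 u1.
transitivity (\int[mu]_(x in period) (u x * z x)).
  apply: ae_Rintegral => //.
  - apply: measurable_funM; first exact: integrable_meas.
    apply: measurable_funD; last apply: measurable_funM => //.
      by apply: integrable_meas; apply: integrable_tb; case: v1.
    by apply: integrable_meas; apply: integrable_tb; case: w1.
  - by apply: measurable_funM; [exact: integrable_meas|exact: continuous_meas].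
  by apply: ae_imp (ae_and vE wE) => x [-> ->] _; rewrite zE.
have E x : u x * z x = tsum (fun m => u x * (m%:R * (c false m * tb b (m + n)%N x +
    (-1) ^+ b * (c true m * tb (~~ b) (m + n)%N x)))).
  by rewrite tsumZ//; apply: (dom_cvg (fun m => zt m x) uB).
under eq_Rintegral do rewrite E.
have [|||||_ ->] := @Rintegral_tsum R period (fun m x => u x * (m%:R *
    (c false m * tb b (m + n)%N x + (-1) ^+ b * (c true m * tb (~~ b) (m + n)%N x))))
    (fun m => m%:R * absm c m) B (fun x => `|u x|) mP.
- move=> m; apply: measurable_funM; first exact: integrable_meas.
  exact: continuous_meas.
- by move=> m x _; rewrite normrM mulrC ler_wpM2r.
- by move=> m; rewrite mulr_ge0// absm_ge0.
- exact: uB.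
- exact: integrable_norm.
have [K cK] : exists K, forall k, absm c k <= K.
  exists B => k; apply: (term_le_sumby _ (absm_ge0 c)).
  exact: sumby_absm (coef0 u0) uB.
rewrite -tsumZ; last first.
  by apply: (dom_cvg (v := fun m => m%:R * absm c m * absm c (m + n)%N)
      _ (convol_sumby n uB cK)) => m; exact: NLt_le.
apply: eq_tsum => m.
have Em x : u x * (m%:R * (c false m * tb b (m + n)%N x +
      (-1) ^+ b * (c true m * tb (~~ b) (m + n)%N x))) =
    (m%:R * c false m) * (u x * tb b (m + n)%N x) +
    (m%:R * ((-1) ^+ b * c true m)) * (u x * tb (~~ b) (m + n)%N x) by ring.
under eq_Rintegral do rewrite Em.
rewrite RintegralD// ?RintegralZl//; try apply: integrableZ => //; try exact: integrable_tb.
by rewrite -!/(fc u _ _) !fc_coef -/c; ring.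
Qed.

End Operators.

(** * Duhamel formula *)

Section LinearODE.
Context {R : realType}.
Notation mu := (@lebesgue_measure R).
Implicit Types (x s f : R -> R) (r a T t z M : R).

Lemma derive_ge0_le (F f : R -> R) (a b : R) : a <= b ->
  (forall t, a < t < b -> is_derive t 1 F (f t)) -> continuous F ->
  (forall t, a < t < b -> 0 <= f t) -> F a <= F b.
Proof.
rewrite le_eqVlt => /predU1P[->//|ab] dF cF f0.
have dF' t : t \in `]a, b[ -> is_derive t 1 F (f t) by rewrite in_itv/=; exact: dF.
have [c cab e] := MVT ab dF' (continuous_subspaceT cF).
rewrite -subr_ge0 e mulr_ge0 ?subr_ge0 ?(ltW ab)//.
by apply: f0; move: cab; rewrite in_itv.
Qed.

(* The base point -1 keeps [prim f] differentiable at 0. *)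
Definition prim f t : R :=
  \int[mu]_(z in `[-1, t]) f z - \int[mu]_(z in `[-1, 0]) f z.

Lemma is_derive_prim f t : continuous f -> -1 < t -> is_derive t 1 (prim f) (f t).
Proof.
move=> cf t1.
have [d1 d2] := @continuous_FTC1_closed R f (-1) t (t + 1) (etrans (ltrDl t 1) ltr01)
  (continuous_integrable_itv (-1) (t + 1) cf) t1 (cf t).
rewrite -[f t]subr0; apply: is_deriveB.
by rewrite -d2 derive1E; apply: derivableP.
Qed.

Lemma prim0 f : prim f 0 = 0.
Proof. by rewrite /prim subrr. Qed.

(** Curves are frozen for negative times. They are then continuous on the whole line, while the
    equation is claimed for positive times only. *)
Definition clamp (t : R) : R := Num.max 0 t.

Lemma clamp_ge0 t : 0 <= clamp t.
Proof. by rewrite le_max lexx. Qed.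

Lemma clampE t : 0 <= t -> clamp t = t.
Proof. by move=> t0; apply/max_idPr. Qed.

Lemma clamp_near t : 0 < t -> \forall y \near t, clamp y = y.
Proof.
move=> t0; near=> y; apply: clampE; apply: ltW; near: y; exact: lt_nbhsr.
Unshelve. all: by end_near. Qed.

Lemma continuous_clamp : continuous clamp.
Proof.
move=> t; apply: continuous_max; [exact: cvg_cst|exact: cvg_id].
Qed.

Lemma continuous_prim_clamp f : continuous f -> continuous (fun t => prim f (clamp t)).
Proof.
move=> cf t; apply: (@continuous_comp _ _ _ clamp (prim f)); first exact: continuous_clamp.
by apply: is_derive_continuous; apply: is_derive_prim => //; apply: lt_le_trans (clamp_ge0 t); rewrite ltrN10.
Qed.

Lemma is_derive_prim_clamp f t : continuous f -> 0 < t ->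
  is_derive t 1 (fun t => prim f (clamp t)) (f t).
Proof.
move=> cf t0; apply: (@near_eq_is_derive _ _ _ (prim f)).
  by near=> y; congr (prim f _); apply/esym; near: y; exact: clamp_near.
by apply: is_derive_prim => //; apply: lt_trans t0; rewrite ltrN10.
Unshelve. all: by end_near. Qed.

(** The primitive is nondecreasing and vanishes at both ends, hence is constant, and f is its
    derivative. *)
Lemma integral0_continuous f T : continuous f -> (forall t, 0 <= f t) ->
  \int[mu]_(t in `[0, T]) f t = 0 -> forall t, 0 < t < T -> f t = 0.
Proof.
move=> cf f0 If t /andP[t0 tT]; have T0 := lt_trans t0 tT.
pose P y := prim f (clamp y); have cP : continuous P by exact: continuous_prim_clamp.
have dP (y : R) : 0 < y -> is_derive y 1 P (f y) by move=> y0; exact: is_derive_prim_clamp.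
have P0 : P 0 = 0 by rewrite /P clampE// prim0.
have PT : P T = 0.
  have dP0 y : 0 < y < T -> is_derive y 1 P (f y) by move=> /andP[y0 _]; exact: dP.
  by have := @Rintegral_ftc R f P 0 T (ltW T0) dP0 cP cf; rewrite If P0 subr0.
have Pz y : 0 < y < T -> P y = 0.
  move=> /andP[y0 yT]; apply/eqP; rewrite eq_le -{1}PT -{1}P0; apply/andP; split.
    apply: (@derive_ge0_le P f) => // [|z /andP[z0 _]]; [exact: ltW|by apply: dP; exact: lt_trans z0].
  apply: (@derive_ge0_le P f) => // [|z /andP[z0 _]]; [exact: ltW|exact: dP].
have d0 : is_derive t 1 P 0.
  apply: (@near_eq_is_derive _ _ _ (cst 0)).
  by near=> y; rewrite Pz//; apply/andP; split; near: y; [exact: lt_nbhsr|exact: lt_nbhsl].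
by have [_ <-] := dP t t0; have [_ ->] := d0.
Unshelve. all: by end_near. Qed.

Definition duh r a s t : R :=
  expR (- (r * clamp t)) * (a + prim (fun z => r * expR (r * z) * s z) (clamp t)).

Definition ode r s x T : Prop := continuous x /\
  forall t, 0 < t < T -> is_derive t 1 x (r * (s t - x t)).

Lemma continuous_expRM r : continuous (fun z : R => expR (r * z)).
Proof.
move=> z; apply: (@continuous_comp _ _ _ (fun z => r * z) expR).
  by apply: cvgMl_tmp; exact: cvg_id.
exact: continuous_expR.
Qed.

Lemma is_derive_expRM r (t : R) :
  is_derive t 1 (fun z : R => expR (r * z)) (r * expR (r * t)).
Proof.
by apply: is_derive_eq; rewrite /GRing.scale/= ?mulr0 ?addr0 ?mulr1 ?add0r mulrC.
Qed.

Lemma duh0 r a s t : t <= 0 -> duh r a s t = a.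
Proof.
move=> t0; rewrite /duh /clamp; move/max_idPl : t0 => ->.
by rewrite prim0 mulr0 oppr0 expR0 mul1r addr0.
Qed.

Lemma duh_ode r a s T : continuous s -> ode r s (duh r a s) T.
Proof.
move=> cs; pose g z := r * expR (r * z) * s z.
have cg : continuous g.
  move=> z; apply: cvgM; last exact: cs.
  by apply: cvgMl_tmp; exact: continuous_expRM.
have cp t : -1 < t -> {for t, continuous (prim g)}.
  by move=> t1; apply: is_derive_continuous (is_derive_prim cg t1).
pose h z := expR (- r * z) * (a + prim g z).
have hE t : duh r a s t = h (clamp t) by rewrite /duh /h mulNr.
have dh t : (-1 : R) < t -> is_derive t 1 h (r * (s t - h t)).
  move=> t1; apply: is_derive_eq (is_deriveM (is_derive_expRM (- r) t)
    (is_deriveD (is_derive_cst a t 1) (is_derive_prim cg t1))) _.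
  rewrite ?fctE /GRing.scale/= add0r /h /g mulNr.
  rewrite -[X in _ = r * (X - _)]mul1r -[X in _ = r * (X * _ - _)](expRxMexpNx_1 (r * t)).
  by ring.
split.
  move=> t; rewrite (_ : duh r a s = h \o clamp); last exact/funext.
  apply: continuous_comp; first exact: continuous_clamp.
  apply: is_derive_continuous (dh _ _); apply: lt_le_trans (clamp_ge0 t).
  by rewrite ltrN10.
move=> t /andP[t0 _]; rewrite hE clampE ?(ltW t0)//.
have /dh dt : -1 < t by apply: lt_trans t0; rewrite ltrN10.
apply: (@near_eq_is_derive _ _ _ h) => //.
by near=> y; rewrite hE (_ : clamp y = y)//; near: y; exact: clamp_near.
Unshelve. all: by end_near. Qed.

(** Source and damping share the factor r, so e^(r t) (M + x) and e^(r t) (M - x) have nonnegative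
    derivatives as long as |s| <= M. The bound depends neither on r nor on T. *)
Lemma ode_bound r s x T M t : 0 <= r -> ode r s x T -> 0 <= t <= T ->
  (forall z, 0 < z < T -> `|s z| <= M) -> 0 <= M -> `|x t| <= `|x 0| + M.
Proof.
move=> r0 [cx dx] /andP[t0 tT] sM M0.
have H (e : R) : `|e| = 1 -> M + e * x 0 <= expR (r * t) * (M + e * x t).
  move=> e1; pose F z := expR (r * z) * (M + e * x z).
  have -> : M + e * x 0 = F 0 by rewrite /F mulr0 expR0 mul1r.
  apply: (@derive_ge0_le F (fun z => r * expR (r * z) * (M + e * s z))) => //.
  - move=> z /andP[z0 zt].
    have dz : is_derive z 1 x (r * (s z - x z)).
      by apply: dx; rewrite z0 (lt_le_trans zt).
    apply: is_derive_eq (is_deriveM (is_derive_expRM r z)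
      (is_deriveD (is_derive_cst M z 1) (is_deriveZ e dz))) _.
    rewrite -[LHS]/(expR (r * z) * (0 + e * (r * (s z - x z))) +
      (M + e * x z) * (r * expR (r * z))); ring.
  - move=> z; apply: cvgM; first exact: continuous_expRM.
    by apply: cvgD; [exact: cvg_cst|apply: cvgMl_tmp; exact: cx].
  - move=> z /andP[z0 zt]; rewrite !mulr_ge0 ?expR_ge0//.
    have zT : `|e * s z| <= M by rewrite normrM e1 mul1r sM// z0 (lt_le_trans zt).
    by move: zT; rewrite ler_norml => /andP[? ?]; lra.
have E1 : 1 <= expR (r * t) by rewrite (le_trans _ (expR_ge1Dx _))// lerDl mulr_ge0.
have := H 1; have := H (- 1); rewrite normrN normr1 !mulN1r !mul1r.
move=> /(_ erefl) H1 /(_ erefl) H2.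
have := ler_norm (x 0); have := ler_norm (- x 0); rewrite normrN.
move: (expR _) E1 H1 H2 => E E1 H1 H2 n1 n2; rewrite ler_norml; apply/andP; split.
- rewrite lerNl -subr_ge0 -(@pmulr_rge0 _ E) ?(lt_le_trans ltr01 E1)//.
  have := normr_ge0 (x 0) => ?; nra.
- rewrite -subr_ge0 -(@pmulr_rge0 _ E) ?(lt_le_trans ltr01 E1)//.
  have := normr_ge0 (x 0) => ?; nra.
Qed.

Lemma odeB r s s' x x' T : ode r s x T -> ode r s' x' T ->
  ode r (fun t => s t - s' t) (fun t => x t - x' t) T.
Proof.
move=> [cx dx] [cx' dx']; split; first by move=> t; apply: cvgB; [exact: cx|exact: cx'].
move=> t tT; apply: is_derive_eq (is_deriveB (dx t tT) (dx' t tT)) _; ring.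
Qed.

Lemma ode_unique r s x x' T t : 0 <= r -> ode r s x T -> ode r s x' T -> x 0 = x' 0 ->
  0 <= t <= T -> x t = x' t.
Proof.
move=> r0 ox ox' e tT.
have := ode_bound (M := 0) r0 (odeB ox ox') tT _ (lexx 0).
rewrite e subrr normr0 addr0 => H; apply/eqP; rewrite -subr_eq0 -normr_le0.
by apply: H => z _; rewrite subrr normr0.
Qed.

End LinearODE.

(** * Picard iteration *)

Section NonlinearBounds.
Context {R : realType}.
Implicit Types (c x y : bool -> nat -> R) (A D : nat -> R) (a d B : R).

(** Majorant of the terms of the nonlinearity. Two sequences are allowed because the energy estimate
    keeps the solution itself in the second factor. *)
Definition cvt A D n m : R := m%:R * A m * D (m + n)%N.
Definition cv A n : R := tsum (cvt A A n).

Lemma cvt_ge0 A D n m : (forall k, 0 <= A k) -> (forall k, 0 <= D k) -> 0 <= cvt A D n m.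
Proof. by move=> A0 D0; rewrite /cvt !mulr_ge0. Qed.

Lemma cvt_sumby A D a d n : (forall k, 0 <= A k) -> (forall k, 0 <= D k) ->
  sumby (fun m => m%:R * A m) a -> sumby (fun m => m%:R * D m) d ->
  sumby (cvt A D n) (a * d).
Proof.
move=> A0 D0 Aa Dd N; apply: (@le_trans _ _ (series (fun m => d * (m%:R * A m)) N)).
  apply: ler_series => -[|m]; first by rewrite /cvt !mul0r mulr0.
  rewrite /cvt mulrC ler_wpM2r ?mulr_ge0//.
  apply: le_trans (term_le_sumby (m.+1 + n) _ Dd); last by move=> k; rewrite mulr_ge0.
  by rewrite ler_peMl// ler1n.
by rewrite mulrC; apply: sumbyZ => //; exact: sumby_ge0 Dd.
Qed.

Lemma cv_ge0 A n : (forall k, 0 <= A k) -> cvgn (series (cvt A A n)) -> 0 <= cv A n.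
Proof.
move=> A0 cA; apply: limr_ge => //; apply: nearW => N.
by apply: series_ge0 => m; exact: cvt_ge0.
Qed.

(** Majorant method: p' q' - p q = (p' - p) q' + p (q' - q), and the same identity for the majorants
    dominates it term by term. Increments bounded by increments thus remain so after the
    nonlinearity. *)
Lemma NLt_diff x y A D b n m :
  (forall b k, `|x b k| <= A k) -> (forall b k, `|y b k - x b k| <= D k - A k) ->
  `|NLt y b n m - NLt x b n m| <= 2 * (cvt D D n m - cvt A A n m).
Proof.
move=> xA yD.
have K p q p' q' (k l : nat) : `|p : R| <= A k -> `|q| <= A l ->
    `|p' - p| <= D k - A k -> `|q' - q| <= D l - A l ->
    `|p' * q' - p * q| <= D k * D l - A k * A l.
  move=> pA qA pD qD.
  have q'D : `|q'| <= D l.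
    rewrite -[q'](subrK q); apply: le_trans (ler_normD _ _) _; lra.
  have -> : p' * q' - p * q = (p' - p) * q' + p * (q' - q) by ring.
  apply: le_trans (ler_normD _ _) _; rewrite !normrM.
  have -> : D k * D l - A k * A l = (D k - A k) * D l + A k * (D l - A l) by ring.
  by apply: lerD; apply: ler_pM.
rewrite /NLt -mulrBr normrM normr_nat /cvt -!mulrA -mulrBr [X in _ <= X]mulrCA ler_wpM2l//.
rewrite opprD addrACA -mulrBr; apply: le_trans (ler_normD _ _) _.
rewrite [X in _ + X]normrM normrX normrN1 expr1n mul1r mulr2n mulrDl mul1r.
by apply: lerD; apply: K.
Qed.

Lemma NLt_le2 x A b n m : (forall b k, `|x b k| <= A k) ->
  `|NLt x b n m| <= 2 * cvt A A n m.
Proof.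
move=> xA; have A0 k : 0 <= A k by apply: le_trans (xA b k).
rewrite /NLt normrM normr_nat /cvt -!mulrA [X in _ <= X]mulrCA ler_wpM2l//.
apply: le_trans (ler_normD _ _) _; rewrite !normrM normrX normrN1 expr1n mul1r.
by rewrite [2]mulr2n mulrDl mul1r; apply: lerD; apply: ler_pM.
Qed.

Lemma NL_le x A a b n : (forall b k, `|x b k| <= A k) ->
  sumby (fun m => m%:R * A m) a -> `|NL x b n| <= 2 * cv A n.
Proof.
move=> xA Aa; have A0 k : 0 <= A k by apply: le_trans (xA b k).
have cA := cvt_sumby n A0 A0 Aa Aa.
have cA0 m : 0 <= cvt A A n m by exact: cvt_ge0.
rewrite /cv -tsumZ; last exact: sumby_cvg cA.
by apply: (@tsum_norm _ _ _ (2 * (a * a))); [move=> m; exact: NLt_le2|exact: sumbyZ].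
Qed.

Lemma NL_diff x y A D d b n : (forall b k, `|x b k| <= A k) ->
  (forall b k, `|y b k - x b k| <= D k - A k) ->
  sumby (fun m => m%:R * D m) d ->
  `|NL y b n - NL x b n| <= 2 * (cv D n - cv A n).
Proof.
move=> xA yD Dd.
have A0 k : 0 <= A k by apply: le_trans (xA b k).
have AD k : A k <= D k by rewrite -subr_ge0; apply: le_trans (yD b k).
have D0 k : 0 <= D k by apply: le_trans (AD k).
have Aa : sumby (fun m => m%:R * A m) d.
  by apply: sumby_le Dd => m; rewrite ler_wpM2l.
have yD' b' k : `|y b' k| <= D k.
  rewrite -[y b' k](subrK (x b' k)); apply: le_trans (ler_normD _ _) _.
  have := yD b' k; have := xA b' k; lra.
have cA := cvt_sumby n A0 A0 Aa Aa; have cD := cvt_sumby n D0 D0 Dd Dd.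
have sA : cvgn (series (cvt A A n)) by apply: sumby_cvg cA => m; exact: cvt_ge0.
have sD : cvgn (series (cvt D D n)) by apply: sumby_cvg cD => m; exact: cvt_ge0.
rewrite /cv -tsumB// -tsumZ; last exact: is_cvg_seriesB.
have nx : cvgn (series (NLt x b n)).
  by apply: (dom_cvg (v := fun m => 2 * cvt A A n m) _ (sumbyZ _ cA)) => // m; exact: NLt_le2.
have ny : cvgn (series (NLt y b n)).
  by apply: (dom_cvg (v := fun m => 2 * cvt D D n m) _ (sumbyZ _ cD)) => // m; exact: NLt_le2.
rewrite -tsumB//; apply: (@tsum_norm _ _ _ (2 * (d * d))).
  by move=> m; exact: NLt_diff.
apply: sumby_le (sumbyZ _ cD) => // m.
by rewrite ler_wpM2l// gerBl cvt_ge0.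
Qed.

Lemma NL_continuous (X : bool -> nat -> R -> R) A a b n :
  (forall b k, continuous (X b k)) -> (forall b k t, `|X b k t| <= A k) ->
  sumby (fun m => m%:R * A m) a ->
  continuous (fun t => NL (fun b k => X b k t) b n).
Proof.
move=> cX XA Aa; have A0 k : 0 <= A k by apply: le_trans (XA b k 0).
apply: (@mtest_continuous R R (fun m t => NLt (fun b k => X b k t) b n m)
  (fun m => 2 * cvt A A n m) (2 * (a * a))).
- move=> m t; apply: cvgMl_tmp; apply: cvgD; first by apply: cvgM; exact: cX.
  by apply: cvgMl_tmp; apply: cvgM; exact: cX.
- by move=> m t; apply: NLt_le2 => b' k; exact: XA.
by apply: sumbyZ => //; exact: cvt_sumby.
Qed.

Lemma cv_l1 A a : (forall k, 0 <= A k) -> sumby (fun m => m%:R * A m) a ->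
  sumby (fun n => n%:R * cv A n) (a * a).
Proof.
move=> A0 Aa.
apply: (@sumby_lim _ (fun M n => n%:R * series (cvt A A n) M)) => [n|M N].
  apply: cvgMl_tmp; apply: sumby_cvg (cvt_sumby n A0 A0 Aa Aa) => m; exact: cvt_ge0.
exact: young_l1.
Qed.

Lemma tsum_l2 (W A D : nat -> R) a B : (forall n, 0 <= W n) ->
  (forall m n, W n <= W (m + n)%N) -> (forall n, 0 <= A n) ->
  (forall n, cvgn (series (cvt A D n))) ->
  sumby (fun m => m%:R * A m) a -> sumby (fun n => W n * D n ^+ 2) B ->
  sumby (fun n => W n * tsum (cvt A D n) ^+ 2) (a ^+ 2 * B).
Proof.
move=> W0 Wm A0 cD Aa DB.
apply: (@sumby_lim _ (fun M n => W n * series (cvt A D n) M ^+ 2)) => [n|M N].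
  apply: cvgMl_tmp; under eq_fun do rewrite expr2; rewrite expr2.
  by apply: cvgM; exact: cD.
exact: young_l2.
Qed.

End NonlinearBounds.

(** * Convergence of the iteration under its majorants *)

Section Picard.
Context {R : realType}.
Variables (x0 : bool -> nat -> R) (al : nat -> R) (de : R).
Hypothesis x0al : forall b n, `|x0 b n| <= al n.
Hypothesis alde : sumby (fun n => n%:R * al n) de.
Hypothesis de8 : 8 * de <= 1.

Let al0 n : 0 <= al n. Proof. exact: le_trans (x0al false n). Qed.
Let de0 : 0 <= de. Proof. exact: sumby_ge0 alde. Qed.

(* [pA] is a majorant of the iterates [pX], and its increments majorize theirs:
   |pX k.+1 - pX k| <= pA k.+1 - pA k. *)
Fixpoint pA (k : nat) : nat -> R :=
  if k is k'.+1 then fun n => al n + 2 * cv (pA k') n else fun=> 0.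

Fixpoint pX (k : nat) : bool -> nat -> R -> R :=
  if k is k'.+1 then
    fun b n => duh n%:R (x0 b n) (fun t => NL (fun b m => pX k' b m t) b n)
  else fun _ _ _ => 0.

(** With a = 2 de, [cv_l1] gives de + 2 a^2 = de + 8 de^2, which is at most 2 de when 8 de <= 1. *)
Lemma pA_spec k : (forall n, 0 <= pA k n) /\ sumby (fun n => n%:R * pA k n) (2 * de).
Proof.
elim: k => [|k [IH0 IH]] /=.
  by split=> // N; rewrite seriesE big1 ?mulr_ge0// => i _; rewrite mulr0.
have cg n := sumby_cvg (fun m => cvt_ge0 n m IH0 IH0) (cvt_sumby n IH0 IH0 IH IH).
split=> [n|].
  by rewrite addr_ge0// mulr_ge0// cv_ge0//; exact: cg.
have H := sumbyD alde (sumbyZ (ler0n R 2) (cv_l1 IH0 IH)).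
move=> N; apply: (@le_trans _ _ (de + 2 * (2 * de * (2 * de)))); last first.
  have : 0 <= de * (1 - 8 * de) by rewrite mulr_ge0// subr_ge0.
  lra.
apply: le_trans (H N); apply: ler_series => n.
by rewrite mulrDr [2 * (_ * _)]mulrCA.
Qed.

Let pA0 k n : 0 <= pA k n. Proof. exact: (pA_spec k).1. Qed.
Let pA1 k : sumby (fun n => n%:R * pA k n) (2 * de). Proof. exact: (pA_spec k).2. Qed.
Let pAc k n : cvgn (series (cvt (pA k) (pA k) n)).
Proof.
exact: sumby_cvg (fun m => cvt_ge0 n m (pA0 k) (pA0 k)) (cvt_sumby n (pA0 k) (pA0 k) (pA1 k) (pA1 k)).
Qed.

Lemma pX_le k : (forall b n, continuous (pX k b n)) /\
  (forall b n t, `|pX k b n t| <= pA k n).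
Proof.
elim: k => [|k [IHc IHA]]; first by split=> [b n t|b n t]; [exact: cvg_cst|rewrite normr0].
have cs b n := @NL_continuous R _ _ _ b n IHc IHA (pA1 k).
split=> [b n|b n t]; first by have [] := @duh_ode R n%:R (x0 b n) _ 1 (cs b n).
have c0 : 0 <= cv (pA k) n by exact: cv_ge0.
have [t0|t0] := leP t 0.
  by rewrite /= duh0// (le_trans (x0al b n))// lerDl mulr_ge0.
apply: le_trans (ode_bound (ler0n R n) (duh_ode _ (x0 b n) t (cs b n)) _ _ _) _.
- by rewrite lexx (ltW t0).
- by move=> z _; exact: NL_le (pA1 k).
- by rewrite mulr_ge0.
- by rewrite duh0// lerD2r.
Qed.

Let pXc k b n : continuous (pX k b n). Proof. exact: (pX_le k).1. Qed.
Let pXA k b n t : `|pX k b n t| <= pA k n. Proof. exact: (pX_le k).2. Qed.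

Lemma NLX_continuous k b n : continuous (fun t => NL (fun b m => pX k b m t) b n).
Proof. exact: NL_continuous (pA1 k). Qed.

Lemma duh_diff n a (s s' : R -> R) M t : continuous s -> continuous s' ->
  (forall z, `|s z - s' z| <= M) ->
  `|duh n%:R a s t - duh n%:R a s' t| <= M :> R.
Proof.
move=> cs cs' sM; have M0 : 0 <= M by apply: le_trans (sM 0).
have [t0|t0] := leP t 0; first by rewrite !duh0// subrr normr0.
have H := @ode_bound R n%:R _ _ t M t (ler0n R n)
  (odeB (duh_ode n%:R a t cs) (duh_ode n%:R a t cs')).
apply: le_trans (H _ _ M0) _ => [|z _|]; [by rewrite lexx (ltW t0)|exact: sM|].
by rewrite !duh0// subrr normr0 add0r.
Qed.

Lemma pX_diff k b n t : `|pX k.+1 b n t - pX k b n t| <= pA k.+1 n - pA k n.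
Proof.
elim: k b n t => [|k IH] b n t; first by rewrite !subr0 pXA.
have -> : pA k.+2 n - pA k.+1 n = 2 * (cv (pA k.+1) n - cv (pA k) n) by rewrite /=; ring.
apply: (duh_diff _ _ _ (@NLX_continuous k.+1 b n) (@NLX_continuous k b n)) => z.
by apply: NL_diff (pA1 k.+1) => b' m; [exact: pXA|exact: IH].
Qed.

Definition dA k n : R := pA k.+1 n - pA k n.

Lemma dA_ge0 k n : 0 <= dA k n.
Proof. by apply: le_trans (pX_diff k false n 0). Qed.

Lemma pA_le k n : pA k n <= al n + 2 * (2 * de * (2 * de)).
Proof.
case: k => [|k]; first by rewrite addr_ge0// !mulr_ge0.
rewrite lerD2l ler_wpM2l//; apply: tsum_le; first exact: pAc.
exact: cvt_sumby.
Qed.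

Lemma series_dA n N : series (dA^~ n) N = pA N n.
Proof.
elim: N => [|N IH]; first by rewrite series0n.
by rewrite seriesrS IH /dA addrC subrK.
Qed.

Lemma sumby_dA n : sumby (dA^~ n) (al n + 2 * (2 * de * (2 * de))).
Proof. by move=> N; rewrite series_dA pA_le. Qed.

(** Both limits are written as telescoping series, so that the increments of the majorants serve at
    once as the dominating series for tails and for continuity in time. *)
Definition pAlim n : R := tsum (dA^~ n).
Definition pXlim b n t : R := tsum (fun k => pX k.+1 b n t - pX k b n t).

Lemma pA_cvg n : pA^~ n @ \oo --> pAlim n.
Proof.
have c : series (dA^~ n) @ \oo --> pAlim n := sumby_cvg (dA_ge0^~ n) (@sumby_dA n).
by rewrite (_ : pA^~ n = series (dA^~ n))//; apply/funext => N; rewrite series_dA.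
Qed.

Lemma pA_le_lim k n : pA k n <= pAlim n.
Proof. by rewrite -series_dA; exact: (le_series_tsum k (dA_ge0^~ n) (@sumby_dA n)). Qed.

Lemma pXlim_diff k b n t : `|pXlim b n t - pX k b n t| <= pAlim n - pA k n.
Proof.
rewrite -series_dA; have := dom_tail k (fun k => pX_diff k b n t) (@sumby_dA n).
rewrite (_ : series _ k = pX k b n t)//; elim: k => [|k IH]; first by rewrite series0n.
by rewrite seriesrS IH addrC subrK.
Qed.

Lemma pXlim_continuous b n : continuous (pXlim b n).
Proof.
apply: (@mtest_continuous R R (fun k t => pX k.+1 b n t - pX k b n t) (dA^~ n)
  _ _ _ (@sumby_dA n)) => [k t|k t]; last exact: pX_diff.
by apply: cvgB; exact: pXc.
Qed.

Lemma pXlim_le b n t : `|pXlim b n t| <= pAlim n.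
Proof. by have := pXlim_diff 0 b n t; rewrite !subr0. Qed.

Lemma pAlim_l1 : sumby (fun n => n%:R * pAlim n) (2 * de).
Proof.
apply: (@sumby_lim _ (fun k n => n%:R * pA k n)) pA1 => n.
by apply: cvgMl_tmp; exact: pA_cvg.
Qed.

Lemma pAlim_ge0 n : 0 <= pAlim n.
Proof. by apply: le_trans (pXlim_le false n 0). Qed.

(** Half of the fixed point equation for the limit majorant, obtained by Fatou. This half bounds the
    nonlinearity of the limit, in [pXlim_duh] and later in the Lipschitz bound in time. *)
Lemma pAlim_cv n : 2 * cv pAlim n <= pAlim n - al n.
Proof.
rewrite -ler_pdivlMl//; apply: tsum_le.
  exact: sumby_cvg (fun m => cvt_ge0 n m pAlim_ge0 pAlim_ge0)
    (cvt_sumby n pAlim_ge0 pAlim_ge0 pAlim_l1 pAlim_l1).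
apply: (@sumby_lim _ (fun k m => cvt (pA k) (pA k) n m)) => [m|k N].
  by apply: cvgM; [apply: cvgMl_tmp|]; exact: pA_cvg.
apply: (@le_trans _ _ (cv (pA k) n)).
  exact: le_series_tsum N (fun m => cvt_ge0 n m (pA0 k) (pA0 k)) (cvt_sumby n (pA0 k) (pA0 k) (pA1 k) (pA1 k)).
rewrite ler_pdivlMl// lerBrDl; exact: (pA_le_lim k.+1).
Qed.

Lemma NLXlim_continuous b n : continuous (fun t => NL (fun b m => pXlim b m t) b n).
Proof. exact: NL_continuous pXlim_continuous pXlim_le pAlim_l1. Qed.

(** Both sides are within the remaining increment A_n - A^{k+1}_n of the iterate k + 1, and this
    remainder tends to 0. *)
Lemma pXlim_duh b n t :
  pXlim b n t = duh n%:R (x0 b n) (fun t => NL (fun b m => pXlim b m t) b n) t.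
Proof.
apply/eqP; rewrite -subr_eq0 -normr_le0.
have H k : `|pXlim b n t - duh n%:R (x0 b n) (fun t => NL (fun b m => pXlim b m t) b n) t|
    <= 2 * (pAlim n - pA k.+1 n).
  rewrite -[X in X - _](subrK (pX k.+1 b n t)) -addrA.
  apply: le_trans (ler_normD _ _) _; rewrite mulr2n mulrDl mul1r.
  apply: lerD; first exact: pXlim_diff.
  rewrite distrC; apply: (@le_trans _ _ (2 * (cv pAlim n - cv (pA k) n))).
    apply: (duh_diff _ _ _ (@NLXlim_continuous b n) (@NLX_continuous k b n)) => z.
    by apply: NL_diff pAlim_l1 => b' m; [exact: pXA|exact: pXlim_diff].
  have := pAlim_cv n; rewrite /=; lra.
have c : (fun k => 2 * (pAlim n - pA k.+1 n)) @ \oo --> 2 * (pAlim n - pAlim n).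
  apply: cvgMl_tmp; apply: cvgB; first exact: cvg_cst.
  by have := @pA_cvg n; rewrite -(cvg_shiftS (pA^~ n)).
move: c; rewrite subrr mulr0 => c; rewrite -(cvg_lim _ c)//.
by apply: limr_ge; [exact: cvgP c|exact: nearW].
Qed.

Lemma pXlim_ode b n T : ode n%:R (fun t => NL (fun b m => pXlim b m t) b n) (pXlim b n) T.
Proof.
rewrite (_ : pXlim b n = duh n%:R (x0 b n) (fun t => NL (fun b m => pXlim b m t) b n)).
  exact: duh_ode (@NLXlim_continuous b n).
by apply/funext => t; exact: pXlim_duh.
Qed.

Lemma pXlim0 b n t : t <= 0 -> pXlim b n t = x0 b n.
Proof. by move=> t0; rewrite pXlim_duh duh0. Qed.

(** For n = 0 the equation reads x' = 0: the zero average is conserved. *)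
Lemma pXlim_mode0 b t : x0 b 0%N = 0 -> pXlim b 0%N t = 0.
Proof.
move=> x00; have [t0|t0] := leP t 0; first by rewrite pXlim0.
have := ode_unique (lexx 0) (pXlim_ode b 0 t) (x' := fun=> 0).
apply; [|by rewrite pXlim0|by rewrite (ltW t0) lexx].
split=> z; first exact: cvg_cst.
by move=> _; rewrite mul0r; exact: is_derive_cst.
Qed.

(** The bound 4 B is propagated along the iteration: (x + 2 y)^2 <= 2 x^2 + 8 y^2 and Young's
    inequality give 2 B + 8 (2 de)^2 (4 B), and 64 de^2 <= 1 makes the second term at most 2 B. *)
Lemma pAlim_l2 (W : nat -> R) B : (forall n, 0 <= W n) ->
  (forall m n, W n <= W (m + n)%N) -> sumby (fun n => W n * al n ^+ 2) B ->
  sumby (fun n => W n * pAlim n ^+ 2) (4 * B).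
Proof.
move=> W0 Wm alB; have B0 := sumby_ge0 alB.
apply: (@sumby_lim _ (fun k n => W n * pA k n ^+ 2)) => [n|].
  apply: cvgMl_tmp; under eq_fun do rewrite expr2; rewrite expr2.
  by apply: cvgM; exact: pA_cvg.
elim=> [|k IH] N.
  by rewrite seriesE big1 ?mulr_ge0// => i _; rewrite expr0n mulr0.
have H := tsum_l2 W0 Wm (pA0 k) (@pAc k) (pA1 k) IH.
have := sumbyD (sumbyZ (ler0n R 2) alB) (sumbyZ (ler0n R 8) H).
move=> /(_ N) {}H; apply: (@le_trans _ _ (2 * B + 8 * ((2 * de) ^+ 2 * (4 * B)))).
  apply: le_trans H; apply: ler_series => n.
  rewrite -/(cv (pA k) n) /=; have := W0 n; move: (W n) (al n) (cv _ _) => w a c w0.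
  rewrite -subr_ge0.
  have -> : 2 * (w * a ^+ 2) + 8 * (w * c ^+ 2) - w * (a + 2 * c) ^+ 2 = w * (a - 2 * c) ^+ 2.
    ring.
  by rewrite mulr_ge0// sqr_ge0.
have d2 : (8 * de) ^+ 2 <= 1 by rewrite exprn_ile1// mulr_ge0.
have := ler_wpM2r B0 d2; lra.
Qed.

End Picard.

(** * Energy estimate *)

Section Energy.
Context {R : realType}.
Notation mu := (@lebesgue_measure R).
Notation integrable_on D f := (mu.-integrable D (EFin \o f)).

Lemma continuous_sqr (f : R -> R) : continuous f -> continuous (fun t => f t ^+ 2).
Proof.
move=> cf; rewrite (_ : (fun t => f t ^+ 2) = fun t => f t * f t).
  by move=> t; apply: cvgM; exact: cf.
by apply/funext => t; rewrite expr2.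
Qed.

Lemma Rintegral_series (D : set R) (f : nat -> R -> R) N : measurable D ->
  (forall n, integrable_on D (f n)) ->
  integrable_on D (fun x => series (f^~ x) N) /\
  \int[mu]_(x in D) series (f^~ x) N = series (fun n => \int[mu]_(x in D) f n x) N.
Proof.
move=> mD fi; elim: N => [|N [IHi IH]].
  split; last first.
    by under eq_Rintegral do rewrite series0n; rewrite Rintegral_cst// mul0r series0n.
  rewrite (_ : (fun x => series (f^~ x) 0) = fun x => 0 * f 0 x).
    exact: integrableZ.
  by apply/funext => x; rewrite series0n mul0r.
have E : (fun x => series (f^~ x) N.+1) = fun x => series (f^~ x) N + f N x.
  by apply/funext => x; rewrite seriesrS.
by rewrite E seriesrS -IH RintegralD//; split=> //; exact: integrable_add.
Qed.

(** The derivative of x^2 is 2 r x (s - x) <= r (s^2 - x^2); integrate and drop x(T)^2. *)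
Lemma energy_ode (r T : R) (s x : R -> R) : 0 <= r -> 0 <= T -> continuous s ->
  ode r s x T ->
  r * \int[mu]_(t in `[0, T]) (x t ^+ 2) <=
  x 0 ^+ 2 + r * \int[mu]_(t in `[0, T]) (s t ^+ 2).
Proof.
move=> r0 T0 cs [cx dx].
have cg : continuous (fun t => 2 * (x t * (r * (s t - x t)))).
  move=> t; apply: cvgMl_tmp; apply: cvgM; first exact: cx.
  by apply: cvgMl_tmp; apply: cvgB; [exact: cs|exact: cx].
have cx2 := continuous_sqr cx; have cs2 := continuous_sqr cs.
have E : \int[mu]_(t in `[0, T]) (2 * (x t * (r * (s t - x t)))) = x T ^+ 2 - x 0 ^+ 2.
  apply: (@Rintegral_ftc R _ (fun t => x t ^+ 2)) => // t tT.
  have := is_deriveM (dx t tT) (dx t tT).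
  rewrite (_ : (fun t => x t ^+ 2) = x * x); last by apply/funext => y; rewrite expr2.
  by move=> d; apply: is_derive_eq d _; rewrite /GRing.scale/=; ring.
have ii f : continuous f -> integrable_on `[0, T] f by exact: continuous_integrable_itv.
have mI : measurable `[0, T]%classic by exact: measurable_itv.
have H : \int[mu]_(t in `[0, T]) (2 * (x t * (r * (s t - x t)))) <=
    \int[mu]_(t in `[0, T]) (r * (s t ^+ 2) - r * (x t ^+ 2)).
  apply: le_Rintegral => //; first exact: ii.
    by apply: integrable_sub => //; apply: integrableZ => //; exact: ii.
  move=> t _; rewrite -subr_ge0.
  have -> : r * s t ^+ 2 - r * x t ^+ 2 - 2 * (x t * (r * (s t - x t))) =
    r * (s t - x t) ^+ 2 by ring.
  by rewrite mulr_ge0// sqr_ge0.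
move: H; rewrite E RintegralB ?RintegralZl//; try exact: ii; try by apply: integrableZ => //; exact: ii.
have := sqr_ge0 (x T); lra.
Qed.

Variables (X : bool -> nat -> R -> R) (A : nat -> R) (a : R).
Hypothesis cX : forall b n, continuous (X b n).
Hypothesis XA : forall b n t, `|X b n t| <= A n.
Hypothesis Aa : sumby (fun n => n%:R * A n) a.
Hypothesis a4 : 4 * a <= 1.
Hypothesis oX : forall b n T,
  ode n%:R (fun t => NL (fun b m => X b m t) b n) (X b n) T.

Let A0 n : 0 <= A n. Proof. exact: le_trans (XA false n 0). Qed.
Let z n t : R := `|X false n t| + `|X true n t|.

Lemma cvtAz_cvg n t : cvgn (series (cvt A (z^~ t) n)).
Proof.
have z0 k : 0 <= z k t by rewrite addr_ge0.
have zA : sumby (fun m => m%:R * z m t) (2 * a).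
  apply: sumby_le (sumbyZ (ler0n R 2) Aa) => m; rewrite mulrCA ler_wpM2l//.
  by rewrite mulr2n mulrDl mul1r; apply: lerD; exact: XA.
exact: sumby_cvg (fun m => cvt_ge0 n m A0 z0) (cvt_sumby n A0 z0 Aa zA).
Qed.

(** Only the factor of index m is replaced by its majorant. The other stays the solution at time t,
    so Young's inequality returns a multiple of the very norm that the damping controls. *)
Lemma NL_le_cvtAz b n t : `|NL (fun b m => X b m t) b n| <= tsum (cvt A (z^~ t) n).
Proof.
have z0 k : 0 <= z k t by rewrite addr_ge0.
apply: (@tsum_norm _ _ _ (tsum (cvt A (z^~ t) n))); last first.
  move=> N; apply: nondecreasing_cvgn_le (@cvtAz_cvg n t) _.
  by apply/nondecreasing_seqP => k; rewrite seriesrS lerDl cvt_ge0.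
move=> m; rewrite normrM normr_nat /cvt -mulrA ler_wpM2l//.
apply: le_trans (ler_normD _ _) _; rewrite !normrM normrX normrN1 expr1n mul1r.
rewrite /z; case: b => /=.
  by rewrite addrC mulrDr; apply: lerD; apply: ler_pM.
by rewrite mulrDr; apply: lerD; apply: ler_pM.
Qed.

(** As 4 a^2 <= 1/4, the nonlinear term costs at most a quarter of the dissipated energy E, and E <=
    Y0 + E / 4. The hypothesis with B makes the series [Phi] converge uniformly in time, so that E
    is a genuine finite number and the absorption is legitimate. *)
Lemma energy_bound (V : nat -> R) (T B Y0 : R) : 0 <= T -> (forall n, 0 <= V n) ->
  (forall m n, V n <= V (m + n)%N) ->
  sumby (fun n => n%:R * V n * A n ^+ 2) B ->
  sumby (fun n => V n * (X false n 0 ^+ 2 + X true n 0 ^+ 2)) Y0 ->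
  sumby (fun n => n%:R * V n *
     \int[mu]_(t in `[0, T]) (X false n t ^+ 2 + X true n t ^+ 2)) (2 * Y0).
Proof.
move=> T0 V0 Vm VB VY; pose W n := n%:R * V n.
have W0 n : 0 <= W n by rewrite mulr_ge0.
have Wm m n : W n <= W (m + n)%N by apply: ler_pM => //; rewrite ler_nat leq_addl.
have a0 := sumby_ge0 Aa; have Y00 := sumby_ge0 VY.
pose q n t := X false n t ^+ 2 + X true n t ^+ 2.
have q0 n t : 0 <= q n t by rewrite addr_ge0// sqr_ge0.
have cq n : continuous (q n) by move=> t; apply: cvgD; exact: continuous_sqr.
have X2 b n t : X b n t ^+ 2 <= A n ^+ 2.
  by rewrite -real_normK ?num_real// lerXn2r ?nnegrE.
have q2 n t : q n t <= 2 * A n ^+ 2 by rewrite mulr2n mulrDl mul1r; apply: lerD.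
pose Phi t := tsum (fun n => W n * q n t).
have Wq t : sumby (fun n => W n * q n t) (2 * B).
  by apply: sumby_le (sumbyZ (ler0n R 2) VB) => n; rewrite mulrCA ler_wpM2l.
have Wq0 t n : 0 <= W n * q n t by rewrite mulr_ge0.
have cPhi : continuous Phi.
  apply: (@mtest_continuous R R (fun n t => W n * q n t)
    (fun n => 2 * (n%:R * V n * A n ^+ 2)) (2 * B)).
  - by move=> n t; apply: cvgMl_tmp; exact: cq.
  - by move=> n t; rewrite ger0_norm// mulrCA ler_wpM2l.
  - exact: sumbyZ.
pose nl n t := NL (fun b m => X b m t) false n ^+ 2 + NL (fun b m => X b m t) true n ^+ 2.
have cNL b n : continuous (fun t => NL (fun b m => X b m t) b n).
  exact: NL_continuous cX XA Aa.
have cnl n : continuous (nl n) by move=> t; apply: cvgD; exact: continuous_sqr.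
have nlPhi N t : series (fun n => W n * nl n t) N <= 4^-1 * Phi t.
  have zPhi : sumby (fun n => W n * z n t ^+ 2) (2 * Phi t).
    have PhiB : sumby (fun n => W n * q n t) (Phi t).
      by move=> M; exact: le_series_tsum (Wq t).
    apply: sumby_le (sumbyZ (ler0n R 2) PhiB) => n; rewrite [X in _ <= X]mulrCA ler_wpM2l//.
    rewrite /z /q -(real_normK (num_real (X false n t))) -(real_normK (num_real (X true n t))).
    by move: `|X false n t| `|X true n t| => x y; have := sqr_ge0 (x - y); lra.
  have H := tsum_l2 W0 Wm A0 (fun n => @cvtAz_cvg n t) Aa zPhi.
  have := sumbyZ (ler0n R 2) H; move=> /(_ N) H2.
  apply: (@le_trans _ _ (2 * (a ^+ 2 * (2 * Phi t)))).
    apply: le_trans H2; apply: ler_series => n; rewrite [X in _ <= X]mulrCA ler_wpM2l//.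
    rewrite mulr2n mulrDl mul1r /nl.
    have sq b : NL (fun b m => X b m t) b n ^+ 2 <= tsum (cvt A (z^~ t) n) ^+ 2.
      have l := NL_le_cvtAz b n t.
      by rewrite -real_normK ?num_real// lerXn2r ?nnegrE// (le_trans _ l).
    by apply: lerD; exact: sq.
  have P0 : 0 <= Phi t by have := sumby_ge0 zPhi; rewrite pmulr_rge0.
  have d2 : (4 * a) ^+ 2 <= 1 by rewrite exprn_ile1// mulr_ge0.
  have := ler_wpM2r P0 d2; lra.
have mI : measurable `[0, T]%classic by exact: measurable_itv.
have ii f : continuous f -> integrable_on `[0, T] f by exact: continuous_integrable_itv.
pose E := \int[mu]_(t in `[0, T]) Phi t.
have EE : E = tsum (fun n => W n * \int[mu]_(t in `[0, T]) q n t).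
  rewrite /E /Phi; have [|||||_ ->] := @Rintegral_tsum R `[0, T] (fun n t => W n * q n t)
      (fun n => 2 * (n%:R * V n * A n ^+ 2)) (2 * B) (fun=> 1) mI.
  - by move=> n; apply: continuous_meas => // t; apply: cvgMl_tmp; exact: cq.
  - by move=> n t _; rewrite mulr1 ger0_norm// mulrCA ler_wpM2l.
  - by move=> n; rewrite !mulr_ge0// sqr_ge0.
  - exact: sumbyZ.
  - by apply: ii => t; exact: cvg_cst.
  by apply: eq_tsum => n; rewrite RintegralZl//; exact: ii.
have part : sumby (fun n => W n * \int[mu]_(t in `[0, T]) q n t) (Y0 + 4^-1 * E).
  move=> N; apply: (@le_trans _ _ (series (fun n => V n * q n 0) N +
      series (fun n => W n * \int[mu]_(t in `[0, T]) nl n t) N)).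
    rewrite !seriesE -big_split/=; apply: ler_sum => n _.
    have en b := energy_ode (ler0n R n) T0 (cNL b n) (oX b n T).
    have := ler_wpM2l (V0 n) (lerD (en false) (en true)).
    rewrite /nl /W /q !RintegralD//; try by apply: ii; exact: continuous_sqr.
    by lra.
  apply: lerD; first exact: VY.
  have Wi n : integrable_on `[0, T] (fun t => W n * nl n t).
    by apply: integrableZ => //; exact: ii.
  have [i1 e1] := Rintegral_series N mI Wi.
  rewrite /E -RintegralZl//; last exact: ii.
  apply: (@le_trans _ _ (\int[mu]_(t in `[0, T]) series (fun n => W n * nl n t) N)).
    rewrite e1; apply: ler_series => n; rewrite RintegralZl//; exact: ii.
  have iP : integrable_on `[0, T] (fun t => 4^-1 * Phi t).
    by apply: integrableZ => //; exact: ii.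
  by apply: le_Rintegral => // t _; exact: nlPhi.
have : E <= Y0 + 4^-1 * E.
  rewrite {1}EE; apply: (tsum_le _ part).
  apply: sumby_cvg part => n; rewrite mulr_ge0//; apply: Rintegral_ge0 => t _; exact: q0.
move=> EY N; apply: le_trans (part N) _; lra.
Qed.

Lemma energy_sobolev (sg T Y0 : R) : 0 <= sg -> 0 <= T ->
  sumby (fun n => n%:R `^ (2 * sg) * (X false n 0 ^+ 2 + X true n 0 ^+ 2)) Y0 ->
  sumby (fun n => n%:R `^ (2 * sg + 1) *
     \int[mu]_(t in `[0, T]) (X false n t ^+ 2 + X true n t ^+ 2)) (2 * Y0).
Proof.
move=> sg0 T0 Y N; have a0 := sumby_ge0 Aa.
(* Freezing the weights beyond N makes all the series converge a priori. *)
pose V n : R := (minn n N)%:R `^ (2 * sg).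
have mono m n : (m <= n)%N -> m%:R `^ (2 * sg) <= n%:R `^ (2 * sg) :> R.
  by move=> mn; rewrite ge0_ler_powR ?nnegrE ?mulr_ge0// ler_nat.
have V0 n : 0 <= V n by exact: powR_ge0.
have Vm m n : V n <= V (m + n)%N.
  by apply: mono; rewrite leq_min geq_minr andbT (leq_trans (geq_minl _ _))// leq_addl.
have VB : sumby (fun n => n%:R * V n * A n ^+ 2) (N%:R `^ (2 * sg) * a * a).
  apply: (@sumby_le _ _ (fun n => N%:R `^ (2 * sg) * a * (n%:R * A n))) => [n|]; last first.
    by apply: sumbyZ => //; rewrite mulr_ge0 ?powR_ge0.
  have -> : n%:R * V n * A n ^+ 2 = V n * A n * (n%:R * A n) by ring.
  have [->|n0] := posnP n; first by rewrite mul0r !mulr0.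
  apply: ler_wpM2r; first by rewrite mulr_ge0.
  apply: ler_pM => //; first by apply: mono; exact: geq_minr.
  apply: le_trans (term_le_sumby n _ Aa); last by move=> k; rewrite mulr_ge0.
  by rewrite ler_peMl// ler1n.
have VY : sumby (fun n => V n * (X false n 0 ^+ 2 + X true n 0 ^+ 2)) Y0.
  apply: sumby_le Y => n; apply: ler_wpM2r; first by rewrite addr_ge0// sqr_ge0.
  by apply: mono; exact: geq_minl.
apply: le_trans (energy_bound T0 V0 Vm VB VY N).
rewrite !seriesE; apply: ler_sum => n _; apply: ler_wpM2r.
  by apply: Rintegral_ge0 => t _; rewrite addr_ge0// sqr_ge0.
rewrite /V (minn_idPl (ltnW (ltn_ord n))).
case: (nat_of_ord n) => [|k]; first by rewrite mul0r powR0// gt_eqF// ltr_wpDl// mulr_ge0.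
rewrite powRD; last by rewrite pnatr_eq0 implybT.
by rewrite powRr1// mulrC.
Qed.

End Energy.

(** * The smallness condition *)

Section Smallness.
Context {R : realType}.
Implicit Types (s N : R).

Lemma ln_ge (x : R) : 0 < x -> 1 - x^-1 <= ln x.
Proof.
move=> x0; rewrite -[ln x]opprK -lnV// lerNr opprB.
rewrite -[X in ln X](subrK 1) addrC; apply: le_ln1Dx.
by rewrite ltrBrDl subrr invr_gt0.
Qed.

Lemma xlnx_ge_id (x : R) : 0 < x -> x <= x * ln x + 1.
Proof.
move=> x0; have := ler_wpM2l (ltW x0) (ln_ge x0).
by rewrite mulrBr mulr1 divff ?gt_eqF//; lra.
Qed.

(** Lower bound that does not degenerate as x tends to 0. Through q = sqrt x it becomes 2 (q^2 - q)
    + 1 >= 1/2, a perfect square. *)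
Lemma xlnx_ge_half (x : R) : 0 < x -> 2^-1 <= x * ln x + 1.
Proof.
move=> x0; have q0 : 0 < Num.sqrt x by rewrite sqrtr_gt0.
have := ln_ge q0; have e := sqr_sqrtr (ltW x0).
have -> : ln x = 2 * ln (Num.sqrt x).
  by rewrite -[in LHS]e lnXn// mulr_natl.
rewrite -[X in _ -> _ <= X * _ + 1]e => l.
have := ler_wpM2l (ltW (exprn_gt0 2 q0)) l.
have -> : Num.sqrt x ^+ 2 * (1 - (Num.sqrt x)^-1) = Num.sqrt x ^+ 2 - Num.sqrt x.
  by field; rewrite gt_eqF.
move: (Num.sqrt x) (ln _) => q L h; have := sqr_ge0 (q - 2^-1); lra.
Qed.

Lemma hs_interpolation s1 s2 c (B1 B2 : R) :
  0 <= B1 -> 0 <= B2 ->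
  sumby (hs s1 c) (B1 ^+ 2) -> sumby (hs s2 c) (B2 ^+ 2) ->
  (forall b, c b 0%N = 0) ->
  sumby (hs ((s1 + s2) / 2) c) (B1 * B2).
Proof.
move=> B10 B20 h1 h2 c0 N.
have S0 : 0 <= series (hs ((s1 + s2) / 2) c) N by apply: series_ge0 => n; exact: hs_ge0.
have e : series (hs ((s1 + s2) / 2) c) N =
    series (fun n => Num.sqrt (hs s1 c n) * Num.sqrt (hs s2 c n)) N.
  rewrite !seriesE; apply: eq_bigr => -[[|n] /= _] _.
    by rewrite /hs !c0 expr0n/= addr0 !mulr0 sqrtr0 mulr0.
  rewrite -sqrtrM ?hs_ge0// /hs mulrACA -powRD; last by rewrite pnatr_eq0 implybT.
  rewrite -expr2; have -> : 2 * s1 + 2 * s2 = (2 * ((s1 + s2) / 2)) * 2%:R by field.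
  rewrite [in RHS]powRrM powR_mulrn ?powR_ge0// -exprMn sqrtr_sqr ger0_norm//.
  by rewrite mulr_ge0 ?powR_ge0// addr_ge0// sqr_ge0.
have H := cauchy_schwarz_series (fun n => Num.sqrt (hs s1 c n)) (fun n => Num.sqrt (hs s2 c n)) N.
rewrite -(@ler_pXn2r _ 2)// ?nnegrE ?mulr_ge0// exprMn e.
apply: le_trans H _; apply: ler_pM.
- by apply: series_ge0 => n; exact: sqr_ge0.
- by apply: series_ge0 => n; exact: sqr_ge0.
- by apply: le_trans (h1 N); apply: ler_series => n; rewrite sqr_sqrtr// hs_ge0.
- by apply: le_trans (h2 N); apply: ler_series => n; rewrite sqr_sqrtr// hs_ge0.
Qed.

(** H^{3/2} alone fails logarithmically to control sum_n n |x_n|. The embedding is therefore applied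
    at the midpoint 3/2 + eps/2, whose squared norm is bounded by the product of the two given
    norms. *)
Lemma small_data (eps : R) : 0 < eps -> exists C : R, 0 < C /\
  forall f0 : R -> R, sobolev (3 / 2) f0 -> sobolev (3 / 2 + eps) f0 ->
  sobolev_norm (3 / 2) f0 < eps ^+ 2 /
     (C * (sobolev_norm (3 / 2 + eps) f0 * ln (sobolev_norm (3 / 2 + eps) f0) + 1) ^+ 2) ->
  sumby (fun n => n%:R * absm (coef f0) n) 8^-1.
Proof.
move=> e0; (* 2 (1 + 1/eps) is the constant of [sobolev_embedding] at exponent (3 + eps)/2
   and h N <= 2 eps^2 / C; this value of C turns the bound into 8^-2. *)
have [C CE] : {C : R | C = 256 * ((1 + eps^-1) * eps ^+ 2)} by eexists.
have C0 : 0 < C.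
  rewrite CE; apply: mulr_gt0; first by rewrite ltr0n.
  by rewrite mulr_gt0 ?exprn_gt0// addr_gt0// invr_gt0.
exists C; split=> // f0 h1 h2.
have s1 : 0 < 3 / 2 :> R by lra.
have s2 : 0 < 3 / 2 + eps by rewrite addr_gt0.
have B1 := sumby_sobolev s1 h1; have B2 := sumby_sobolev s2 h2.
set h := sobolev_norm (3 / 2) f0 in B1 *; set N := sobolev_norm (3 / 2 + eps) f0 in B2 *.
have hn0 : 0 <= h by exact: sqrtr_ge0.
have N0 : 0 <= N by exact: sqrtr_ge0.
move=> hC; have p1 : 1 <= pi :> R by have := @pi_ge2 R; lra.
have p0 : 0 < pi :> R by exact: pi_gt0.
have hN : h * N <= 2 * eps ^+ 2 / C.
  have [->|Np] := eqVneq N 0; first by rewrite mulr0 divr_ge0 ?(ltW C0)// mulr_ge0 ?sqr_ge0.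
  have {}Np : 0 < N by rewrite lt_neqAle eq_sym Np.
  (* With q = N ln N + 1, the bounds N <= q and 1/2 <= q give h N C / 2 <= h N C q <= h C q^2 <=
     eps^2. *)
  have q1 := xlnx_ge_id Np; have q2 := xlnx_ge_half Np.
  move: hC; move: (N * ln N + 1) q1 q2 => q q1 q2.
  have q0 : 0 < q by lra.
  rewrite ltr_pdivlMr ?mulr_gt0 ?exprn_gt0// => /ltW hC.
  rewrite ler_pdivlMr//.
  have : h * N * C * q <= h * (C * q ^+ 2).
    have -> : h * (C * q ^+ 2) = h * q * C * q by ring.
    by rewrite !ler_wpM2r ?(ltW C0) ?(ltW q0)// ler_wpM2l.
  move=> H; have := le_trans H hC => H2.
  have H3 : h * N * C * 2^-1 <= h * N * C * q by rewrite ler_wpM2l// !mulr_ge0// (ltW C0).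
  have := le_trans H3 H2; lra.
have f00 := coef0 (let: And3 _ z _ := h1 in z).
have s12 : sumby (hs (3 / 2 + eps / 2) (coef f0)) (h / Num.sqrt pi * (N / Num.sqrt pi)).
  have -> : 3 / 2 + eps / 2 = (3 / 2 + (3 / 2 + eps)) / 2 :> R by field.
  have sq (x : R) : (x / Num.sqrt pi) ^+ 2 = x ^+ 2 / pi.
    by rewrite exprMn exprVn sqr_sqrtr// (ltW p0).
  by apply: hs_interpolation => //; rewrite ?sq// divr_ge0// sqrtr_ge0.
have e3 : 3 / 2 < 3 / 2 + eps / 2 by lra.
have H := sobolev_sumby_absm e3 s12.
move=> M; apply: le_trans (H M) _.
rewrite -[8^-1]ger0_norm// -sqrtr_sqr ler_wsqrtr//.
have -> : 2 * (3 / 2 + eps / 2) - 3 = eps by field.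
have -> : h / Num.sqrt pi * (N / Num.sqrt pi) = h * N / pi.
  by rewrite mulrACA -invfM -expr2 sqr_sqrtr// ltW.
have ie : 0 < 1 + eps^-1 by rewrite addr_gt0// invr_gt0.
apply: (@le_trans _ _ (2 * (1 + eps^-1) * (2 * eps ^+ 2 / C))).
  rewrite ler_wpM2l ?mulr_ge0 ?(ltW ie)//; apply: le_trans hN.
  by rewrite ler_pdivrMr// ler_peMr// mulr_ge0.
rewrite CE le_eqVlt; apply/orP; left; apply/eqP; field.
by rewrite gt_eqF//= gt_eqF// addr_gt0.
Qed.

End Smallness.

(** * Integrals depending on a parameter *)

Section JointContinuity.
Context {R : realType}.
Notation mu := (@lebesgue_measure R).
Notation integrable_on D f := (mu.-integrable D (EFin \o f)).
Implicit Types (H G : R -> R -> R).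

Definition jc H : Prop := continuous (fun p : R * R => H p.1 p.2).

Lemma jc_slice1 H x : jc H -> continuous (H^~ x).
Proof.
move=> cH t; apply: (@continuous_comp _ _ _ (fun t => (t, x)) (fun p : R * R => H p.1 p.2)).
  exact: (@cvg_pair _ _ _ (nbhs t) (nbhs t) (nbhs x) _ _ _ id (cst x) cvg_id (cvg_cst x)).
exact: cH.
Qed.

Lemma jc_slice2 H t : jc H -> continuous (H t).
Proof.
move=> cH x; apply: (@continuous_comp _ _ _ (fun x => (t, x)) (fun p : R * R => H p.1 p.2)).
  exact: (@cvg_pair _ _ _ (nbhs x) (nbhs t) (nbhs x) _ _ _ (cst t) id (cvg_cst t) cvg_id).
exact: cH.
Qed.

Lemma jcM H G : jc H -> jc G -> jc (fun t x => H t x * G t x).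
Proof. by move=> cH cG p; apply: cvgM; [exact: cH|exact: cG]. Qed.

Lemma jc_norm H : jc H -> jc (fun t x => `|H t x|).
Proof.
move=> cH p; apply: (@continuous_comp _ _ _ (fun p : R * R => H p.1 p.2) (fun y : R => `|y|)).
  exact: cH.
exact: norm_continuous.
Qed.

Lemma jc_time (f : R -> R) : continuous f -> jc (fun t _ => f t).
Proof.
move=> cf p; apply: (@continuous_comp _ _ _ (fun p : R * R => p.1) f); last exact: cf.
exact: cvg_fst.
Qed.

Lemma jc_space (f : R -> R) : continuous f -> jc (fun _ x => f x).
Proof.
move=> cf p; apply: (@continuous_comp _ _ _ (fun p : R * R => p.2) f); last exact: cf.
exact: cvg_snd.
Qed.

Lemma jc_box_bounded H (a b c d : R) : jc H -> exists2 K, 0 <= K &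
  forall t x, a <= t <= b -> c <= x <= d -> `|H t x| <= K.
Proof.
move=> cH.
have cpt : compact (`[a, b]%classic `*` `[c, d]%classic : set (R * R)).
  by apply: compact_setX; exact: segment_compact.
have : compact ((fun p : R * R => H p.1 p.2) @` (`[a, b]%classic `*` `[c, d]%classic)).
  by apply: continuous_compact => //; exact: continuous_subspaceT.
move/compact_bounded => [M [_ HM]].
exists (Num.max 0 (M + 1)); first by rewrite le_max lexx.
move=> t x tab xcd; rewrite le_max; apply/orP; right.
apply: HM; first by rewrite ltrDl.
by exists (t, x) => //=; split; rewrite /= in_itv.
Qed.

Lemma param_continuous H : jc H ->
  continuous (fun t => \int[mu]_(x in period) H t x).
Proof.
move=> cH t; have [K K0 HK] := jc_box_bounded (t - 1) (t + 1) 0 (pi *+ 2) cH.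
have := @continuity_under_integral R _ (measurableTypeR R) mu H period (@measurable_period R)
  (t - 1) (t + 1) _ _ (cst K) _ _ t.
apply.
- move=> y _; apply: integrable_period; exact: jc_slice2.
- by apply: aeW => x _ y _; exact: jc_slice1.
- by apply: integrable_period => x; exact: cvg_cst.
- move=> y; rewrite /= in_itv/= => /andP[y1 y2]; apply: aeW => x.
  by rewrite /period/= in_itv/= => xp; apply: HK => //; rewrite (ltW y1) (ltW y2).
- by rewrite inE/= in_itv/= ltrDl ltr01 andbT ltrBlDr ltrDl.
Qed.

Lemma param_derive H Ht : jc H -> jc Ht ->
  (forall t x : R, is_derive t 1 (H^~ x) (Ht t x)) ->
  forall t : R, is_derive t 1 (fun t => \int[mu]_(x in period) H t x)
     (\int[mu]_(x in period) Ht t x).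
Proof.
move=> cH cHt dH t; have [K K0 HK] := jc_box_bounded (t - 1) (t + 1) 0 (pi *+ 2) cHt.
have dE y x : (partial1of2 H) y x = Ht y x by rewrite partial1of2E; apply: derive_val.
have It : `]t - 1, t + 1[%classic t.
  by rewrite /= in_itv/= ltrDl ltr01 andbT ltrBlDr ltrDl.
have iH y : `]t - 1, t + 1[%classic y -> integrable_on period (H y).
  by move=> _; apply: integrable_period; exact: jc_slice2.
have dr y x : `]t - 1, t + 1[%classic y -> period x -> derivable (H^~ x) y 1.
  by move=> _ _; case: (dH y x).
have iK : integrable_on period (cst K) by apply: integrable_period => x; exact: cvg_cst.
have bK y x : `]t - 1, t + 1[%classic y -> period x -> `|(partial1of2 H) y x| <= cst K x.
  rewrite dE /period /= !in_itv/= => /andP[y1 y2] xp.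
  by apply: HK => //; rewrite (ltW y1) (ltW y2).
have := @derivable_under_integral R _ (measurableTypeR R) mu H period
  (@measurable_period R) t _ _ It iH dr (cst K) (fun=> K0) iK bK.
have := @differentiation_under_integral R _ (measurableTypeR R) mu H period
  (@measurable_period R) t _ _ It iH dr (cst K) (fun=> K0) iK bK.
rewrite derive1E => E D; split => //.
by rewrite E; apply: eq_Rintegral => x _; rewrite dE.
Qed.

Lemma jc_trig (c : R -> bool -> nat -> R) (v : nat -> R) B :
  (forall b n, continuous (fun t => c t b n)) ->
  (forall t n, absm (c t) n <= v n) -> sumby v B ->
  jc (fun t x => trig (c t) x).
Proof.
move=> cc cv vB.
apply: (@mtest_continuous R (R * R)%type (fun n p => cterm (c p.1) n p.2) v B) => // [n|n p].
  have E b : jc (fun t x => c t b n * tb b n x).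
    by apply: jcM; [exact: jc_time|exact: jc_space (@continuous_tb R b n)].
  by move=> p; apply: cvgD; [exact: (E false)|exact: (E true)].
by apply: le_trans (cterm_le _ _ _) _.
Qed.

(** Since g is chosen time by time up to null sets, no joint measurability is at hand. Each
    condition involves g only through integrals in x, which do not change when [g t] is replaced by
    the continuous [G t]. *)
Lemma L1_loc_continuous g G : jc G -> (forall t, 0 < t -> torus_L1 (g t)) ->
  (forall t, 0 < t -> ae_equal (g t) (G t)) -> L1_loc_in_time g.
Proof.
move=> cG g1 gG; have mP := @measurable_period R.
have E h t : 0 < t -> measurable_fun period (h : R -> R) ->
    \int[mu]_(x in period) (g t x * h x) = \int[mu]_(x in period) (G t x * h x).
  move=> t0 mh; apply: ae_Rintegral => //.
  - by apply: measurable_funM => //; apply: integrable_meas; case: (g1 t t0).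
  - by apply: measurable_funM => //; apply: continuous_meas => //; exact: jc_slice2.
  by apply: ae_imp (gG t t0) => x ->.
split=> // [phi [/(_ 0%N)[cphi _] _ _]|a b a0].
  have mt : measurable (`]0, +oo[%classic : set R) by exact: measurable_itv.
  apply: (@eq_measurable_fun _ _ _ _ _ (fun t => \int[mu]_(x in period) (G t x * phi t x))).
    move=> t; rewrite inE/= in_itv/= andbT => t0; rewrite E//.
    by apply: continuous_meas => //; exact: jc_slice2.
  by apply: continuous_meas => //; apply: param_continuous; exact: jcM.
have mI : measurable (`[a, b]%classic : set R) by exact: measurable_itv.
have -> : (\int[mu]_(t in `[a, b]) \int[mu]_(x in period) `|g t x|%:E =
    \int[mu]_(t in `[a, b]) (\int[mu]_(x in period) `|G t x|)%:E)%E.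
  apply: eq_integral => t; rewrite inE/= in_itv/= => /andP[at_ _].
  have t0 : 0 < t by exact: lt_le_trans at_.
  have iG : integrable_on period (fun x => `|G t x|).
    by apply: integrable_norm; apply: integrable_period; exact: jc_slice2 cG.
  rewrite /Rintegral fineK; last exact: integrable_fin_num.
  apply: ae_eq_integral => //.
  - by apply: mEFin; apply: measurableT_comp => //; apply: integrable_meas; case: (g1 t t0).
  - exact: measurable_int iG.
  by apply: ae_imp (gG t t0) => x -> _.
have : integrable_on `[a, b] (fun t => \int[mu]_(x in period) `|G t x|).
  by apply: continuous_integrable_itv; apply: param_continuous; exact: jc_norm.
move/integrableP => [_]; apply: le_lt_trans; rewrite le_eqVlt; apply/orP; left; apply/eqP.
by apply: eq_integral => t _ /=; rewrite ger0_norm//; apply: Rintegral_ge0.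
Qed.

Lemma Rintegral_halfline_support (al be : R) (I J : R -> R) : 0 < al ->
  (forall t, 0 < t -> I t = J t) -> (forall t, ~ (al <= t <= be) -> J t = 0) ->
  \int[mu]_(t in `]0, +oo[) I t = \int[mu]_(t in `[al, be]) J t.
Proof.
move=> al0 IJ Jz; transitivity (\int[mu]_(t in `]0, +oo[) (J \_ `[al, be]) t).
  apply: eq_Rintegral => t; rewrite inE/= in_itv/= andbT => t0; rewrite IJ//.
  rewrite patchE; case: ifPn => // /negP H; apply: Jz => h; apply: H.
  by rewrite inE/= in_itv.
rewrite -Rintegral_mkcondr; congr (Rintegral _ _ _).
apply/seteqP; split=> t /=; first by case.
by rewrite !in_itv/= andbT => h; split=> //; case/andP: h => h _; exact: lt_le_trans h.
Qed.

End JointContinuity.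

(** * Weak formulation *)

Section TestFunctions.
Context {R : realType}.
Notation mu := (@lebesgue_measure R).
Notation integrable_on D f := (mu.-integrable D (EFin \o f)).
Implicit Types (H phi : R -> R -> R) (psi w : R -> R).

Lemma Ck_jc k H : Ck k H -> jc H.
Proof. by case: k => [|k] []. Qed.

Lemma CkS k H : Ck k.+1 H ->
  [/\ forall t x : R, is_derive t 1 (H^~ x) (dt H t x),
      forall t x : R, is_derive x 1 (H t) (dx H t x),
      Ck k (dt H) & Ck k (dx H)].
Proof.
move=> [_ [dH c1 c2]]; split; [move=> t x|move=> t x|exact: c1|exact: c2].
  by have [/derivableP + _] := dH t x; rewrite -derive1E.
by have [_ /derivableP] := dH t x; rewrite -derive1E.
Qed.

Lemma periodic_derive psi (psi' : R -> R) T : (forall x : R, is_derive x 1 psi (psi' x)) ->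
  periodic psi T -> periodic psi' T.
Proof.
move=> dpsi ppsi x.
have dT : is_derive x 1 (fun y => y + T) 1 by apply: is_derive_eq; rewrite addr0.
have d1 := @is_derive1_comp R psi (fun y => y + T) x _ _ (dpsi (x + T)) dT.
have e : psi \o (fun y => y + T) = psi by apply/funext => y /=; exact: ppsi.
by move: d1; rewrite e mulr1 => -[_ <-]; have [_ <-] := dpsi x.
Qed.

Lemma fc_le w b n : integrable_on period w -> `|fc w b n| <= \int[mu]_(x in period) `|w x|.
Proof.
have mP := @measurable_period R; move=> iw.
apply: le_trans (le_normr_Rintegral _ _) _ => //; first exact: integrable_tb.
apply: le_Rintegral => //.
- by apply: integrable_norm; exact: integrable_tb.
- exact: integrable_norm.
- by move=> x _; rewrite normrM ler_piMr// tb_le1.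
Qed.

Lemma fc_le_cst w b n K : continuous w -> (forall x, 0 <= x <= pi *+ 2 -> `|w x| <= K) ->
  `|fc w b n| <= K * (pi *+ 2).
Proof.
move=> cw wK; have iw := integrable_period cw; have mP := @measurable_period R.
apply: le_trans (fc_le b n iw) _.
have -> : K * (pi *+ 2) = \int[mu]_(x in period) (cst K x).
  by rewrite Rintegral_cst//; congr (_ * _); exact/esym/(congr1 fine (@mu_period R)).
apply: le_Rintegral => //.
- exact: integrable_norm.
- by apply: integrable_period => x; exact: cvg_cst.
Qed.

Lemma trig_fc_cvg w c B : integrable_on period w -> sumby (absm c) B ->
  cvgn (series (fun n => c false n * fc w false n + c true n * fc w true n)).
Proof.
move=> iw cB; have I0 : 0 <= \int[mu]_(x in period) `|w x| by apply: Rintegral_ge0.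
apply: (dom_cvg _ (sumbyZ I0 cB)) => n; rewrite /absm mulrDr.
apply: le_trans (ler_normD _ _) _.
by apply: lerD; rewrite normrM mulrC ler_wpM2r// fc_le.
Qed.

Lemma fc_zero w b n : (forall x, w x = 0) -> fc w b n = 0.
Proof.
move=> w0; rewrite /fc; under eq_Rintegral do rewrite w0 mul0r.
by rewrite Rintegral_cst ?mul0r//; exact: measurable_period.
Qed.

Lemma tsum0 (u : nat -> R) : (forall n, u n = 0) -> tsum u = 0.
Proof. by move=> u0; rewrite (@tsum_single _ 0%N) ?u0. Qed.

Lemma tsum_comb4 (u1 u2 u3 u4 : nat -> R) : cvgn (series u1) -> cvgn (series u2) ->
  cvgn (series u3) -> cvgn (series u4) ->
  - tsum u1 + tsum u2 - (tsum u3 - tsum u4) =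
  tsum (fun n => - u1 n + u2 n - (u3 n - u4 n)).
Proof.
move=> c1 c2 c3 c4; have c43 : cvgn (series (fun n => u3 n - u4 n)).
  exact: is_cvg_seriesB.
have c21 : cvgn (series (fun n => u2 n - u1 n)) by exact: is_cvg_seriesB.
transitivity (tsum (fun n => u2 n - u1 n - (u3 n - u4 n))).
  by rewrite tsumB// tsumB// tsumB// [- _ + _]addrC.
by apply: eq_tsum => n; rewrite [- _ + _]addrC.
Qed.

Variable phi : R -> R -> R.
Hypothesis tphi : test_function phi.

Let Ckp k : Ck k phi. Proof. by case: tphi. Qed.
Let pphi t : periodic (phi t) (pi *+ 2). Proof. by case: tphi. Qed.

Lemma test_torus t : torus_L1 (phi t).
Proof. by split=> //; apply: integrable_period; exact: jc_slice2 (Ck_jc (Ckp 0)). Qed.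

(** Three integrations by parts give decay n^-3 of the coefficients, so n^-2 remains after the
    factor n. Compact support in time makes the bound on the third derivative uniform in t. *)
Lemma test_decay : exists2 K, 0 <= K &
  forall t b n, n%:R * `|coef (phi t) b n| <= K * n%:R `^ (- (1 + 1)).
Proof.
have [_ _ [a [b [a0 phi0]]]] := tphi.
have [_ d1 _ C1] := CkS (Ckp 3); have [_ d2 _ C2] := CkS C1; have [_ d3 _ C3] := CkS C2.
have [K K0 HK] := jc_box_bounded a b 0 (pi *+ 2) (Ck_jc C3).
have p0 : 0 <= pi :> R by exact: pi_ge0.
have K1 : 0 <= K * (pi *+ 2) / pi by rewrite divr_ge0// mulr_ge0// mulrn_wge0.
exists (K * (pi *+ 2) / pi) => //.
move=> t b' n; have [tab|/negP tab] := boolP (a <= t <= b); last first.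
  have z : fc (phi t) b' n = 0 by apply: fc_zero => x; exact: phi0.
  by rewrite /coef z mul0r normr0 mulr0 mulr_ge0// powR_ge0.
have p1 := periodic_derive (d1 t) (pphi t); have p2 := periodic_derive (d2 t) p1.
have c1 := @jc_slice2 R _ t (Ck_jc C1); have c2 := @jc_slice2 R _ t (Ck_jc C2).
have c3 := @jc_slice2 R _ t (Ck_jc C3).
have nfc (w w' : R -> R) b1 : periodic w (pi *+ 2) -> (forall x : R, is_derive x 1 w (w' x)) ->
    continuous w' -> n%:R * `|fc w b1 n| = `|fc w' (~~ b1) n|.
  move=> pw dw cw'; rewrite (fc_derive _ _ pw dw cw') normrM normrX normrN1 expr1n mul1r.
  by rewrite normrM normr_nat negbK.
have n3 : n%:R * (n%:R * (n%:R * `|fc (phi t) b' n|)) <= K * (pi *+ 2).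
  rewrite (nfc _ _ _ (pphi t) (d1 t) c1) (nfc _ _ _ p1 (d2 t) c2) (nfc _ _ _ p2 (d3 t) c3).
  by apply: fc_le_cst => // x xp; exact: HK.
have [->|n0] := posnP n.
  by rewrite mul0r mulr_ge0// powR_ge0.
have np : 0 < n%:R :> R by rewrite ltr0n.
have -> : n%:R `^ (- (1 + 1)) = n%:R ^- 2 :> R.
  by rewrite powRN -[1 + 1]/(2%:R) powR_mulrn.
have -> : `|coef (phi t) b' n| = `|fc (phi t) b' n| / pi.
  by rewrite /coef normrM normfV (ger0_norm p0).
rewrite ler_pdivlMr ?exprn_gt0//.
have -> : n%:R * (`|fc (phi t) b' n| / pi) * n%:R ^+ 2 =
  n%:R * (n%:R * (n%:R * `|fc (phi t) b' n|)) / pi by ring.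
by rewrite ler_wpM2r ?invr_ge0.
Qed.

Lemma test_absm : exists2 v : nat -> R, (exists B, sumby v B) &
  forall t n, n%:R * absm (coef (phi t)) n <= v n.
Proof.
have [K K0 HK] := test_decay.
exists (fun n => 2 * K * n%:R `^ (- (1 + 1))).
  by exists (2 * K * (1 + 1^-1)); apply: sumbyZ; [rewrite mulr_ge0|exact: pseries_sumby].
move=> t n; rewrite /absm mulrDr -mulrA mulr2n mulrDl mul1r.
by apply: lerD; exact: HK.
Qed.

Lemma test_Lambda t : torus_L1 (Lambda (phi t)) /\
  ae_equal (Lambda (phi t)) (trig (nc (coef (phi t)))).
Proof.
have [v [B vB] Hv] := test_absm; apply: (@Lambda_spec _ _ B); first exact: test_torus.
by apply: sumby_le vB => n; exact: Hv.
Qed.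

Lemma test_dx t : torus_L1 (dx phi t) /\ ae_equal (dx phi t) (trig (dc (coef (phi t)))).
Proof.
have [v [B vB] Hv] := test_absm.
have [_ d1 _ C1] := CkS (Ckp 3).
have T1 : torus_L1 (dx phi t).
  split; first exact: periodic_derive (d1 t) (pphi t).
  by apply: integrable_period; exact: jc_slice2 (Ck_jc C1).
split=> //; apply: (ae_trig T1 (B := B)) => [|b'|b' n].
- by apply: sumby_le vB => n; rewrite absm_dc.
- exact: dc0.
rewrite (fc_derive _ _ (pphi t) (d1 t) (@jc_slice2 R _ t (Ck_jc C1))) fc_coef /dc.
by case: b' => /=; rewrite ?expr1 ?expr0; ring.
Qed.

Lemma continuous_test_coef b n : continuous (fun t => coef (phi t) b n).
Proof.
move=> t; apply: cvgMr_tmp; apply: param_continuous.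
exact: jcM (Ck_jc (Ckp 0)) (jc_space (@continuous_tb R b n)).
Qed.

Lemma jc_test_Lambda : jc (fun t x => trig (nc (coef (phi t))) x).
Proof.
have [v [B vB] Hv] := test_absm.
apply: (@jc_trig R (fun t => nc (coef (phi t))) v B) => // [b n t|t n].
  by apply: cvgMl_tmp; exact: continuous_test_coef.
by rewrite absm_nc.
Qed.

End TestFunctions.

(** * From the system of modes to the weak form of the equation *)

Section WeakFormulation.
Context {R : realType}.
Notation mu := (@lebesgue_measure R).
Notation integrable_on D f := (mu.-integrable D (EFin \o f)).
Variables (X : bool -> nat -> R -> R) (A : nat -> R) (a : R).
Hypothesis cX : forall b n, continuous (X b n).
Hypothesis XA : forall b n t, `|X b n t| <= A n.
Hypothesis A00 : A 0%N = 0.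
Hypothesis Aa : sumby (fun n => n%:R * A n) a.
Hypothesis oX : forall b n T,
  ode n%:R (fun t => NL (fun b m => X b m t) b n) (X b n) T.

Let mP := @measurable_period R.
Let A0 n : 0 <= A n. Proof. exact: le_trans (XA false n 0). Qed.
Let xt t : bool -> nat -> R := fun b n => X b n t.

Definition sol (t : R) : R -> R := trig (xt t).
Let lam t := trig (nc (xt t)).
Let der t := trig (dc (xt t)).

Lemma A_le_nA n : A n <= n%:R * A n.
Proof. by case: n => [|n]; rewrite ?A00 ?mulr0// ler_peMl// ler1n. Qed.

Let absmA t n : absm (xt t) n <= 2 * A n.
Proof. by rewrite mulr2n mulrDl mul1r; apply: lerD; exact: XA. Qed.

Let nA2 : sumby (fun n => 2 * (n%:R * A n)) (2 * a).
Proof. exact: sumbyZ. Qed.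

Let A2 : sumby (fun n => 2 * A n) (2 * a).
Proof. by apply: sumby_le nA2 => n; rewrite ler_wpM2l// A_le_nA. Qed.

Let xabs t : sumby (absm (xt t)) (2 * a).
Proof. exact: sumby_le A2. Qed.

Lemma sol_n_absm t : sumby (fun n => n%:R * absm (xt t) n) (2 * a).
Proof. by apply: sumby_le nA2 => n; rewrite [X in _ <= X]mulrCA ler_wpM2l. Qed.

Lemma X_mode0 b t : X b 0%N t = 0.
Proof. by apply/eqP; rewrite -normr_le0 -A00. Qed.

Lemma sol_torus t : torus_L1 (sol t).
Proof. exact: trig_torus_L1 (xabs t). Qed.

Lemma sol_zero_average t : zero_average (sol t).
Proof. by apply: zero_average_trig (xabs t) _ => b; exact: X_mode0. Qed.

Lemma coef_sol t : coef (sol t) = xt t.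
Proof.
apply/funext => b; apply/funext => n; apply: coef_trig (xabs t) _ => b'; exact: X_mode0.
Qed.

Lemma jc_sol : jc sol.
Proof. by apply: (@jc_trig R xt _ _ _ _ A2) => [b n|t n]; [exact: cX|exact: absmA]. Qed.

Let jc_lam : jc lam.
Proof.
apply: (@jc_trig R (fun t => nc (xt t)) _ _ _ _ nA2) => [b n t|t n].
  by apply: cvgMl_tmp; exact: cX.
by rewrite absm_nc [X in _ <= X]mulrCA ler_wpM2l.
Qed.

Let jc_der : jc der.
Proof.
apply: (@jc_trig R (fun t => dc (xt t)) _ _ _ _ nA2) => [b n t|t n].
  by case: b; rewrite /dc; [apply: cvgN|]; apply: cvgMl_tmp; exact: cX.
by rewrite absm_dc [X in _ <= X]mulrCA ler_wpM2l.
Qed.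

Let sol_Lambda t : torus_L1 (Lambda (sol t)) /\ ae_equal (Lambda (sol t)) (lam t).
Proof.
have := @Lambda_spec R (sol t) (2 * a) (sol_torus t).
by rewrite coef_sol; apply; exact: sol_n_absm.
Qed.

Let sol_weak_deriv t : torus_L1 (weak_deriv (sol t)) /\ ae_equal (weak_deriv (sol t)) (der t).
Proof.
have := @weak_deriv_spec R (sol t) (2 * a) (sol_torus t) (sol_zero_average t).
by rewrite coef_sol; apply; exact: sol_n_absm.
Qed.

Let torus_mul u v c B : torus_L1 (u : R -> R) -> torus_L1 (v : R -> R) -> u = trig c -> sumby (absm c) B ->
  torus_L1 (fun x => u x * v x).
Proof.
move=> [pu iu] [pv iv] uc cB; split=> [x|]; first by rewrite pu pv.
under eq_fun do rewrite mulrC.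
by apply: (integrable_mul_continuous iv); rewrite uc; exact: continuous_trig cB.
Qed.

Lemma sol_L1_loc : [/\ L1_loc_in_time sol,
  L1_loc_in_time (fun t x => sol t x * Lambda (sol t) x) &
  L1_loc_in_time (fun t x => sol t x * weak_deriv (sol t) x)].
Proof.
split.
- apply: (L1_loc_continuous jc_sol) => t _; first exact: sol_torus.
  by apply: aeW.
- apply: (L1_loc_continuous (jcM jc_sol jc_lam)) => t _.
    by apply: torus_mul (sol_torus t) (sol_Lambda t).1 erefl (xabs t).
  by apply: ae_imp (sol_Lambda t).2 => x ->.
- apply: (L1_loc_continuous (jcM jc_sol jc_der)) => t _.
    by apply: torus_mul (sol_torus t) (sol_weak_deriv t).1 erefl (xabs t).
  by apply: ae_imp (sol_weak_deriv t).2 => x ->.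
Qed.

Lemma sol_sobolev1 t : sobolev 1 (sol t).
Proof.
have [] // := @sobolev_sumby R 1 (sol t) (2 * (a * a)) ltr01 (sol_torus t) (sol_zero_average t).
apply: (@sumby_le _ _ (fun n => 2 * (a * (n%:R * A n)))) => [n|]; last first.
  by do 2 apply: sumbyZ => //; exact: sumby_ge0 Aa.
rewrite coef_sol /hs mulr1 powR_mulrn// mulrDr mulr2n mulrDl mul1r.
(* One factor n A_n is bounded by the whole sum a, the other is kept for summation. *)
have H b : n%:R ^+ 2 * X b n t ^+ 2 <= a * (n%:R * A n).
  rewrite -exprMn -real_normK ?num_real// normrM normr_nat expr2.
  have h1 : n%:R * `|X b n t| <= n%:R * A n by rewrite ler_wpM2l.
  apply: ler_pM => //; rewrite ?mulr_ge0// (le_trans h1)//.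
  by apply: (term_le_sumby n _ Aa) => k; rewrite mulr_ge0.
by apply: lerD; exact: H.
Qed.

Lemma Rintegral_comb4 (D : set R) (f1 f2 f3 f4 : R -> R) : measurable D ->
  integrable_on D f1 -> integrable_on D f2 -> integrable_on D f3 -> integrable_on D f4 ->
  \int[mu]_(t in D) (- f1 t + f2 t - (f3 t - f4 t)) =
  - (\int[mu]_(t in D) f1 t) + \int[mu]_(t in D) f2 t -
    (\int[mu]_(t in D) f3 t - \int[mu]_(t in D) f4 t).
Proof.
move=> mD i1 i2 i3 i4.
transitivity (\int[mu]_(t in D) (f2 t - f1 t - (f3 t - f4 t))).
  by apply: eq_Rintegral => t _; rewrite [- _ + _]addrC.
have i21 : integrable_on D (fun t => f2 t - f1 t) by exact: integrable_sub.
have i34 : integrable_on D (fun t => f3 t - f4 t) by exact: integrable_sub.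
by rewrite RintegralB// RintegralB// RintegralB// [- _ + _]addrC.
Qed.

Section WeakForm.
Variable phi : R -> R -> R.
Hypothesis tphi : test_function phi.

Let Cp k : Ck k phi. Proof. by case: tphi. Qed.
Let cphi : jc phi. Proof. exact: Ck_jc (Cp 0). Qed.
Let jdt : jc (dt phi). Proof. by have [_ _ /Ck_jc] := CkS (Cp 1). Qed.
Let jdx : jc (dx phi). Proof. by have [_ _ _ /Ck_jc] := CkS (Cp 1). Qed.
Let Lp t := trig (nc (coef (phi t))).
Let jLp : jc Lp. Proof. exact: jc_test_Lambda. Qed.

Let J1 t := \int[mu]_(x in period) (sol t x * dt phi t x).
Let J2 t := \int[mu]_(x in period) (sol t x * Lp t x).
Let J3 t := \int[mu]_(x in period) (sol t x * lam t x * Lp t x).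
Let J4 t := \int[mu]_(x in period) (sol t x * der t x * dx phi t x).

(** Share of mode n in the weak form at time t. By the equation of the mode it is the time
    derivative of minus the pairing of that mode with the test function. *)
Let g n t : R := - (X false n t * fc (dt phi t) false n + X true n t * fc (dt phi t) true n) +
  n%:R * (X false n t * fc (phi t) false n + X true n t * fc (phi t) true n) -
  n%:R * (fc (phi t) false n * NL (xt t) false n + fc (phi t) true n * NL (xt t) true n).

Let fcX t b n : fc (sol t) b n = pi * X b n t.
Proof. by rewrite fc_coef coef_sol. Qed.

Let identity t : - J1 t + J2 t - (J3 t - J4 t) = tsum (g^~ t).
Proof.
have [v [B vB] Hv] := test_absm tphi.
have nB : sumby (absm (nc (coef (phi t)))) B by apply: sumby_le vB => n; rewrite absm_nc.
have dB : sumby (absm (dc (coef (phi t)))) B by apply: sumby_le vB => n; rewrite absm_dc.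
have i1 : integrable_on period (dt phi t) by apply: integrable_period; exact: jc_slice2 jdt.
have i2 := (sol_torus t).2.
have i3 : integrable_on period (fun x => sol t x * lam t x).
  by apply: integrable_period; exact: (@jc_slice2 R _ t (jcM jc_sol jc_lam)).
have i4 : integrable_on period (fun x => sol t x * der t x).
  by apply: integrable_period; exact: (@jc_slice2 R _ t (jcM jc_sol jc_der)).
have e1 : J1 t = tsum (fun n => X false n t * fc (dt phi t) false n + X true n t * fc (dt phi t) true n).
  rewrite /J1; under eq_Rintegral do rewrite mulrC.
  exact: integral_trig i1 (xabs t).
have c1 := trig_fc_cvg i1 (xabs t).
have e2 := integral_trig i2 nB; have c2 := trig_fc_cvg i2 nB.
have e3 := integral_trig i3 nB; have c3 := trig_fc_cvg i3 nB.
have e4 : J4 t = tsum (fun n => dc (coef (phi t)) false n * fc (fun x => sol t x * der t x) false n +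
    dc (coef (phi t)) true n * fc (fun x => sol t x * der t x) true n).
  rewrite -(integral_trig i4 dB); have [T1 E1] := test_dx tphi t.
  apply: ae_Rintegral => //.
  - by apply: measurable_funM; [exact: integrable_meas i4|exact: integrable_meas T1.2].
  - apply: measurable_funM; first exact: integrable_meas i4.
    by apply: continuous_meas => //; exact: continuous_trig dB.
  by apply: ae_imp E1 => x ->.
have c4 := trig_fc_cvg i4 dB.
have nl b n : fc (fun x => sol t x * lam t x) b n +
    (-1) ^+ b * fc (fun x => sol t x * der t x) (~~ b) n = pi * NL (xt t) b n.
  have := @nonlinear_coef R (sol t) (lam t) (der t) b n (2 * a) (sol_torus t) (sol_zero_average t).
  rewrite coef_sol => <-; last 5 first.
  - exact: sol_n_absm.
  - by apply: (@trig_torus_L1 _ _ (2 * a)); apply: sumby_le (sol_n_absm t) => k; rewrite absm_nc.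
  - exact: aeW.
  - by apply: (@trig_torus_L1 _ _ (2 * a)); apply: sumby_le (sol_n_absm t) => k; rewrite absm_dc.
  - exact: aeW.
  rewrite /fc -RintegralZl//; last exact: integrable_tb.
  rewrite -RintegralD//; last 2 first.
  - exact: integrable_tb.
  - by apply: integrableZ => //; exact: integrable_tb.
  by apply: eq_Rintegral => x _; ring.
rewrite e1 /J2 e2 /J3 e3 e4 (tsum_comb4 c1 c2 c3 c4).
apply: eq_tsum => n; rewrite /g !fcX !(fc_coef (phi t)).
have nl0 := nl false n; have nl1 := nl true n.
rewrite /= expr0 mul1r in nl0; rewrite /= expr1 mulN1r in nl1.
move: nl0 nl1; set p0 := fc _ false n; set p1 := fc _ true n.
set q1 := fc _ true n; set q0 := fc _ false n => nl0 nl1.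
have -> : pi * coef (phi t) false n * NL (xt t) false n = coef (phi t) false n * (p0 + p1).
  by rewrite nl0; ring.
have -> : pi * coef (phi t) true n * NL (xt t) true n = coef (phi t) true n * (q1 - q0).
  by rewrite nl1; ring.
rewrite /nc /dc /= /xt.
move: (coef (phi t) false n) (coef (phi t) true n) (fc _ false n) (fc _ true n) => k0 k1 l0 l1.
move: (X false n t) (X true n t) => x0 x1.
clear -x0 x1 k0 k1 l0 l1 p0 p1 q0 q1; move: p0 p1 q0 q1 (pi : R) => p0 p1 q0 q1 p.
ring.
Qed.

Let cfc (H : R -> R -> R) b n : jc H -> continuous (fun t => fc (H t) b n).
Proof.
by move=> cH; apply: param_continuous; exact: jcM cH (jc_space (@continuous_tb R b n)).
Qed.

Let cNL b n : continuous (fun t => NL (xt t) b n).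
Proof. exact: NL_continuous cX XA Aa. Qed.

Let dfc b n (t : R) : is_derive t 1 (fun s : R => fc (phi s) b n) (fc (dt phi t) b n).
Proof.
apply: (@param_derive R (fun s x => phi s x * tb b n x) (fun s x => dt phi s x * tb b n x)).
- exact: jcM cphi (jc_space (@continuous_tb R b n)).
- exact: jcM jdt (jc_space (@continuous_tb R b n)).
move=> s x; have [dphi _ _ _] := CkS (Cp 1).
apply: is_derive_eq (is_deriveM (dphi s x) (is_derive_cst (tb b n x) s 1)) _.
by rewrite /GRing.scale/= mulr0 add0r mulrC.
Qed.

Lemma sol_weak_form :
  Dt (of_fun sol) phi + DLambda (of_fun sol) phi =
  DLambda (of_fun (fun t x => sol t x * Lambda (sol t) x)) phi +
  Dx (of_fun (fun t x => sol t x * weak_deriv (sol t) x)) phi.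
Proof.
have [_ _ [a1 [b1 [a10 phi0]]]] := tphi.
(* The time support is enlarged strictly, so that [phi] vanishes at the endpoints themselves and
   [dt phi] outside, and [al] stays positive. *)
pose al := a1 / 2; pose be := Num.max a1 b1 + 1.
have al0 : 0 < al by rewrite divr_gt0.
have ala : al < a1 by rewrite /al; lra.
have bea : a1 < be /\ b1 < be.
  have : a1 <= Num.max a1 b1 by rewrite le_max lexx.
  have : b1 <= Num.max a1 b1 by rewrite le_max lexx orbT.
  by rewrite /be; split; lra.
have albe : al <= be by case: bea; lra.
have phiz t x : ~ (al < t < be) -> phi t x = 0.
  move=> H; apply: phi0 => /andP[h1 h2]; apply: H.
  by case: bea => ? ?; apply/andP; split; lra.
have dtz t x : ~ (al <= t <= be) -> dt phi t x = 0.
  move=> H; rewrite /dt derive1E; apply: derive_val.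
  apply: (@near_eq_is_derive _ _ _ (cst 0)).
  have /negP : ~ (al <= t <= be) by [].
  rewrite negb_and -!ltNge => /orP[h|h]; near=> y; apply/esym/phiz => /andP[y1 y2].
    have : y < al by near: y; exact: lt_nbhsl.
    by move/(lt_trans y1); rewrite ltxx.
  have : be < y by near: y; exact: lt_nbhsr.
  by move/(lt_trans y2); rewrite ltxx.
have coefz t b n : ~ (al < t < be) -> fc (phi t) b n = 0.
  by move=> H; apply: fc_zero => x; exact: phiz.
have Lpz t x : ~ (al < t < be) -> Lp t x = 0.
  move=> H; apply: tsum0 => n; rewrite /cterm /nc /coef !coefz//.
  by rewrite !mul0r !mulr0 !mul0r addr0.
have dxz t x : ~ (al < t < be) -> dx phi t x = 0.
  move=> H; rewrite /dx derive1E; have -> : phi t = cst 0 by apply/funext => y; exact: phiz.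
  exact: derive_val.
have Rint0 (h : R -> R) : (forall x, h x = 0) -> \int[mu]_(x in period) h x = 0.
  by move=> h0; under eq_Rintegral do rewrite h0; rewrite Rintegral_cst// mul0r.
have out t : ~ (al <= t <= be) -> ~ (al < t < be).
  by move=> H /andP[h1 h2]; apply: H; rewrite !ltW.
have z1 t : ~ (al <= t <= be) -> J1 t = 0.
  by move=> H; apply: Rint0 => x; rewrite dtz// mulr0.
have z2 t : ~ (al <= t <= be) -> J2 t = 0.
  by move=> /out H; apply: Rint0 => x; rewrite Lpz// mulr0.
have z3 t : ~ (al <= t <= be) -> J3 t = 0.
  by move=> /out H; apply: Rint0 => x; rewrite Lpz// mulr0.
have z4 t : ~ (al <= t <= be) -> J4 t = 0.
  by move=> /out H; apply: Rint0 => x; rewrite dxz// mulr0.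
have c1 : continuous J1 by apply: param_continuous; exact: jcM jc_sol jdt.
have c2 : continuous J2 by apply: param_continuous; exact: jcM jc_sol jLp.
have c3 : continuous J3 by apply: param_continuous; exact: jcM (jcM jc_sol jc_lam) jLp.
have c4 : continuous J4 by apply: param_continuous; exact: jcM (jcM jc_sol jc_der) jdx.
have mI : measurable `[al, be]%classic by exact: measurable_itv.
have red (J I : R -> R) := @Rintegral_halfline_support R al be I J al0.
have aeM (u v v' w w' : R -> R) : torus_L1 u -> torus_L1 v -> torus_L1 w ->
    continuous u -> continuous v' -> continuous w' -> ae_equal v v' -> ae_equal w w' ->
    \int[mu]_(x in period) (u x * v x * w x) = \int[mu]_(x in period) (u x * v' x * w' x).
  move=> u1 v1 w1 cu cv' cw' vv' ww'; apply: (ae_Rintegral mP).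
  - exact: measurable_funM (measurable_funM (integrable_meas u1.2) (integrable_meas v1.2))
      (integrable_meas w1.2).
  - exact: measurable_funM (measurable_funM (continuous_meas mP cu) (continuous_meas mP cv'))
      (continuous_meas mP cw').
  by apply: ae_imp (ae_and vv' ww') => x [-> ->].
have r1 : \int[mu]_(t in `]0, +oo[) \int[mu]_(x in period) (sol t x * dt phi t x) =
  \int[mu]_(t in `[al, be]) J1 t by exact: (red J1 _ (fun t _ => erefl) z1).
have p2 t : 0 < t -> \int[mu]_(x in period) (sol t x * Lambda (phi t) x) = J2 t.
  move=> t0; have [T1 E1] := test_Lambda tphi t; apply: (ae_Rintegral mP).
  - exact: measurable_funM (integrable_meas (sol_torus t).2) (integrable_meas T1.2).
  - exact: measurable_funM (integrable_meas (sol_torus t).2) (continuous_meas mP (@jc_slice2 R _ t jLp)).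
  by apply: ae_imp E1 => x ->.
have r2 := red J2 _ p2 z2.
have p3 t : 0 < t ->
    \int[mu]_(x in period) (sol t x * Lambda (sol t) x * Lambda (phi t) x) = J3 t.
  move=> t0; have [T1 E1] := test_Lambda tphi t; have [T2 E2] := sol_Lambda t.
  exact: (aeM _ _ _ _ _ (sol_torus t) T2 T1 (@jc_slice2 R _ t jc_sol) (@jc_slice2 R _ t jc_lam)
    (@jc_slice2 R _ t jLp) E2 E1).
have r3 := red J3 _ p3 z3.
have p4 t : 0 < t ->
    \int[mu]_(x in period) (sol t x * weak_deriv (sol t) x * dx phi t x) = J4 t.
  move=> t0; have [T1 E1] := test_dx tphi t; have [T2 E2] := sol_weak_deriv t.
  exact: (aeM _ _ _ _ _ (sol_torus t) T2 T1 (@jc_slice2 R _ t jc_sol) (@jc_slice2 R _ t jc_der)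
    (@jc_slice2 R _ t jdx) E2 (aeW _ (fun=> erefl))).
have r4 := red J4 _ p4 z4.
have -> : Dt (of_fun sol) phi = - \int[mu]_(t in `[al, be]) J1 t by rewrite -r1.
have -> : DLambda (of_fun sol) phi = \int[mu]_(t in `[al, be]) J2 t by exact: r2.
have -> : DLambda (of_fun (fun t x => sol t x * Lambda (sol t) x)) phi =
  \int[mu]_(t in `[al, be]) J3 t by exact: r3.
have -> : Dx (of_fun (fun t x => sol t x * weak_deriv (sol t) x)) phi =
  - \int[mu]_(t in `[al, be]) J4 t by rewrite -r4.
clear r1 r2 r3 r4 p2 p3 p4 aeM.
have ii f : continuous f -> integrable_on `[al, be] f by exact: continuous_integrable_itv.
apply/eqP; rewrite -subr_eq0; apply/eqP.
transitivity (\int[mu]_(t in `[al, be]) tsum (g^~ t)).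
  rewrite -(Rintegral_comb4 mI (ii _ c1) (ii _ c2) (ii _ c3) (ii _ c4)).
  by apply: eq_Rintegral => t _; exact: identity.
have [K0 K00 HK0] := jc_box_bounded al be 0 (pi *+ 2) cphi.
have [K1 K10 HK1] := jc_box_bounded al be 0 (pi *+ 2) jdt.
have P0 : 0 <= pi *+ 2 :> R by rewrite mulrn_wge0// pi_ge0.
pose L := K0 * (pi *+ 2); pose L' := K1 * (pi *+ 2).
have L0 : 0 <= L by rewrite mulr_ge0.
have L'0 : 0 <= L' by rewrite mulr_ge0.
have a0 := sumby_ge0 Aa.
(* Time-independent majorant of [g n], needed to integrate term by term; the last part is summable
   because [cv_l1] tolerates the factor n. *)
pose v n := 2 * (A n * L') + 2 * (n%:R * A n * L) + 4 * (n%:R * cv A n * L).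
have cg n : continuous (g n).
  move=> t; apply: cvgB.
    apply: cvgD; first (apply: cvgN; apply: cvgD; apply: cvgM; [exact: cX|exact: cfc|exact: cX|exact: cfc]).
    by apply: cvgMl_tmp; apply: cvgD; apply: cvgM; [exact: cX|exact: cfc|exact: cX|exact: cfc].
  by apply: cvgMl_tmp; apply: cvgD; apply: cvgM; [exact: cfc|exact: cNL|exact: cfc|exact: cNL].
have cvn n : 0 <= cv A n.
  have := @NL_le R (xt 0) A a false n (fun b k => XA b k 0) Aa.
  by move/(le_trans (normr_ge0 _)); rewrite pmulr_rge0.
have gv n t : al <= t <= be -> `|g n t| <= v n.
  move=> tI.
  have f0 b : `|fc (phi t) b n| <= L.
    by apply: fc_le_cst => [|x xp]; [exact: jc_slice2 cphi|exact: HK0].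
  have f1 b : `|fc (dt phi t) b n| <= L'.
    by apply: fc_le_cst => [|x xp]; [exact: jc_slice2 jdt|exact: HK1].
  have nn b : `|NL (xt t) b n| <= 2 * cv A n.
    by apply: NL_le Aa => b' k; exact: XA.
  have m1 b : `|X b n t * fc (dt phi t) b n| <= A n * L' by rewrite normrM ler_pM.
  have m2 b : `|X b n t * fc (phi t) b n| <= A n * L by rewrite normrM ler_pM.
  have m3 b : `|fc (phi t) b n * NL (xt t) b n| <= L * (2 * cv A n) by rewrite normrM ler_pM.
  apply: le_trans (ler_normB _ _) _; rewrite /v; apply: lerD.
    apply: le_trans (ler_normD _ _) _; apply: lerD.
      rewrite normrN; apply: le_trans (ler_normD _ _) _.
      by have := m1 false; have := m1 true; lra.
    rewrite normrM normr_nat -mulrA [X in _ <= X]mulrCA ler_wpM2l//.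
    apply: le_trans (ler_normD _ _) _.
    by have := m2 false; have := m2 true; lra.
  rewrite normrM normr_nat -mulrA [X in _ <= X]mulrCA ler_wpM2l//.
  apply: le_trans (ler_normD _ _) _.
  by have := m3 false; have := m3 true; lra.
have vB : sumby v (2 * L' * a + 2 * L * a + 4 * L * (a * a)).
  apply: (@sumby_le _ _ (fun n => 2 * L' * (n%:R * A n) + 2 * L * (n%:R * A n) + 4 * L * (n%:R * cv A n))).
    move=> n; rewrite /v; apply: lerD; last by rewrite le_eqVlt; apply/orP; left; apply/eqP; ring.
    apply: lerD; last by rewrite le_eqVlt; apply/orP; left; apply/eqP; ring.
    by rewrite -mulrA ler_wpM2l// mulrC ler_wpM2l// A_le_nA.
  apply: sumbyD; first by apply: sumbyD; apply: sumbyZ => //; rewrite mulr_ge0.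
  by apply: sumbyZ; [rewrite mulr_ge0|exact: cv_l1].
have v0 n : 0 <= v n by rewrite /v !addr_ge0// !mulr_ge0.
have [|||_ ->] := @Rintegral_tsum R `[al, be] g v _ (fun=> 1) mI _ _ v0 vB.
- by move=> n; exact: continuous_meas.
- by move=> n t; rewrite /= in_itv/= mulr1 => h; exact: gv.
- by apply: ii => t; exact: cvg_cst.
apply: tsum0 => n.
(* Primitive of [g n]; it vanishes at both ends of the interval together with the test function. *)
pose F t := - (X false n t * fc (phi t) false n + X true n t * fc (phi t) true n).
have : \int[mu]_(t in `[al, be]) g n t = F be - F al.
  apply: (@Rintegral_ftc R (g n) F) => //.
  - move=> t /andP[t1 t2].
    have dX b := (oX b n (t + 1)).2 t.
    have t0 : 0 < t < t + 1 by rewrite (lt_trans al0 t1) ltrDl ltr01.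
    have := is_deriveN (is_deriveD (is_deriveM (dX false t0) (dfc false n t))
      (is_deriveM (dX true t0) (dfc true n t))).
    move=> d; apply: is_derive_eq d _; rewrite /g /GRing.scale/=; ring.
  - move=> t; apply: cvgN; apply: cvgD; apply: cvgM; [exact: cX|exact: cfc|exact: cX|exact: cfc].
by rewrite /F !coefz ?ltxx ?andbF// !mulr0 addr0 oppr0 subr0.
Unshelve. all: by end_near. Qed.

End WeakForm.
End WeakFormulation.

(** * Regularity in time *)

Section TorusDifference.
Context {R : realType}.
Notation mu := (@lebesgue_measure R).
Implicit Types (u v : R -> R).

Lemma torus_sub u v : torus_L1 u -> torus_L1 v -> torus_L1 (u \- v).
Proof.
move=> [pu iu] [pv iv]; split; last exact: integrable_sub (@measurable_period R) iu iv.
by move=> x /=; rewrite pu pv.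
Qed.

Lemma coef_sub u v b n : torus_L1 u -> torus_L1 v ->
  coef (u \- v) b n = coef u b n - coef v b n.
Proof.
move=> [_ iu] [_ iv]; rewrite /coef -mulrBl; congr (_ / _); rewrite /fc.
rewrite -RintegralB//; [|exact: measurable_period|exact: integrable_tb|exact: integrable_tb].
by apply: eq_Rintegral => x _; rewrite mulrBl.
Qed.

Lemma zero_average_sub u v : torus_L1 u -> torus_L1 v ->
  zero_average u -> zero_average v -> zero_average (u \- v).
Proof.
move=> [_ iu] [_ iv] u0 v0; rewrite /zero_average RintegralB//; last exact: measurable_period.
by rewrite u0 v0 subrr.
Qed.

Lemma sumby_split (e h : nat -> R) N B : (forall n, 0 <= e n) -> (forall n, 0 <= h n) ->
  (forall n, (N <= n)%N -> e n <= h n) -> sumby h B ->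
  sumby e (series e N + (tsum h - series h N)).
Proof.
move=> e0 h0 eh hB M; pose K := maxn M N.
have me : nondecreasing_seq (series e).
  by apply/nondecreasing_seqP => n; rewrite seriesrS lerDl.
apply: le_trans (me _ K (leq_maxl M N)) _.
rewrite -lerBlDl (sub_series_geq _ (leq_maxr M N)).
apply: (@le_trans _ _ (series h K - series h N)); last first.
  by rewrite lerD2r; exact: le_series_tsum hB.
rewrite (sub_series_geq _ (leq_maxr M N)) big_nat [X in _ <= X]big_nat.
by apply: ler_sum => i /andP[Ni _]; exact: eh.
Qed.

Lemma hs_mono (r s : R) c n : 0 < r -> r <= s -> hs r c n <= hs s c n.
Proof.
move=> r0 rs; apply: ler_wpM2r; first by rewrite addr_ge0// sqr_ge0.
case: n => [|n]; last by rewrite ler_powR// ?ler1n// ler_wpM2l.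
by rewrite !powR0// gt_eqF// mulr_gt0//; exact: lt_le_trans rs.
Qed.

End TorusDifference.

(** * Membership of the constructed solution in the solution class *)

Section Regularity.
Context {R : realType}.
Notation mu := (@lebesgue_measure R).
Notation integrable_on D f := (mu.-integrable D (EFin \o f)).
Variables (X : bool -> nat -> R -> R) (A : nat -> R) (a : R).
Hypothesis cX : forall b n, continuous (X b n).
Hypothesis XA : forall b n t, `|X b n t| <= A n.
Hypothesis A00 : A 0%N = 0.
Hypothesis Aa : sumby (fun n => n%:R * A n) a.
Hypothesis oX : forall b n T,
  ode n%:R (fun t => NL (fun b m => X b m t) b n) (X b n) T.
Hypothesis cvA : forall n, (0 < n)%N -> 2 * cv A n <= A n.

Let A0 n : 0 <= A n. Proof. exact: le_trans (XA false n 0). Qed.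
Let xt t : bool -> nat -> R := fun b n => X b n t.
Notation f := (sol X).

Let solT t : torus_L1 (f t). Proof. exact: sol_torus XA A00 Aa t. Qed.
Let solZ t : zero_average (f t). Proof. exact: sol_zero_average XA A00 Aa t. Qed.
Let solC t : coef (f t) = xt t. Proof. exact: coef_sol XA A00 Aa t. Qed.

(** The equation and 2 cv A_n <= A_n bound the derivative of the mode by K = 2 n A_n; monotonicity
    of K t - x and K t + x then replaces a mean value argument. *)
Lemma X_lipschitz b n t t' : 0 <= t -> 0 <= t' ->
  `|X b n t - X b n t'| <= 2 * A n * (n%:R * `|t - t'|).
Proof.
wlog tt : t t' / t' <= t => [H t0 t0'|t0 t0'].
  have [?|/ltW ?] := leP t' t; first exact: H.
  by rewrite distrC (distrC t) H.
rewrite (@ger0_norm _ (t - t')) ?subr_ge0//.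
have [-> /=|n0] := posnP n.
  have x0 s : X b 0%N s = 0 by apply/eqP; rewrite -normr_le0 -A00.
  by rewrite !x0 subrr normr0 mul0r mulr0.
pose K := 2 * A n * n%:R.
have dX := (oX b n (t + 1)).2.
have bd s : `|n%:R * (NL (fun b m => X b m s) b n - X b n s)| <= K.
  rewrite normrM normr_nat /K mulrC ler_wpM2r//.
  apply: le_trans (ler_normB _ _) _; rewrite mulr2n mulrDl mul1r; apply: lerD => //.
  by apply: le_trans (cvA n0); apply: NL_le Aa => b' k; exact: XA.
have lin (c : R) (s : R) : is_derive s 1 (fun y : R => c * y) c.
  by apply: is_derive_eq; rewrite /GRing.scale/= mulr1.
have cl (c : R) : continuous (fun y : R => c * y).
  by move=> y; apply: cvgMl_tmp; exact: cvg_id.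
have h1 : K * t' - X b n t' <= K * t - X b n t.
  apply: (@derive_ge0_le R (fun s => K * s - X b n s)
    (fun s => K - n%:R * (NL (fun b m => X b m s) b n - X b n s)))
    => [|s /andP[s1 s2]|s|s _]; first exact: tt.
  - have st : 0 < s < t + 1 by rewrite (le_lt_trans t0' s1) (lt_trans s2)// ltrDl.
    exact: is_deriveB (lin K s) (dX s st).
  - by apply: cvgB; [exact: cl|exact: cX].
  by rewrite subr_ge0; apply: le_trans (ler_norm _) (bd s).
have h2 : K * t' + X b n t' <= K * t + X b n t.
  apply: (@derive_ge0_le R (fun s => K * s + X b n s)
    (fun s => K + n%:R * (NL (fun b m => X b m s) b n - X b n s)))
    => [|s /andP[s1 s2]|s|s _]; first exact: tt.
  - have st : 0 < s < t + 1 by rewrite (le_lt_trans t0' s1) (lt_trans s2)// ltrDl.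
    exact: is_deriveD (lin K s) (dX s st).
  - by apply: cvgD; [exact: cl|exact: cX].
  by rewrite -lerBlDl sub0r; have := bd s; rewrite ler_norml => /andP[].
rewrite mulrA -/K mulrBr ler_norml; apply/andP; split; lra.
Qed.

(** Interpolation between the Lipschitz bound and the trivial bound 2 A_n: min (1, d) <= d^ga. *)
Lemma X_holder b n t t' ga : 0 <= ga <= 1 -> 0 <= t -> 0 <= t' ->
  `|X b n t - X b n t'| <= 2 * A n * (n%:R `^ ga * `|t - t'| `^ ga).
Proof.
move=> /andP[g0 g1] t0 t0'; rewrite -powRM//; set d := n%:R * _.
have d0 : 0 <= d by rewrite mulr_ge0.
have A2 : 0 <= 2 * A n by rewrite mulr_ge0.
have [d1|d1] := leP d 1.
  apply: le_trans (X_lipschitz b n t0 t0') _; rewrite -/d ler_wpM2l//.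
  have [->|dn] := eqVneq d 0; first exact: powR_ge0.
  rewrite -[X in X <= _](powRr1 d0); apply: ger_powR => //.
  by rewrite d1 lt_def dn d0.
apply: le_trans (ler_normB _ _) _.
apply: (@le_trans _ _ (2 * A n)); first by rewrite mulr2n mulrDl mul1r lerD.
by rewrite ler_peMr// -[X in X <= _](powRr0 d) ler_powR// ltW.
Qed.

Variables (s B : R).
Hypothesis s0 : 0 < s.
Hypothesis sA : sumby (fun n => n%:R `^ (2 * s) * A n ^+ 2) B.

Let B0 : 0 <= B. Proof. exact: sumby_ge0 sA. Qed.

Let sqrX b n t : X b n t ^+ 2 <= A n ^+ 2.
Proof. by rewrite -real_normK ?num_real// ler_pXn2r// nnegrE. Qed.

Lemma sol_hs t : sumby (hs s (coef (f t))) (2 * B).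
Proof.
apply: sumby_le (sumbyZ (ler0n R 2) sA) => n; rewrite solC /hs [X in _ <= X]mulrCA.
by rewrite ler_wpM2l ?powR_ge0// mulr2n mulrDl mul1r; apply: lerD; exact: sqrX.
Qed.

Lemma sol_sobolev r t : 0 < r -> r <= s ->
  sobolev r (f t) /\ sobolev_norm r (f t) <= Num.sqrt (pi * (2 * B)).
Proof.
move=> r0 rs; apply: sobolev_sumby => //.
by apply: sumby_le (sol_hs t) => n; exact: hs_mono.
Qed.

(** An exponent ga in time costs n^ga in every mode, whence the condition on r + ga. The 8 is 2^2
    from the bound on increments, counted for the cosine and the sine. *)
Lemma sol_holder r ga T : 0 < r -> 0 <= ga <= 1 -> r + ga <= s ->
  holder_in_time ga T r f.
Proof.
move=> r0 ga01 rgs; have /andP[g0 g1] := ga01; split=> [t _|].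
  have rs : r <= s by apply: le_trans rgs; rewrite lerDl.
  by have [] := @sol_sobolev r t r0 rs.
have p0 : 0 <= pi :> R by exact: pi_ge0.
exists (Num.sqrt (8 * (pi * B))) => t t' /andP[t0 _] /andP[t0' _].
set D := _ `^ ga; have D0 : 0 <= D by exact: powR_ge0.
have [|_] := @sobolev_sumby R r (f t \- f t') (8 * B * D ^+ 2) r0
    (torus_sub (solT t) (solT t'))
    (zero_average_sub (solT t) (solT t') (solZ t) (solZ t')); last first.
  move/le_trans; apply; rewrite (_ : pi * _ = 8 * (pi * B) * D ^+ 2); last by ring.
  by rewrite sqrtrM ?mulr_ge0// sqrtr_sqr ger0_norm.
rewrite (_ : 8 * B * D ^+ 2 = 8 * D ^+ 2 * B); last by ring.
have K0 : 0 <= 8 * D ^+ 2 by rewrite mulr_ge0 ?exprn_ge0.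
apply: sumby_le (sumbyZ K0 sA) => n; rewrite /hs !coef_sub// !solC /xt.
have sq b : (X b n t - X b n t') ^+ 2 <= 4 * D ^+ 2 * (n%:R `^ (2 * ga) * A n ^+ 2).
  have h := X_holder b n ga01 t0 t0'.
  rewrite -real_normK ?num_real//; apply: (@le_trans _ _ ((2 * A n * (n%:R `^ ga * D)) ^+ 2)).
    by rewrite ler_pXn2r// nnegrE ?mulr_ge0 ?powR_ge0//; exact: le_trans h.
  rewrite (_ : n%:R `^ (2 * ga) = (n%:R `^ ga) ^+ 2); last by rewrite mulrC powRrM powR_mulrn ?powR_ge0.
  by rewrite le_eqVlt; apply/orP; left; apply/eqP; ring.
apply: (@le_trans _ _ (n%:R `^ (2 * r) * (8 * D ^+ 2 * (n%:R `^ (2 * ga) * A n ^+ 2)))).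
  rewrite ler_wpM2l ?powR_ge0//; have := sq false; have := sq true.
  rewrite (_ : 8 * D ^+ 2 * _ = 4 * D ^+ 2 * (n%:R `^ (2 * ga) * A n ^+ 2) + 4 * D ^+ 2 * (n%:R `^ (2 * ga) * A n ^+ 2)); last by ring.
  by move=> h1 h2; exact: lerD h2 h1.
rewrite (_ : _ * _ = 8 * D ^+ 2 * (n%:R `^ (2 * r) * n%:R `^ (2 * ga) * A n ^+ 2)); last by ring.
rewrite ler_wpM2l// ler_wpM2r ?sqr_ge0//.
have [->|n0] := posnP n; first by rewrite powR0 ?mul0r ?powR_ge0// gt_eqF// mulr_gt0.
by rewrite -powRD ?pnatr_eq0 -?lt0n ?n0 ?implybT// ler_powR ?ler1n// -mulrDr ler_wpM2l.
Qed.


Let trunc_at N t : bool -> nat -> R := fun b n => if (n < N)%N then X b n t else 0.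

Let absmX t n : absm (xt t) n <= 2 * (n%:R * A n).
Proof.
apply: (@le_trans _ _ (2 * A n)); last by rewrite ler_wpM2l// (A_le_nA XA A00).
by rewrite mulr2n mulrDl mul1r; apply: lerD; exact: XA.
Qed.

Let sumby_trunc N t : sumby (absm (trunc_at N t)) (2 * a).
Proof.
apply: (sumby_le _ (sumbyZ (ler0n R 2) Aa)) => n; apply: le_trans (absmX t n).
by rewrite /trunc_at /absm; case: ifP => // _; rewrite normr0 addr0 addr_ge0.
Qed.

Let coef_trunc N t : coef (trig (trunc_at N t)) = trunc_at N t.
Proof.
apply/funext => b; apply/funext => n; apply: coef_trig (sumby_trunc N t) _ => b'.
by rewrite /trunc_at; case: ifP => // _; apply/eqP; rewrite -normr_le0 -A00.
Qed.

Lemma trunc_sobolev N t r : 0 < r -> sobolev r (trig (trunc_at N t)).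
Proof.
move=> r0; set u := trig _; have uT : torus_L1 u := trig_torus_L1 (sumby_trunc N t).
have uz : zero_average u.
  apply: zero_average_trig (sumby_trunc N t) _ => b.
  by rewrite /trunc_at; case: ifP => // _; apply/eqP; rewrite -normr_le0 -A00.
have z0 : sumby (fun=> 0 : R) 0 by move=> M; rewrite seriesE big1.
have [] // := @sobolev_sumby R r u _ r0 uT uz (sumby_split (hs_ge0 r _) _ _ z0 (N := N)).
move=> n Nn; rewrite /hs coef_trunc /trunc_at ltnNge Nn/= expr0n/= addr0 mulr0.
exact: lexx.
Qed.

(* Piecewise constant in time on a mesh of size 1/M, and a trigonometric
   polynomial of degree < N in space. *)
Lemma simple_approximation r T N (e : R) : 0 < r -> 0 < T -> 0 < e ->
  exists2 g, simple_curve r g & forall t, 0 <= t < T ->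
    [/\ torus_L1 (g t), zero_average (g t),
        forall b n, (N <= n)%N -> coef (g t) b n = 0 &
        series (hs r (coef (g t \- f t))) N <= e].
Proof.
move=> r0 T0 e0.
(* By the Lipschitz bounds, moving by at most 1/M in time changes the modes below N by at most c /
   M^2 in the squared norm. M is then chosen above c / e, and M <= M^2. *)
have [c cE] : {c | c = series (fun n => n%:R `^ (2 * r) * (2 * (2 * (A n * n%:R)) ^+ 2)) N} by eexists.
have c0 : 0 <= c.
  by rewrite cE; apply: series_ge0 => n; rewrite mulr_ge0 ?powR_ge0// mulr_ge0// sqr_ge0.
pose M := (Num.truncn (c / e)).+1.
have M1 : 1 <= M%:R :> R by rewrite ler1n.
have M0 : 0 < M%:R :> R by exact: lt_le_trans M1.
have Mc : c * (M%:R^-1) ^+ 2 <= e.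
  rewrite exprVn ler_pdivrMr ?exprn_gt0// -ler_pdivrMl// mulrC.
  apply: (@le_trans _ _ M%:R); last by rewrite expr2 ler_peMl// ltW.
  by have /andP[_ /ltW] := truncn_itv (divr_ge0 c0 (ltW e0)).
pose m := (Num.truncn (T * M%:R)).+1.
(* Half-open intervals, so that each time belongs to exactly one of them and the sum over i has a
   single nonzero term. *)
pose I (i : 'I_m) : set R := [set` `[i%:R / M%:R, i.+1%:R / M%:R[].
pose u (i : 'I_m) := trig (trunc_at N (i%:R / M%:R)).
pose g t x := \sum_(i < m) \1_(I i) t * u i x.
exists g.
  exists m, I, u; split=> // i; split; first exact: measurable_itv.
  exact: trunc_sobolev.
move=> t /andP[t0 tT].
have tM0 : 0 <= t * M%:R by rewrite mulr_ge0// ltW.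
have /andP[k1 k2] := truncn_itv tM0; set k := Num.truncn _ in k1 k2.
have km : (k < m)%N.
  have /andP[_ h] := truncn_itv (mulr_ge0 (ltW T0) (ltW M0)).
  rewrite -(ltr_nat R); apply: le_lt_trans k1 _; apply: le_lt_trans h.
  by rewrite ler_wpM2r// ltW.
have memI i : I i t = (i%:R <= t * M%:R < i.+1%:R) :> Prop.
  by rewrite /I /= in_itv/= ler_pdivrMr// ltr_pdivlMr.
have gt : g t = u (Ordinal km).
  apply/funext => x; rewrite /g (bigD1 (Ordinal km))//= big1 ?addr0 => [|i ik].
    by rewrite indicE mem_set ?mul1r// memI k1.
  rewrite indicE memNset ?mul0r// memI => /andP[i1 i2].
  move/negP: ik; apply; apply/eqP/val_inj => /=; apply/eqP; rewrite eqn_leq.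
  have h1 := le_lt_trans i1 k2; have h2 := le_lt_trans k1 i2.
  by rewrite !ltr_nat !ltnS in h1 h2; rewrite h1 h2.
have tk : `|k%:R / M%:R - t| <= M%:R^-1.
  rewrite distrC ger0_norm; last by rewrite subr_ge0 ler_pdivrMr.
  rewrite -(ler_pM2r M0) mulrBl mulVf ?gt_eqF// divfK ?gt_eqF//.
  by rewrite lerBlDl natr1 ltW.
have [uT uZ _] : sobolev r (u (Ordinal km)) by exact: trunc_sobolev.
rewrite gt; split=> // [b n Nn|].
  by rewrite /u coef_trunc /trunc_at ltnNge Nn.
apply: le_trans Mc; rewrite cE !seriesE mulr_suml; apply: ler_sum => i _.
rewrite /hs !coef_sub// solC coef_trunc /trunc_at ltn_ord /xt /= -[X in _ <= X]mulrA.
apply: ler_wpM2l; first exact: powR_ge0.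
rewrite -[X in _ <= X]mulrA -exprMn.
have sq b : (X b i (k%:R / M%:R) - X b i t) ^+ 2 <= (2 * (A i * i%:R) * M%:R^-1) ^+ 2.
  rewrite -real_normK ?num_real// ler_pXn2r// ?nnegrE//; last first.
    by rewrite mulr_ge0 ?invr_ge0 ?mulr_ge0.
  apply: le_trans (X_lipschitz b i _ t0) _; first by rewrite divr_ge0.
  by rewrite -!mulrA !ler_wpM2l.
by rewrite mulr2n mulrDl mul1r; apply: lerD; exact: sq.
Qed.

(** The error at time t splits into modes below N, at most 1/(N + 1), and the tail of the solution,
    since the approximation has no mode from N on. The tail is estimated separately at each t, which
    covers exponents r > s where [f t] is in H^r only for almost every t. *)
Lemma sol_bochner r T : 0 < r -> 0 < T ->
  {ae mu, forall t, 0 <= t < T -> sobolev r (f t)} -> bochner_measurable T r f.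
Proof.
move=> r0 T0 fr; split=> //.
have ex N : exists g, simple_curve r g /\ forall t, 0 <= t < T ->
    [/\ torus_L1 (g t), zero_average (g t),
        forall b n, (N <= n)%N -> coef (g t) b n = 0 &
        series (hs r (coef (g t \- f t))) N <= N.+1%:R^-1].
  by have [|g g1 g2] := @simple_approximation r T N N.+1%:R^-1 r0 T0; [rewrite invr_gt0|exists g].
have [g Hg] := choice ex; exists g; split=> [n|]; first by case: (Hg n).
apply: ae_imp fr => t frt tT; have st := frt tT.
have hB := sumby_sobolev r0 st; set h := hs r _ in hB.
have h0 n : 0 <= h n by exact: hs_ge0.
pose v N : R := pi * (N.+1%:R^-1 + (tsum h - series h N)).
apply: (@squeeze_cvge _ _ _ _ (cst 0%E) _ (fun N => (v N)%:E)).
- near=> N; apply/andP; split.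
    by apply: esum_ge0 => z _; rewrite lee_fin mulr_ge0 ?powR_ge0// sqr_ge0.
  have [gT gZ gN gs] := (Hg N).2 t tT.
  rewrite sobolev_norm2E//; last exact: torus_sub.
  rewrite /v EFinM lee_pmul2l ?lte_fin ?pi_gt0//.
  apply/nneseries_sumby; first exact: hs_ge0.
  move=> M; apply: le_trans (@sumby_split R _ h N _ (hs_ge0 r _) h0 _ hB M) _.
    by move=> n Nn; rewrite /h /hs !coef_sub// !gN// !sub0r !sqrrN.
  by rewrite lerD2r.
- exact: cvg_cst.
apply: cvg_EFin; first by near=> N.
rewrite -[X in _ --> X](mulr0 pi); apply: cvgMl_tmp.
rewrite -[X in _ --> X](addr0 0); apply: cvgD.
  exact: cvg_harmonic.
rewrite -[X in _ --> X](subrr (tsum h)); apply: cvgB; first exact: cvg_cst.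
exact: sumby_cvg h0 hB.
Unshelve. all: by end_near. Qed.

Lemma sol_Linfty T : 0 < T -> Linfty_in_time T s f.
Proof.
move=> T0; split.
  by apply: sol_bochner => //; apply: aeW => t _; case: (sol_sobolev t s0 (lexx s)).
exists (Num.sqrt (pi * (2 * B))); apply: aeW => t _.
by case: (sol_sobolev t s0 (lexx s)).
Qed.

Hypothesis a4 : 4 * a <= 1.

(** The half derivative gained is the weight n^(2 s + 1) of the energy estimate. Summation over
    modes and integration in time are exchanged by monotone convergence, and integrability yields
    finiteness of the norm at almost every time. *)
Lemma sol_L2 T r : r = s + 2^-1 -> 0 < T -> L2_in_time T r f.
Proof.
move=> rE T0; have r0 : 0 < r by rewrite rE addr_gt0// invr_gt0.
pose D : set R := `[0, T[%classic; have mD : measurable D by exact: measurable_itv.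
pose E : set R := `[0, T]%classic; have mE : measurable E by exact: measurable_itv.
have DE : D `<=` E by move=> t; rewrite /D /E /= !in_itv/= => /andP[-> /ltW].
pose h n t : R := hs r (xt t) n.
have h0 n t : 0 <= h n t by exact: hs_ge0.
have ch n : continuous (h n).
  move=> t; apply: cvgMl_tmp; apply: cvgD; apply: continuous_sqr; exact: cX.
have mh (F : set R) n : measurable F -> measurable_fun (F : set (measurableTypeR R)) (EFin \o h n).
  by move=> mF; apply: mEFin; exact: continuous_meas.
have norm2E t : sobolev_norm2 r (f t) = (pi%:E * \sum_(n <oo) (h n t)%:E)%E.
  by rewrite sobolev_norm2E// solC.
have ms (F : set R) : measurable F ->
    measurable_fun (F : set (measurableTypeR R)) (fun t => (\sum_(n <oo) (h n t)%:E)%E).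
  move=> mF; apply: ge0_emeasurable_sum => [n t _ _|n _]; first by rewrite lee_fin.
  exact: mh.
have s0' : 0 <= s by exact: ltW.
have ini : sumby (fun n => n%:R `^ (2 * s) * (X false n 0 ^+ 2 + X true n 0 ^+ 2)) (2 * B).
  by have := sol_hs 0; rewrite solC.
have fin : (\int[mu]_(t in D) sobolev_norm2 r (f t) < +oo)%E.
  under eq_integral do rewrite norm2E.
  rewrite ge0_integralZl//; last 3 first.
  - exact: ms.
  - by move=> t _; apply: nneseries_ge0 => n _ _; rewrite lee_fin.
  - by rewrite lee_fin pi_ge0.
  rewrite lte_mul_pinfty ?lee_fin ?pi_ge0//.
  apply: (@le_lt_trans _ _ (\int[mu]_(t in E) (\sum_(n <oo) (h n t)%:E))%E).
    apply: ge0_subset_integral => //; first exact: ms.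
    by move=> t _; apply: nneseries_ge0 => n _ _; rewrite lee_fin.
  rewrite integral_nneseries//; last 2 first.
  - by move=> n; exact: mh.
  - by move=> n t _; rewrite lee_fin.
  apply: (@le_lt_trans _ _ (2 * (2 * B))%:E); last exact: ltry.
  have iE n : integrable_on E (h n) by apply: continuous_integrable_itv; exact: ch.
  rewrite (@eq_eseriesr _ _ (fun n => (\int[mu]_(t in E) h n t)%:E)); last first.
    by move=> n _; have e := @integrable_fin_num _ (measurableTypeR R) _ mu E mE _ (iE n); exact/esym/(fineK e).
  apply/nneseries_sumby; first by move=> n; exact: Rintegral_ge0.
  apply: sumby_le (energy_sobolev cX XA Aa a4 oX s0' (ltW T0) ini) => n.
  rewrite /h /hs RintegralZl//; last first.
    by apply: continuous_integrable_itv => t; apply: cvgD; apply: continuous_sqr; exact: cX.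
  by rewrite rE mulrDr divff.
split=> //; apply: sol_bochner => //.
have iD : mu.-integrable D (fun t => sobolev_norm2 r (f t)).
  apply/integrableP; split.
    rewrite (_ : (fun t => _) = fun t => (pi%:E * \sum_(n <oo) (h n t)%:E)%E); last first.
      by apply/funext => t; exact: norm2E.
    by apply: measurable_funeM; exact: ms.
  apply: le_lt_trans fin; rewrite le_eqVlt; apply/orP; left; apply/eqP.
  apply: eq_integral => t _.
  rewrite gee0_abs// norm2E mule_ge0 ?lee_fin ?pi_ge0//.
  by apply: nneseries_ge0 => n _ _; rewrite lee_fin.
have fn := @integrable_ae _ (measurableTypeR R) _ mu D mD _ iD.
apply: ae_imp fn => t H tT.
split=> //; have : sobolev_norm2 r (f t) \is a fin_num by apply: H; rewrite /D /= in_itv.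
  by rewrite fin_numElt => /andP[].
Qed.

End Regularity.

(** * Smooth steps *)

Section SmoothFunctions.
Context {R : realType}.
Notation mu := (@lebesgue_measure R).
Implicit Types (f g : R -> R).

(** C^k regularity with existentially given derivatives: sums, products and changes of variable go
    through by induction without computing iterated derivatives. *)
Fixpoint sm (k : nat) f : Prop := continuous f /\
  if k is k'.+1 then exists2 f', (forall x : R, is_derive x 1 f (f' x)) & sm k' f' else True.

Lemma sm_continuous k f : sm k f -> continuous f.
Proof. by case: k => [|k] []. Qed.

Lemma smS k f : sm k.+1 f -> sm k f.
Proof.
elim: k f => [|k IH] f [cf [f' df sf]]; first by split.
by split=> //; exists f' => //; exact: IH.
Qed.

Lemma smD k f g : sm k f -> sm k g -> sm k (fun x => f x + g x).
Proof.
elim: k f g => [|k IH] f g [cf Hf] [cg Hg].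
  by split=> // x; apply: cvgD; [exact: cf|exact: cg].
split; first by move=> x; apply: cvgD; [exact: cf|exact: cg].
case: Hf => f' df sf; case: Hg => g' dg sg.
by exists (fun x => f' x + g' x) => [x|]; [exact: is_deriveD|exact: IH].
Qed.

Lemma smM k f g : sm k f -> sm k g -> sm k (fun x => f x * g x).
Proof.
elim: k f g => [|k IH] f g sf sg; have cf := sm_continuous sf; have cg := sm_continuous sg.
  by split=> // x; apply: cvgM; [exact: cf|exact: cg].
split; first by move=> x; apply: cvgM; [exact: cf|exact: cg].
have [_ [f' df sf']] := sf; have [_ [g' dg sg']] := sg.
exists (fun x => f x * g' x + g x * f' x) => [x|].
  exact: (is_deriveM (df x) (dg x)).
by apply: smD; apply: IH => //; exact: smS.
Qed.

Lemma is_derive_affine f f' (c d : R) (x : R) : (forall y : R, is_derive y 1 f (f' y)) ->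
  is_derive x 1 (fun y => f (c * y + d)) (c * f' (c * x + d)).
Proof.
move=> df; have dl : is_derive x 1 (fun y => c * y + d) c.
  by apply: is_derive_eq; rewrite /GRing.scale/= mulr1 addr0.
by apply: is_derive_eq (@is_derive1_comp R f (fun y => c * y + d) x _ _ (df _) dl) _; rewrite mulrC.
Qed.

Lemma sm_cst k (c : R) : sm k (fun=> c).
Proof.
elim: k c => [|k IH] c; split=> //; try by move=> x; exact: cvg_cst.
by exists (fun=> 0) => [x|]; [exact: is_derive_cst|exact: IH].
Qed.

Lemma sm_affine k f (c d : R) : sm k f -> sm k (fun x => f (c * x + d)).
Proof.
have cl : continuous (fun x : R => c * x + d).
  by move=> x; apply: cvgD; [apply: cvgMl_tmp; exact: cvg_id|exact: cvg_cst].
elim: k f => [|k IH] f [cf Hf].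
  by split=> // x; apply: (continuous_comp (cl x)); exact: cf.
split; first by move=> x; apply: (continuous_comp (cl x)); exact: cf.
case: Hf => f' df sf; exists (fun x => c * f' (c * x + d)) => [x|].
  exact: is_derive_affine.
by apply: smM; [exact: sm_cst|exact: IH].
Qed.

Lemma sm_tb k b n : sm k (tb b n : R -> R).
Proof.
suff H c : sm k (fun x : R => c * tb b n x).
  have := H 1; rewrite (_ : (fun x => 1 * _) = tb b n)//.
  by apply/funext => x; rewrite mul1r.
elim: k b c => [|k IH] b c.
  by split=> // x; apply: cvgMl_tmp; exact: continuous_tb.
split; first by move=> x; apply: cvgMl_tmp; exact: continuous_tb.
exists (fun x => - (c * (-1) ^+ b * n%:R) * tb (~~ b) n x) => [x|]; last exact: IH.
have h := is_deriveM (is_derive_cst c x 1) (@derive_tb R b n x).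
by apply: is_derive_eq h _; rewrite /GRing.scale/= mulr0 addr0; ring.
Qed.

Lemma sm_tensor k f g : (forall j, sm j f) -> (forall j, sm j g) -> Ck k (fun t x => f t * g x).
Proof.
(* The derivative extracted from [sm j] may depend on j, so the induction uses regularity of one
   fixed order instead of all orders at once. *)
move=> sf sg; have H j : sm j f -> sm j g -> Ck j (fun t x => f t * g x).
  elim: j f g {sf sg} => [|j IH] f g sf sg.
    by split=> //; exact: jcM (jc_time (sm_continuous sf)) (jc_space (sm_continuous sg)).
  split; first exact: jcM (jc_time (sm_continuous sf)) (jc_space (sm_continuous sg)).
  have [_ [f' df sf']] := sf; have [_ [g' dg sg']] := sg.
  have dt1 (t x : R) : is_derive t 1 (fun t => f t * g x) (f' t * g x).
    have h := is_deriveM (df t) (is_derive_cst (g x) t 1).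
    by apply: is_derive_eq h _; rewrite /GRing.scale/= mulr0 add0r mulrC.
  have dx1 (t x : R) : is_derive x 1 (fun x => f t * g x) (f t * g' x).
    have h := is_deriveM (is_derive_cst (f t) x 1) (dg x).
    by apply: is_derive_eq h _; rewrite /GRing.scale/= mulr0 addr0.
  split=> [t x||].
  - by split; [have [] := dt1 t x|have [] := dx1 t x].
  - rewrite (_ : dt _ = fun t x => f' t * g x); first by apply: IH => //; exact: smS.
    by apply/funext => t; apply/funext => x; rewrite /dt derive1E; have [] := dt1 t x.
  rewrite (_ : dx _ = fun t x => f t * g' x); first by apply: IH => //; exact: smS.
  by apply/funext => t; apply/funext => x; rewrite /dx derive1E; have [] := dx1 t x.
exact: H.
Qed.

Lemma is_derive_flat f K : (forall x, `|f x| <= K * x ^+ 2) -> is_derive (0 : R) 1 f 0.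
Proof.
move=> fK; have f0 : f 0 = 0.
  by apply/eqP; rewrite -normr_le0; apply: le_trans (fK 0) _; rewrite expr0n/= mulr0.
have c : (fun h : R => h^-1 *: (f (h *: 1 + 0) - f 0)) @ 0^' --> (0 : R).
  apply/norm_cvg0P.
  apply: (@squeeze_cvgr _ _ _ _ (cst 0) (fun h => K * `|h|)).
  - near=> h; rewrite normr_ge0/= f0 subr0 addr0 /GRing.scale/= mulr1 normrM normfV.
    have h0 : h != 0 by near: h; exact: nbhs_dnbhs_neq.
    rewrite ler_pdivrMl ?normr_gt0//; apply: le_trans (fK h) _.
    by rewrite -real_normK ?num_real// le_eqVlt; apply/orP; left; apply/eqP; ring.
  - exact: cvg_cst.
  rewrite -[X in _ --> X](mulr0 K); apply: cvgMl_tmp; apply: cvg_within_filter.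
  have := @norm_continuous R R 0; rewrite /continuous_at normr0; exact.
apply: DeriveDef; first by apply/cvg_ex; exists 0.
exact: cvg_lim c.
Unshelve. all: by end_near. Qed.

(** The powers x^-j are included because the span of the family in j is closed under
    differentiation, which reduces smoothness to one derivative formula. *)
Definition bump0 (j : nat) (x : R) : R := if 0 < x then x ^- j * expR (- x^-1) else 0.

Lemma expR_ge_pow (m : nat) (y : R) : 0 < y -> (0 < m)%N -> (y / m%:R) ^+ m <= expR y.
Proof.
move=> y0 m0; have m1 : 0 < m%:R :> R by rewrite ltr0n.
have -> : expR y = expR (y / m%:R) ^+ m by rewrite -expRM_natl mulrC divfK ?gt_eqF.
rewrite ler_pXn2r// ?nnegrE ?expR_ge0 ?divr_ge0 ?ltW//.
by apply: lt_le_trans (expR_ge1Dx _); rewrite ltrDr.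
Qed.

(** Comparing exp with the power j + 2 leaves x^2 after division by x^j; quadratic flatness gives a
    zero derivative at the origin. *)
Lemma bump0_flat j x : `|bump0 j x| <= (j.+2)%:R ^+ j.+2 * x ^+ 2.
Proof.
rewrite /bump0; case: ifPn => [x0|_]; last by rewrite normr0 mulr_ge0 ?sqr_ge0// exprn_ge0.
rewrite ger0_norm; last by rewrite mulr_ge0 ?expR_ge0// invr_ge0 exprn_ge0// ltW.
have xV : 0 < x^-1 by rewrite invr_gt0.
have := expR_ge_pow xV (ltn0Sn j.+1).
have q0 : 0 < (x^-1 / j.+2%:R) ^+ j.+2 by rewrite exprn_gt0// divr_gt0// ltr0n.
rewrite -(lef_pV2) ?posrE ?expR_gt0// -expRN => h.
apply: (@le_trans _ _ (x ^- j * ((x^-1 / j.+2%:R) ^+ j.+2)^-1)).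
  by rewrite ler_wpM2l// invr_ge0 exprn_ge0// ltW.
rewrite exprMn exprVn invfM invrK exprVn invrK -addn2 exprD.
rewrite le_eqVlt; apply/orP; left; apply/eqP; field.
by rewrite expf_neq0// gt_eqF.
Qed.

Lemma is_derive_bump0 j (x : R) :
  is_derive x 1 (bump0 j) (- j%:R * bump0 j.+1 x + bump0 j.+2 x).
Proof.
have [x0|x0|->] := ltrgtP x 0.
- rewrite /bump0 !ltNge (ltW x0)/= mulr0 addr0.
  apply: (@near_eq_is_derive _ _ _ (cst 0)).
  near=> y; rewrite ltNge ifF//; apply/negbF/ltW; near: y; exact: lt_nbhsl.
- rewrite /bump0 x0.
  apply: (@near_eq_is_derive _ _ _ (fun y : R => (y^-1) ^+ j * expR (- y^-1))).
    near=> y; rewrite ifT ?exprVn//; near: y; exact: lt_nbhsr.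
  have xn : x != 0 by rewrite gt_eqF.
  have dv : is_derive x 1 (fun y : R => y^-1) (- x ^- 2).
    by apply: is_derive_eq (is_deriveV xn (is_derive_id x 1)) _; rewrite /GRing.scale/= mulr1.
  have de : is_derive x 1 (fun y : R => expR (- y^-1)) (expR (- x^-1) * x ^- 2).
    apply: is_derive_eq (@is_derive1_comp R expR (fun y : R => - y^-1) x _ _ _ (is_deriveN dv)) _.
    by rewrite opprK.
  have dp : is_derive x 1 (fun y : R => y^-1 ^+ j) (j%:R * x^-1 ^+ j.-1 * - x ^- 2).
    have := is_deriveX j dv; rewrite (_ : _ ^+ j = fun y : R => y^-1 ^+ j)//.
    by apply/funext => y; rewrite exprfctE.
  apply: is_derive_eq (is_deriveM dp de) _.
  rewrite /GRing.scale/= {dp}; case: j => [|j].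
    by rewrite mulr0n expr0; field.
  by rewrite /= !exprS !exprVn; field; rewrite xn expf_neq0.
- rewrite /bump0 ltxx mulr0 addr0; exact: is_derive_flat (@bump0_flat j).
Unshelve. all: by end_near. Qed.

Lemma sm_bump0 k j : sm k (bump0 j).
Proof.
have cb i : continuous (bump0 i).
  by move=> x; apply: is_derive_continuous; exact: is_derive_bump0.
elim: k j => [|k IH] j; split=> //.
exists (fun x => - j%:R * bump0 j.+1 x + bump0 j.+2 x) => [x|].
  exact: is_derive_bump0.
by apply: smD => //; apply: smM => //; exact: sm_cst.
Qed.

Definition bump (x : R) : R := bump0 0 x * bump0 0 (-1 * x + 1).

Lemma sm_bump k : sm k bump.
Proof. by apply: smM; [|apply: sm_affine]; exact: sm_bump0. Qed.

Lemma bump_ge0 x : 0 <= bump x.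
Proof.
by rewrite /bump /bump0; apply: mulr_ge0; case: ifP => // _; rewrite mulr_ge0 ?expR_ge0// expr0 invr1.
Qed.

Lemma bump_gt0 x : 0 < x < 1 -> 0 < bump x.
Proof.
move=> /andP[x0 x1]; rewrite /bump /bump0 x0 ifT; last by lra.
by rewrite !expr0 invr1 !mul1r mulr_gt0// expR_gt0.
Qed.

Lemma bump_out x : ~ (0 < x < 1) -> bump x = 0.
Proof.
move=> H; rewrite /bump /bump0; case: ifPn => x0; last by rewrite mul0r.
by rewrite ifF ?mulr0//; apply/negP => h; apply: H; rewrite x0/=; lra.
Qed.

Definition smooth_step : R -> R := prim bump.

Let cbump : continuous bump := sm_continuous (sm_bump 0).

Lemma smooth_step_le0 x : x <= 0 -> smooth_step x = 0.
Proof.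
move=> x0; rewrite /smooth_step /prim.
have z (c : R) : c <= 0 -> \int[mu]_(z in `[-1, c]) bump z = 0.
  move=> c0; transitivity (\int[mu]_(z in `[-1, c]) (cst 0 : R -> R) z).
    apply: eq_Rintegral => z; rewrite inE/= in_itv/= => /andP[_ zc]; apply: bump_out.
    by move=> /andP[z0 _]; have := lt_le_trans z0 (le_trans zc c0); rewrite ltxx.
  by rewrite Rintegral_cst ?mul0r.
by rewrite !z// subrr.
Qed.

Lemma is_derive_smooth_step (x : R) : is_derive x 1 smooth_step (bump x).
Proof.
(* [prim] is differentiable beyond its base point -1 only; for negative x the function is locally
   0. *)
have [x0|x0] := ltP x 0; last first.
  by apply: is_derive_prim => //; apply: lt_le_trans x0; rewrite ltrN10.
rewrite bump_out; last by move=> /andP[+ _]; rewrite ltNge (ltW x0).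
apply: (@near_eq_is_derive _ _ _ (cst 0)).
near=> y; apply/esym/smooth_step_le0/ltW; near: y; exact: lt_nbhsl.
Unshelve. all: by end_near. Qed.

Lemma continuous_smooth_step : continuous smooth_step.
Proof. by move=> x; apply: is_derive_continuous; exact: is_derive_smooth_step. Qed.

Lemma smooth_step_ge1 x : 1 <= x -> smooth_step x = smooth_step 1.
Proof.
move=> x1; have z t : 1 < t < x -> bump t = 0.
  by move=> /andP[t1 _]; apply: bump_out => /andP[_]; rewrite ltNge (ltW t1).
apply/eqP; rewrite eq_le; apply/andP; split; last first.
  apply: (@derive_ge0_le R _ bump) => // [t _||t _]; [exact: is_derive_smooth_step| |exact: bump_ge0].
  exact: continuous_smooth_step.
rewrite -lerN2; apply: (@derive_ge0_le R (fun y => - smooth_step y) (fun y => - bump y)) => // [t _||t tx].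
- by apply: is_deriveN; exact: is_derive_smooth_step.
- by move=> y; apply: cvgN; exact: continuous_smooth_step.
- by rewrite z// oppr0.
Qed.

Lemma smooth_step1_gt0 : 0 < smooth_step 1.
Proof.
have d (t : R) : t \in `]0, 1[%R -> is_derive t 1 smooth_step (bump t).
  by move=> _; exact: is_derive_smooth_step.
have [c] := MVT ltr01 d (continuous_subspaceT continuous_smooth_step).
rewrite in_itv/= => c01; rewrite (smooth_step_le0 (lexx 0)) !subr0 mulr1 => ->.
exact: bump_gt0.
Qed.

Lemma sm_smooth_step k : sm k smooth_step.
Proof.
case: k => [|k]; split=> //; try exact: continuous_smooth_step.
by exists bump; [exact: is_derive_smooth_step|exact: sm_bump].
Qed.

End SmoothFunctions.

(** * Test functions in time *)

Section WeightedEmbedding.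
Context {R : realType}.

Lemma weighted_embedding (s rho : R) c B : 0 <= rho -> 3 / 2 + rho < s -> sumby (hs s c) B ->
  sumby (fun n => n%:R * (n%:R `^ rho * absm c n))
    (Num.sqrt (2 * (1 + (2 * (s - rho) - 3)^-1) * B)).
Proof.
move=> r0 sr cB; have sr' : 3 / 2 < s - rho by lra.
have sp : 0 < s - rho by lra.
have hc n : hs (s - rho) (fun b m => m%:R `^ rho * c b m) n = hs s c n.
  rewrite /hs !exprMn -mulrDr mulrA; congr (_ * _).
  case: n => [|n].
    rewrite (@powR0 _ (2 * (s - rho))) ?mul0r ?(@powR0 _ (2 * s))//; first by apply: lt0r_neq0; lra.
    by apply: lt0r_neq0; lra.
  rewrite -powR_mulrn ?powR_ge0// -powRrM -powRD ?pnatr_eq0 ?implybT//.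
  by congr (_ `^ _); ring.
have := @sobolev_sumby_absm R (s - rho) (fun b m => m%:R `^ rho * c b m) B sr'.
move=> H; apply: sumby_le (H _) => [n|].
  by rewrite /absm !normrM !(ger0_norm (powR_ge0 _ _)) mulrDr.
by apply: sumby_le cB => n; rewrite hc.
Qed.

End WeightedEmbedding.

(** * Smooth ramps and approximate point evaluations *)

Section MeanValues.
Context {R : realType}.
Notation mu := (@lebesgue_measure R).
Notation integrable_on D f := (mu.-integrable D (EFin \o f)).
Implicit Types (s t de y e : R) (Q : R -> R).

Definition ramp s de y : R := smooth_step (de^-1 * y + - (s / de)).
Definition dramp s de y : R := de^-1 * bump (de^-1 * y + - (s / de)).

Lemma ramp_arg s de y : de^-1 * y + - (s / de) = (y - s) / de.
Proof. by rewrite mulrBl mulrC. Qed.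

Lemma is_derive_ramp s de y : is_derive y 1 (ramp s de) (dramp s de y).
Proof. by apply: is_derive_affine => z; exact: is_derive_smooth_step. Qed.

Lemma sm_ramp k s de : sm k (ramp s de).
Proof. by apply: sm_affine; exact: sm_smooth_step. Qed.

Lemma continuous_dramp s de : continuous (dramp s de).
Proof.
move=> y; apply: cvgMl_tmp.
exact: sm_continuous (sm_affine de^-1 (- (s / de)) (sm_bump 0)) y.
Qed.

Lemma ramp_le s de y : 0 < de -> y <= s -> ramp s de y = 0.
Proof.
move=> d0 ys; rewrite /ramp ramp_arg smooth_step_le0// pmulr_lle0 ?invr_gt0//.
by rewrite subr_le0.
Qed.

Lemma ramp_ge s de y : 0 < de -> s + de <= y -> ramp s de y = smooth_step 1.
Proof.
move=> d0 ys; rewrite /ramp ramp_arg smooth_step_ge1// ler_pdivlMr// mul1r.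
by rewrite lerBrDl.
Qed.

Lemma dramp_ge0 s de y : 0 < de -> 0 <= dramp s de y.
Proof. by move=> d0; rewrite mulr_ge0 ?bump_ge0// invr_ge0 ltW. Qed.

Lemma dramp_out s de y : 0 < de -> ~ (s < y < s + de) -> dramp s de y = 0.
Proof.
move=> d0 H; rewrite /dramp ramp_arg bump_out ?mulr0// => /andP[h1 h2]; apply: H.
rewrite -subr_gt0 -(pmulr_lgt0 _ (_ : 0 < de^-1)) ?invr_gt0// h1/=.
by move: h2; rewrite ltr_pdivrMr// mul1r ltrBlDl.
Qed.

Lemma dramp_mass s de (a b : R) : 0 < de -> a <= s -> s + de <= b ->
  \int[mu]_(y in `[a, b]) dramp s de y = smooth_step 1.
Proof.
move=> d0 as_ sb; have ab : a <= b by lra.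
have cr : continuous (ramp s de).
  by move=> y; apply: is_derive_continuous; exact: is_derive_ramp.
have := @Rintegral_ftc R (dramp s de) (ramp s de) a b ab
  (fun y _ => is_derive_ramp s de y) cr (@continuous_dramp s de).
by rewrite ramp_ge// ramp_le// subr0.
Qed.

Lemma dramp_average s de (a b : R) e Q : 0 < de -> a <= s -> s + de <= b -> continuous Q ->
  (forall y, s < y < s + de -> `|Q y - Q s| <= e) ->
  `|\int[mu]_(y in `[a, b]) (dramp s de y * Q y) - smooth_step 1 * Q s| <= e * smooth_step 1.
Proof.
move=> d0 as_ sb cQ Qe; rewrite -(dramp_mass d0 as_ sb).
have cD := @continuous_dramp s de.
have ci f : continuous f -> integrable_on `[a, b] f by exact: continuous_integrable_itv.
have cQ' (f : R -> R) : continuous f -> continuous (fun y => dramp s de y * f y).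
  by move=> cf y; apply: cvgM; [exact: cD|exact: cf].
have mI : measurable (`[a, b]%classic : set R) by exact: measurable_itv.
have cc (c : R) : continuous (fun _ : R => c) by move=> y; exact: cvg_cst.
rewrite -RintegralZr//; last exact: ci.
rewrite -RintegralB//; last 2 first.
- exact/ci/cQ'.
- by apply: ci; apply: cQ'.
have cB : continuous (fun y => dramp s de y * Q y - dramp s de y * Q s).
  by move=> y; apply: cvgB; [exact: cQ'|exact: (cQ' _ (cc (Q s)))].
apply: le_trans (le_normr_Rintegral _ _) _ => //; first exact: ci.
rewrite -RintegralZl//; last exact: ci.
apply: le_Rintegral => //.
- by apply: ci => y; apply: cvg_norm; exact: cB.
- by apply: ci => y; apply: cvgMl_tmp; exact: cD.
move=> y _; rewrite -mulrBr normrM (ger0_norm (dramp_ge0 _ _ d0)).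
have [sy|/negP sy] := boolP (s < y < s + de); last by rewrite dramp_out// mul0r mulr0.
by rewrite [X in _ <= X]mulrC ler_wpM2l ?dramp_ge0// Qe.
Qed.

(* The ramps act as antiderivatives of approximate Dirac masses at s and t. *)
Lemma constant_of_ramps Q T : continuous Q ->
  (forall s t de, 0 < s -> s < t -> 0 < de -> t + de < T ->
     \int[mu]_(y in `[s, t + de]) ((dramp s de y - dramp t de y) * Q y) = 0) ->
  forall s t, 0 < s < T -> 0 < t < T -> Q s = Q t.
Proof.
move=> cQ H s t; wlog st : s t / s < t => [W hs ht|/andP[s0 _] /andP[_ tT]].
  have [?|?|->//] := ltgtP s t; first exact: W.
  by apply/esym; exact: W.
have I0 := @smooth_step1_gt0 R; set I := smooth_step 1 in I0.
apply/eqP; rewrite -subr_eq0 -normr_le0; apply/ler_addgt0Pl => e e0; rewrite addr0.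
have e2 : 0 < e / 2 by rewrite divr_gt0.
have near_ (p : R) : exists2 d, 0 < d & forall y, p < y < p + d -> `|Q y - Q p| <= e / 2.
  have /cvgrPdist_le /(_ _ e2) /nbhs_ballP[d /= d0 Hd] := cQ p.
  exists d => // y /andP[y1 y2]; rewrite distrC; apply: Hd.
  by rewrite /ball/= ltr_norml; apply/andP; split; lra.
have [d1 d10 Hd1] := near_ s; have [d2 d20 Hd2] := near_ t.
(* The width is small enough for the oscillation bounds at s and at t and for the support to end
   before T. *)
have [de [de0 de1 de2 de3]] : exists de, [/\ 0 < de, de <= d1, de <= d2 & t + de < T].
  exists (Num.min (Num.min d1 d2) ((T - t) / 2)); split.
  - by rewrite !lt_min d10 d20 divr_gt0// subr_gt0.
  - by rewrite !ge_min lexx.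
  - by rewrite !ge_min lexx orbT.
  - rewrite -ltrBrDl gt_min; apply/orP; right; lra.
have h := H s t de s0 st de0 de3.
have std : s + de <= t + de by rewrite lerD2r ltW.
have a1 := @dramp_average s de s (t + de) (e / 2) Q de0 (lexx s) std cQ.
have a2 := @dramp_average t de s (t + de) (e / 2) Q de0 (ltW st) (lexx _) cQ.
have {}a1 : `|\int[mu]_(y in `[s, t + de]) (dramp s de y * Q y) - I * Q s| <= e / 2 * I.
  by apply: a1 => y /andP[y1 y2]; apply: Hd1; rewrite y1/=; lra.
have {}a2 : `|\int[mu]_(y in `[s, t + de]) (dramp t de y * Q y) - I * Q t| <= e / 2 * I.
  by apply: a2 => y /andP[y1 y2]; apply: Hd2; rewrite y1/=; lra.
have cD p : continuous (fun y => dramp p de y * Q y).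
  by move=> y; apply: cvgM; [exact: continuous_dramp|exact: cQ].
move: h; under eq_Rintegral do rewrite mulrBl.
rewrite RintegralB//; last 2 first.
- exact: continuous_integrable_itv.
- exact: continuous_integrable_itv.
move: (\int[mu]_(y in _) _) (\int[mu]_(y in _) _) a1 a2 => p q a1 a2 /eqP.
rewrite subr_eq0 => /eqP pq; rewrite pq in a1.
rewrite -(ler_pM2l I0) -{1}(ger0_norm (ltW I0)) -normrM mulrBr.
move: a1 a2; rewrite !ler_norml => /andP[h1 h2] /andP[h3 h4]; apply/andP; split; lra.
Qed.

End MeanValues.

(** * Modes of a weak solution *)

Section ModeEquation.
Context {R : realType}.
Notation mu := (@lebesgue_measure R).
Notation integrable_on D f := (mu.-integrable D (EFin \o f)).

Variables (g : R -> R -> R) (G : bool -> nat -> R -> R) (T C : R).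
Let gLg t x := g t x * Lambda (g t) x.
Let ggx t x := g t x * weak_deriv (g t) x.
Hypothesis gT : forall t, 0 < t -> torus_L1 (g t) /\ zero_average (g t).
Hypothesis gC : forall t, 0 < t < T -> sumby (fun n => n%:R * absm (coef (g t)) n) C.
Hypothesis gL : L1_loc_in_time gLg.
Hypothesis gx : L1_loc_in_time ggx.
Hypothesis weak : forall phi, test_function phi ->
  Dt (of_fun g) phi + DLambda (of_fun g) phi =
  DLambda (of_fun gLg) phi + Dx (of_fun ggx) phi.
Hypothesis cG : forall b n, continuous (G b n).
Hypothesis GC : forall b n t, 0 < t < T -> G b n t = coef (g t) b n.

Let mP := @measurable_period R.

(** The identity evaluates the nonlinearity on mode n; the two bounds, uniform in t, make the
    separate terms integrable in time, so that the weak form can be split and recombined. *)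
Let nonlinear_terms b n t : 0 < t < T ->
  [/\ fc (gLg t) b n + (-1) ^+ b * fc (ggx t) (~~ b) n = pi * NL (coef (g t)) b n,
      `|fc (gLg t) b n| <= C * C * (pi *+ 2) &
      `|fc (ggx t) b n| <= C * C * (pi *+ 2)].
Proof.
move=> tT; have t0 : 0 < t by case/andP: tT.
have [T1 Z1] := gT t0; have H := gC tT; have c0 := coef0 Z1.
have cB := sumby_absm c0 H; have E1 := fourier_expansion T1 T1 Z1 cB.
have [L1 EL] := Lambda_spec T1 H; have [D1 ED] := weak_deriv_spec T1 Z1 H.
have nB : sumby (absm (nc (coef (g t)))) C by apply: sumby_le H => k; rewrite absm_nc.
have dB : sumby (absm (dc (coef (g t)))) C by apply: sumby_le H => k; rewrite absm_dc.
have [gL1 _ _] := gL; have [gx1 _ _] := gx.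
have iL := (gL1 t t0).2; have ix := (gx1 t t0).2.
split.
- rewrite -(@nonlinear_coef R (g t) (Lambda (g t)) (weak_deriv (g t)) b n C T1 Z1 H L1 EL D1 ED).
  rewrite /fc -RintegralZl//; last exact: integrable_tb.
  rewrite -RintegralD//; last 2 first.
  - exact: integrable_tb.
  - by apply: integrableZ => //; exact: integrable_tb.
  by apply: eq_Rintegral => x _; rewrite /gLg /ggx; ring.
- have bound v : sumby (absm v) C -> ae_equal (Lambda (g t)) (trig v) ->
      `|fc (gLg t) b n| <= C * C * (pi *+ 2).
    move=> vB ev.
    have cc : continuous (fun x => trig (coef (g t)) x * trig v x).
      by move=> x; apply: cvgM; [exact: continuous_trig cB x|exact: continuous_trig vB x].
    rewrite (_ : fc (gLg t) b n = fc (fun x => trig (coef (g t)) x * trig v x) b n).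
      apply: fc_le_cst cc _ => x _; rewrite normrM ler_pM//.
        exact: trig_le cB.
      exact: trig_le vB.
    apply: (ae_Rintegral mP).
    - exact: integrable_meas (integrable_tb _ _ iL).
    - exact: integrable_meas (integrable_tb _ _ (integrable_period cc)).
    by apply: ae_imp (ae_and E1 ev) => x [e1 e2]; rewrite /gLg e1 e2.
  exact: bound nB EL.
have bound v : sumby (absm v) C -> ae_equal (weak_deriv (g t)) (trig v) ->
    `|fc (ggx t) b n| <= C * C * (pi *+ 2).
  move=> vB ev.
  have cc : continuous (fun x => trig (coef (g t)) x * trig v x).
    by move=> x; apply: cvgM; [exact: continuous_trig cB x|exact: continuous_trig vB x].
  rewrite (_ : fc (ggx t) b n = fc (fun x => trig (coef (g t)) x * trig v x) b n).
    apply: fc_le_cst cc _ => x _; rewrite normrM ler_pM//.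
      exact: trig_le cB.
    exact: trig_le vB.
  apply: (ae_Rintegral mP).
  - exact: integrable_meas (integrable_tb _ _ ix).
  - exact: integrable_meas (integrable_tb _ _ (integrable_period cc)).
  by apply: ae_imp (ae_and E1 ev) => x [e1 e2]; rewrite /ggx e1 e2.
exact: bound dB ED.
Qed.

Section SingleMode.
Variables (b : bool) (n : nat) (chi chi' : R -> R) (al be : R).
Hypothesis n0 : (0 < n)%N.
Hypothesis al0 : 0 < al.
Hypothesis beT : be < T.
Hypothesis schi : forall k, sm k chi.
Hypothesis dchi : forall t : R, is_derive t 1 chi (chi' t).
Hypothesis cchi' : continuous chi'.
Hypothesis chiz : forall t, ~ (al <= t <= be) -> chi t = 0.
Hypothesis chiz' : forall t, ~ (al <= t <= be) -> chi' t = 0.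
Hypothesis cNL : continuous (fun t => NL (fun b m => G b m t) b n).

Let phi t x := chi t * tb b n x.

Let test_multiple (r : R) b' : test_function (fun t x => chi t * r * tb b' n x).
Proof.
split=> [k|t x|].
- apply: sm_tensor => j; last exact: sm_tb.
  by apply: smM; [exact: schi|exact: sm_cst].
- by rewrite tb_periodic.
by exists al, be; split=> // t x H; rewrite chiz// !mul0r.
Qed.

Let tphi : test_function phi.
Proof.
have := test_multiple 1 b; rewrite (_ : (fun t x => _) = phi)//.
by apply/funext => t; apply/funext => x; rewrite mulr1.
Qed.

Let phi_dt t x : dt phi t x = chi' t * tb b n x.
Proof.
have h := is_deriveM (dchi t) (is_derive_cst (tb b n x) t 1).
have {}h : is_derive t 1 (phi^~ x) (chi' t * tb b n x).
  by apply: is_derive_eq h _; rewrite /GRing.scale/= mulr0 add0r mulrC.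
by rewrite /dt derive1E; have [] := h.
Qed.

Let phi_dx t x : dx phi t x = - (chi t * ((-1) ^+ b * (n%:R * tb (~~ b) n x))).
Proof.
have h := is_deriveM (is_derive_cst (chi t) x 1) (@derive_tb R b n x).
have {}h : is_derive x 1 (phi t) (- (chi t * ((-1) ^+ b * (n%:R * tb (~~ b) n x)))).
  by apply: is_derive_eq h _; rewrite /GRing.scale/= mulr0 addr0 mulrN.
by rewrite /dx derive1E; have [] := h.
Qed.

Let phi_Lambda t : torus_L1 (Lambda (phi t)) /\
  ae_equal (Lambda (phi t)) (fun x => chi t * (n%:R * tb b n x)).
Proof.
have [L1 EL] := test_Lambda tphi t; split=> //.
rewrite (_ : (fun x => _) = trig (nc (coef (phi t))))//.
apply/funext => x; rewrite /trig (@tsum_single _ n) => [|k kn].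
  have cf b' : coef (phi t) b' n = chi t * (if b == b' then 1 else 0).
    rewrite /coef /fc /phi.
    under eq_Rintegral do rewrite -mulrA.
    rewrite RintegralZl//; last first.
      by apply: integrable_tb; apply: integrable_period; exact: continuous_tb.
    rewrite tb_orthogonal// eqxx andbT; case: ifP => _; last by rewrite mulr0 mul0r.
    by rewrite mulfK ?mulr1// gt_eqF// pi_gt0.
  by rewrite /cterm /nc !cf; case: (b) => /=; ring.
case: k kn => [|k] kn; first by rewrite /cterm /nc !mul0r addr0.
have cf b' : coef (phi t) b' k.+1 = 0.
  rewrite /coef /fc /phi; under eq_Rintegral do rewrite -mulrA.
  rewrite RintegralZl//; last first.
    by apply: integrable_tb; apply: integrable_period; exact: continuous_tb.
  by rewrite tb_orthogonal// [n == _]eq_sym (negbTE kn) andbF mulr0 mul0r.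
by rewrite /cterm /nc !cf !mulr0 !mul0r addr0.
Qed.

Let fcZ (w : R -> R) (r : R) b' : integrable_on period w ->
  \int[mu]_(x in period) (w x * (r * tb b' n x)) = r * fc w b' n.
Proof.
move=> iw; rewrite /fc -RintegralZl//; last exact: integrable_tb.
by apply: eq_Rintegral => x _; rewrite mulrCA.
Qed.

(** The weak form tested against chi(t) times [tb b n]. As this function is an eigenfunction of
    [Lambda] and its x-derivative is a multiple of [tb (~~ b) n], only coefficients of index n
    survive. *)
Lemma mode_weak_form : \int[mu]_(t in `[al, be])
  (chi' t * G b n t + chi t * (n%:R * (NL (fun b m => G b m t) b n - G b n t))) = 0.
Proof.
have mI : measurable (`[al, be]%classic : set R) by exact: measurable_itv.
have cchi : continuous chi := sm_continuous (schi 0).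
have tin t : al <= t <= be -> 0 < t < T.
  by move=> /andP[h1 h2]; rewrite (lt_le_trans al0 h1) (le_lt_trans h2 beT).
have [gL1 gLm _] := gL; have [gx1 gxm _] := gx.
pose N3 t := fc (gLg t) b n; pose N4 t := fc (ggx t) (~~ b) n.
pose J1 t := chi' t * (pi * coef (g t) b n).
pose J2 t := chi t * n%:R * (pi * coef (g t) b n).
pose J3 t := chi t * n%:R * N3 t.
pose J4 t := chi t * - ((-1) ^+ b * n%:R) * N4 t.
have r1 : Dt (of_fun g) phi = - \int[mu]_(t in `[al, be]) J1 t.
  congr (- _); apply: Rintegral_halfline_support => // t t0; last by rewrite /J1 chiz'// mul0r.
  have [[_ ig] _] := gT t0; rewrite /J1 -fc_coef -fcZ//.
  by apply: eq_Rintegral => x _; rewrite phi_dt.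
have r2 : DLambda (of_fun g) phi = \int[mu]_(t in `[al, be]) J2 t.
  apply: Rintegral_halfline_support => // t t0; last by rewrite /J2 chiz// !mul0r.
  have [[_ ig] _] := gT t0; have [[_ iL] EL] := phi_Lambda t.
  rewrite /J2 -fc_coef -fcZ//; apply: (ae_Rintegral mP).
  - exact: measurable_funM (integrable_meas ig) (integrable_meas iL).
  - apply: measurable_funM (integrable_meas ig) _; apply: continuous_meas => //.
    by move=> x; apply: cvgMl_tmp; exact: continuous_tb.
  by apply: ae_imp EL => x -> _; rewrite !mulrA.
have r3 : DLambda (of_fun gLg) phi = \int[mu]_(t in `[al, be]) J3 t.
  apply: Rintegral_halfline_support => // t t0; last by rewrite /J3 chiz// !mul0r.
  have [_ ig] := gL1 t t0; have [[_ iL] EL] := phi_Lambda t.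
  rewrite /J3 -fcZ//; apply: (ae_Rintegral mP).
  - exact: measurable_funM (integrable_meas ig) (integrable_meas iL).
  - apply: measurable_funM (integrable_meas ig) _; apply: continuous_meas => //.
    by move=> x; apply: cvgMl_tmp; exact: continuous_tb.
  by apply: ae_imp EL => x -> _; rewrite !mulrA.
have r4 : Dx (of_fun ggx) phi = - \int[mu]_(t in `[al, be]) J4 t.
  congr (- _); apply: Rintegral_halfline_support => // t t0; last by rewrite /J4 chiz// !mul0r.
  have [_ ig] := gx1 t t0; rewrite /J4 /N4 -fcZ//.
  by apply: eq_Rintegral => x _; rewrite phi_dx; ring.
have := weak tphi; rewrite r1 r2 r3 r4 => {r1 r2 r3 r4} W.
have p0 : 0 < pi :> R by exact: pi_gt0.
have i12 (c : R -> R) : continuous c -> integrable_on `[al, be] (fun t => c t * (pi * coef (g t) b n)).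
  move=> cc; have ci : integrable_on `[al, be] (fun t => c t * (pi * G b n t)).
    apply: continuous_integrable_itv => t; apply: cvgM; first exact: cc.
    by apply: cvgMl_tmp; exact: cG.
  apply: eq_integrable ci => // t; rewrite inE/= in_itv/= => /tin h.
  by rewrite /= GC.
(* Measurability in time of these coefficients is available only through the pairing clause of
   [L1_loc_in_time]; hence the factor c is realized inside a test function. *)
have i34 (psi : R -> R -> R) (w : R -> R -> R) b' (c : R -> R) : test_function psi ->
    L1_loc_in_time w -> (forall t x, psi t x = c t * tb b' n x) -> continuous c ->
    (forall t, 0 < t < T -> `|fc (w t) b' n| <= C * C * (pi *+ 2)) ->
    integrable_on `[al, be] (fun t => c t * fc (w t) b' n).
  move=> tpsi [w1 wm _] E cc wb.
  have [K K0 HK] := continuous_itv_bounded al be cc.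
  apply: (@integrable_dom _ _ _ (fun=> K * (C * C * (pi *+ 2)))) => //.
  - have m := wm psi tpsi.
    have sub : `[al, be] `<=` (`]0, +oo[ : set R).
      by move=> t /=; rewrite !in_itv/= andbT => /tin /andP[].
    have := measurable_funS (@measurable_itv R `]0, +oo[) sub m.
    apply: eq_measurable_fun => t; rewrite inE/= in_itv/= => /tin /andP[t0 _].
    by rewrite -fcZ ?(w1 t t0).2//; apply: eq_Rintegral => x _; rewrite E.
  - move=> t; rewrite /= in_itv/= => tI; rewrite normrM ler_pM//; first exact: HK.
    by apply: wb; exact: tin.
  - by apply: continuous_integrable_itv => t; exact: cvg_cst.
have i1 : integrable_on `[al, be] J1 by exact: i12.
have i2 : integrable_on `[al, be] J2.
  by apply: (i12 (fun t => chi t * n%:R)) => t; apply: cvgMr_tmp; exact: cchi.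
have i3 : integrable_on `[al, be] J3.
  apply: (i34 _ _ _ _ (test_multiple n%:R b) gL) => // [t|t tT].
    by apply: cvgMr_tmp; exact: cchi.
  by have [] := nonlinear_terms b n tT.
have i4 : integrable_on `[al, be] J4.
  apply: (i34 _ _ _ _ (test_multiple (- ((-1) ^+ b * n%:R)) (~~ b)) gx) => // [t|t tT].
    by apply: cvgMr_tmp; exact: cchi.
  by have [] := nonlinear_terms (~~ b) n tT.
move/eqP: W; rewrite -subr_eq0 -(Rintegral_comb4 mI i1 i2 i3 i4) => /eqP W.
(* The weak identity is - pi times the claim: pi from the normalization of coefficients, the sign
   from the time derivative falling on the test function. *)
have np : - pi != 0 :> R by rewrite oppr_eq0 lt0r_neq0.
apply: (mulfI np); rewrite mulr0 -RintegralZl//; last first.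
  have ch : continuous (fun t => n%:R * (NL (fun b m => G b m t) b n - G b n t)).
    by move=> t; apply: cvgMl_tmp; apply: cvgB; [exact: cNL|exact: cG].
  apply: continuous_integrable_itv => t; apply: cvgD.
    by apply: cvgM; [exact: cchi'|exact: cG].
  by apply: cvgM; [exact: cchi|exact: ch].
rewrite -[RHS]W; apply: eq_Rintegral => t; rewrite inE/= in_itv/= => /tin tT.
have [e _ _] := nonlinear_terms b n tT.
have gE : (fun b m => G b m t) = coef (g t).
  by apply/funext => b'; apply/funext => m; exact: GC.
rewrite gE GC// /J1 /J2 /J3 /J4 /N3 /N4.
have e' : pi * (chi t * (n%:R * (NL (coef (g t)) b n - coef (g t) b n))) =
    chi t * n%:R * (pi * NL (coef (g t)) b n) - chi t * n%:R * (pi * coef (g t) b n) by ring.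
rewrite mulNr mulrDr e' -e.
move: (fc _ _ _) (fc _ _ _) (coef _ _ _) (chi t) (chi' t) (pi : R) ((-1) ^+ b) (n%:R : R).
by clear; move=> p q k c c' p0 sg m; ring.
Qed.

End SingleMode.

(** Lemma of du Bois-Reymond: G minus a primitive H of the right-hand side has zero derivative in
    the weak sense, hence is constant, being continuous. So G is differentiable with the derivative
    of H. *)
Lemma mode_ode b n : (0 < n)%N -> continuous (fun t => NL (fun b m => G b m t) b n) ->
  ode n%:R (fun t => NL (fun b m => G b m t) b n) (G b n) T.
Proof.
move=> n0 cNL; split; first exact: cG.
have ch : continuous (fun t => n%:R * (NL (fun b m => G b m t) b n - G b n t)).
  by move=> t; apply: cvgMl_tmp; apply: cvgB; [exact: cNL|exact: cG].
set h := fun t => _ in ch.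
pose H t := prim h (clamp t).
have cH : continuous H by exact: continuous_prim_clamp.
have dH (t : R) : 0 < t -> is_derive t 1 H (h t) by move=> t0; exact: is_derive_prim_clamp.
pose Q t := G b n t - H t.
have cQ : continuous Q by move=> t; apply: cvgB; [exact: cG|exact: cH].
have Qc : forall s t, 0 < s < T -> 0 < t < T -> Q s = Q t.
  apply: constant_of_ramps cQ _ => s t de s0 st de0 tT.
  (* Both ramps end at the value [smooth_step 1], so the difference is supported in [s, t + de]. *)
  pose chi y := ramp s de y + -1 * ramp t de y.
  pose chi' y := dramp s de y + -1 * dramp t de y.
  have dchi (y : R) : is_derive y 1 chi (chi' y).
    apply: is_deriveD; first exact: is_derive_ramp.
    have d := is_deriveM (is_derive_cst (-1 : R) y 1) (is_derive_ramp t de y).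
    by apply: is_derive_eq d _; rewrite /GRing.scale/= mulr0 addr0.
  have cchi' : continuous chi'.
    move=> y; apply: cvgD; first exact: continuous_dramp.
    by apply: cvgMl_tmp; exact: continuous_dramp.
  have schi k : sm k chi.
    apply: smD; first exact: sm_ramp.
    by apply: smM; [exact: sm_cst|exact: sm_ramp].
  have cchi := sm_continuous (schi 0%N).
  have chi_le y : y <= s -> chi y = 0.
    by move=> ys; rewrite /chi !ramp_le// ?mulr0 ?addr0//; exact: le_trans (ltW st).
  have chi_ge y : t + de <= y -> chi y = 0.
    move=> yt; rewrite /chi !ramp_ge// ?mulN1r ?subrr//.
    by apply: le_trans yt; rewrite lerD2r ltW.
  have chiz y : ~ (s <= y <= t + de) -> chi y = 0.
    move=> /negP; rewrite negb_and -!ltNge => /orP[/ltW|/ltW]; [exact: chi_le|exact: chi_ge].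
  have chiz' y : ~ (s <= y <= t + de) -> chi' y = 0.
    move=> yN; rewrite /chi' !dramp_out ?mulr0 ?addr0// => /andP[y1 y2]; apply: yN.
      by rewrite !ltW// (lt_trans st y1).
    by rewrite (ltW y1)/= ltW// (lt_trans y2)// ltrD2r.
  have W := @mode_weak_form b n chi chi' s (t + de) n0 s0 tT schi dchi cchi' chiz chiz' cNL.
  have ste : s <= t + de by lra.
  have dF y : s < y < t + de -> is_derive y 1 (fun z => chi z * H z) (chi y * h y + H y * chi' y).
    move=> /andP[sy _]; exact: (is_deriveM (dchi y) (dH y (lt_trans s0 sy))).
  have cF : continuous (fun z => chi z * H z) by move=> y; apply: cvgM; [exact: cchi|exact: cH].
  have cf : continuous (fun y => chi y * h y + H y * chi' y).
    by move=> y; apply: cvgD; apply: cvgM; [exact: cchi|exact: ch|exact: cH|exact: cchi'].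
  have := Rintegral_ftc ste dF cF cf; rewrite (chi_le s (lexx s)) (chi_ge _ (lexx (t + de))) !mul0r subrr => W2.
  have cw : continuous (fun y => chi' y * G b n y + chi y * h y).
    by move=> y; apply: cvgD; apply: cvgM; [exact: cchi'|exact: cG|exact: cchi|exact: ch].
  transitivity (\int[mu]_(y in `[s, t + de]) ((chi' y * G b n y + chi y * h y) -
      (chi y * h y + H y * chi' y))).
    by apply: eq_Rintegral => y _; rewrite /Q /chi'; ring.
  rewrite RintegralB//; last 2 first.
  - exact: continuous_integrable_itv.
  - exact: continuous_integrable_itv.
  by rewrite W W2 subrr.
move=> t tT; have /andP[t0 tT'] := tT.
apply: (@near_eq_is_derive _ _ _ (fun y => H y + Q t)).
  near=> y; rewrite (Qc t y tT) /Q; first by ring.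
  by apply/andP; split; near: y; [exact: lt_nbhsr|exact: lt_nbhsl].
by apply: is_derive_eq (is_deriveD (dH t t0) (is_derive_cst (Q t) t 1)) _; rewrite addr0.
Unshelve. all: by end_near. Qed.

End ModeEquation.

(** * Uniqueness for the system of modes *)

Section WeightedComparison.
Context {R : realType}.
Notation mu := (@lebesgue_measure R).
Notation integrable_on D f := (mu.-integrable D (EFin \o f)).
Implicit Types (x s : R -> R) (r la T : R).

(* With y' = r (|s| - y), y 0 = 0, one has |x| <= y, and integrating the
   derivative of e^(-la t) y gives the bound. *)
Lemma ode_l1 r la T x s : 0 <= r -> 0 <= la -> 0 <= T -> continuous s -> ode r s x T -> x 0 = 0 ->
  (r + la) * \int[mu]_(t in `[0, T]) (expR (- la * t) * `|x t|) <=
  r * \int[mu]_(t in `[0, T]) (expR (- la * t) * `|s t|).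
Proof.
move=> r0 la0 T0 cs [cx dx] x0.
have cns : continuous (fun t => `|s t|) by move=> t; apply: cvg_norm; exact: cs.
have cnx : continuous (fun t => `|x t|) by move=> t; apply: cvg_norm; exact: cx.
pose y := duh r 0 (fun t => `|s t|).
have [cy dy] : ode r (fun t => `|s t|) y T by exact: duh_ode.
have y0 : y 0 = 0 by rewrite /y duh0.
have cE (q : R) : continuous (fun t => expR (q * t)) by exact: continuous_expRM.
have xy t : 0 <= t <= T -> `|x t| <= y t.
  move=> /andP[t0 tT].
  have H (e : R) : `|e| = 1 -> 0 <= y t + e * x t.
    move=> e1; pose F z := expR (r * z) * (y z + e * x z).
    have F0 : F 0 = 0 by rewrite /F x0 y0 add0r !mulr0.
    rewrite -(pmulr_rge0 _ (expR_gt0 (r * t))) -/(F t) -F0.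
    apply: (@derive_ge0_le R F (fun z => r * expR (r * z) * (`|s z| + e * s z))) t0 _ _ _.
    - move=> z /andP[z0 zt]; have zT : 0 < z < T by rewrite z0 (lt_le_trans zt).
      apply: is_derive_eq (is_deriveM (is_derive_expRM r z)
        (is_deriveD (dy z zT) (is_deriveZ e (dx z zT)))) _.
      rewrite -[LHS]/(expR (r * z) * (r * (`|s z| - y z) + e * (r * (s z - x z))) +
        (y z + e * x z) * (r * expR (r * z))); ring.
    - move=> z; apply: cvgM; first exact: cE.
      by apply: cvgD; [exact: cy|apply: cvgMl_tmp; exact: cx].
    - move=> z _; rewrite !mulr_ge0 ?expR_ge0//.
      have : `|e * s z| <= `|s z| by rewrite normrM e1 mul1r.
      by rewrite ler_norml => /andP[? _]; lra.
  have := H 1 (normr1 _); have := H (- 1); rewrite normrN normr1 !mulN1r mul1r => /(_ erefl).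
  by move=> h1 h2; rewrite ler_norml; apply/andP; split; lra.
have ci f : continuous f -> integrable_on `[0, T] f by exact: continuous_integrable_itv.
have cEf f : continuous f -> continuous (fun t => expR (- la * t) * f t).
  by move=> cf t; apply: cvgM; [exact: cE|exact: cf].
apply: (@le_trans _ _ ((r + la) * \int[mu]_(t in `[0, T]) (expR (- la * t) * y t))).
  rewrite ler_wpM2l ?addr_ge0//; apply: le_Rintegral => //; try by apply: ci; exact: cEf.
  by move=> t; rewrite /= in_itv/= => tI; rewrite ler_wpM2l ?expR_ge0// xy.
have dF z : 0 < z < T -> is_derive z 1 (fun t => expR (- la * t) * y t)
    (r * (expR (- la * z) * `|s z|) - (r + la) * (expR (- la * z) * y z)).
  move=> zT; apply: is_derive_eq (is_deriveM (is_derive_expRM (- la) z) (dy z zT)) _.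
  by rewrite /GRing.scale/=; ring.
have c1 : continuous (fun z => r * (expR (- la * z) * `|s z|)).
  by move=> z; apply: cvgMl_tmp; exact: (cEf _ cns).
have c2 : continuous (fun z => (r + la) * (expR (- la * z) * y z)).
  by move=> z; apply: cvgMl_tmp; exact: (cEf _ cy).
have cf : continuous (fun z => r * (expR (- la * z) * `|s z|) - (r + la) * (expR (- la * z) * y z)).
  by move=> z; apply: cvgB; [exact: c1|exact: c2].
have := Rintegral_ftc T0 dF (cEf _ cy) cf.
rewrite y0 mulr0 subr0 RintegralB//; [|exact: ci|exact: ci].
rewrite RintegralZl//; last by apply: ci; exact: (cEf _ cns).
rewrite RintegralZl//; last by apply: ci; exact: (cEf _ cy).
move=> e; rewrite -subr_ge0 e mulr_ge0 ?expR_ge0//.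
by apply: le_trans (xy T _); rewrite ?T0 ?lexx.
Qed.

End WeightedComparison.

Section SystemUniqueness.
Context {R : realType}.
Notation mu := (@lebesgue_measure R).
Notation integrable_on D f := (mu.-integrable D (EFin \o f)).

(** F plays the constructed solution, with a small majorant A; G is the competitor, of arbitrary
    size C but with n^rho to spare. *)
Variables (F G : bool -> nat -> R -> R) (A : nat -> R) (a C rho T : R).
Hypothesis cF : forall b n, continuous (F b n).
Hypothesis cG : forall b n, continuous (G b n).
Hypothesis FA : forall b n t, `|F b n t| <= A n.
Hypothesis A00 : A 0%N = 0.
Hypothesis Aa : sumby (fun n => n%:R * A n) a.
Hypothesis a4 : 4 * a <= 1.
Hypothesis rho01 : 0 < rho <= 1.
Hypothesis G0 : forall b t, G b 0%N t = 0.

Let ga n t : R := `|G false n t| + `|G true n t|.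
Hypothesis GC : forall t, sumby (fun n => n%:R * (n%:R `^ rho * ga n t)) C.

Let rho0 : 0 < rho. Proof. by case/andP: rho01. Qed.
Let A0 n : 0 <= A n. Proof. exact: le_trans (FA false n 0). Qed.
Let C0 : 0 <= C. Proof. exact: sumby_ge0 (GC 0). Qed.
Let a0 : 0 <= a. Proof. exact: sumby_ge0 Aa. Qed.
Let ga0 n t : 0 <= ga n t. Proof. exact: addr_ge0. Qed.
Let gaG b n t : `|G b n t| <= ga n t.
Proof. by rewrite /ga; case: b; rewrite ?lerDr ?lerDl. Qed.

Let ga_decay n t : ga n t <= C * n%:R `^ (- (1 + rho)).
Proof.
case: n => [|n]; first by rewrite /ga !G0 normr0 addr0 mulr_ge0 ?powR_ge0.
rewrite powRN ler_pdivlMr ?powR_gt0// powRD ?pnatr_eq0 ?implybT// powRr1//.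
rewrite mulrC -mulrA; apply: (term_le_sumby n.+1 _ (GC t)) => k.
by rewrite !mulr_ge0// powR_ge0.
Qed.

Let ga_le n t : ga n t <= C.
Proof.
apply: le_trans (ga_decay n t) _; rewrite ler_piMr//.
case: n => [|n]; first by rewrite powR0// oppr_eq0 gt_eqF// addr_gt0.
by rewrite powRN invf_le1 ?powR_gt0// -[X in X <= _](powRr0 n.+1%:R) ler_powR ?ler1n// addr_ge0// ltW.
Qed.

(** The hypothesis on G bounds a sum at each time but offers no fixed dominating sequence. The decay
    n^-(1 + rho) of single modes does: m times two such factors is summable in m, uniformly in t and
    n. *)
Let ga_prod m n t : m%:R * (ga m t * ga (m + n) t) <= C ^+ 2 * m%:R `^ (- (1 + (rho + rho))).
Proof.
case: m => [|m]; first by rewrite mul0r mulr_ge0 ?powR_ge0// sqr_ge0.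
have m0 : 0 < m.+1%:R :> R by rewrite ltr0n.
have h : ga (m.+1 + n) t <= C * m.+1%:R `^ (- (1 + rho)).
  apply: le_trans (ga_decay _ t) _; rewrite ler_wpM2l// !powRN lef_pV2 ?posrE ?powR_gt0 ?ltr0n//.
  by rewrite ge0_ler_powR ?nnegrE ?addr_ge0 ?(ltW rho0)// ler_nat leq_addr.
apply: (@le_trans _ _ (m.+1%:R * (C * m.+1%:R `^ (- (1 + rho)) * (C * m.+1%:R `^ (- (1 + rho)))))).
  by rewrite ler_wpM2l// ler_pM.
rewrite (_ : _ * _ = C ^+ 2 * (m.+1%:R `^ 1 * m.+1%:R `^ (- (1 + rho)) * m.+1%:R `^ (- (1 + rho)))).
  rewrite -!powRD ?pnatr_eq0 ?implybT// ler_wpM2l ?sqr_ge0// le_eqVlt; apply/orP; left; apply/eqP.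
  by congr (_ `^ _); ring.
by rewrite powRr1//; ring.
Qed.

Let v1 n : R := C ^+ 2 * n%:R `^ (- (1 + (rho + rho))).
Let v1B : sumby v1 (C ^+ 2 * (1 + (rho + rho)^-1)).
Proof. by apply: sumbyZ; [exact: sqr_ge0|apply: pseries_sumby; exact: addr_gt0]. Qed.

Let NLG_term b n t m : `|NLt (fun b m => G b m t) b n m| <= v1 m.
Proof.
apply: le_trans (ga_prod m n t); rewrite /NLt normrM normr_nat ler_wpM2l//.
apply: le_trans (ler_normD _ _) _; rewrite !normrM normrX normrN1 expr1n mul1r.
rewrite [ga m t]/ga mulrDl; apply: lerD; exact: ler_wpM2l.
Qed.

Lemma NLG_continuous b n : continuous (fun t => NL (fun b m => G b m t) b n).
Proof.
apply: (@mtest_continuous R R (fun m t => NLt (fun b k => G b k t) b n m) v1 _ _ _ v1B) => [m t|m t].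
  apply: cvgMl_tmp; apply: cvgD; first by apply: cvgM; exact: cG.
  by apply: cvgMl_tmp; apply: cvgM; exact: cG.
exact: NLG_term.
Qed.

Hypothesis T0 : 0 <= T.
Hypothesis oF : forall b n, (0 < n)%N -> ode n%:R (fun t => NL (fun b m => F b m t) b n) (F b n) T.
Hypothesis oG : forall b n, (0 < n)%N -> ode n%:R (fun t => NL (fun b m => G b m t) b n) (G b n) T.
Hypothesis FG0 : forall b n, F b n 0 = G b n 0.

Let d b n t : R := G b n t - F b n t.
Let z n t : R := `|d false n t| + `|d true n t|.
Let la : R := (8 * C + 1) `^ rho^-1.
Let E t : R := expR (- la * t).
Let I n : R := \int[mu]_(t in `[0, T]) (E t * z n t).
(** Majorant of the difference of the two nonlinearities, from G G - F F = (G - F) G + F (G - F).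
    Where the large solution appears, the weight m falls on the difference; elsewhere it falls on
    the small A. *)
Let e n m t : R := m%:R * (z m t * ga (m + n) t) + m%:R * A m * z (m + n) t.

Let mI : measurable (`[0, T]%classic : set R). Proof. exact: measurable_itv. Qed.
Let ci f : continuous f -> integrable_on `[0, T] f.
Proof. exact: continuous_integrable_itv. Qed.
Let cE : continuous E. Proof. exact: continuous_expRM. Qed.
Let E0 t : 0 <= E t. Proof. exact: expR_ge0. Qed.
Let la0 : 0 < la. Proof. by rewrite powR_gt0// ltr_wpDl// mulr_ge0. Qed.
Let E1 t : 0 <= t -> E t <= 1.
Proof. by move=> t0; rewrite /E -expR0 ler_expR mulNr oppr_le0 mulr_ge0// ltW. Qed.
Let cd b n : continuous (d b n). Proof. by move=> t; apply: cvgB; [exact: cG|exact: cF]. Qed.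
Let cz n : continuous (z n).
Proof. by move=> t; apply: cvgD; apply: cvg_norm; exact: cd. Qed.
Let cga n : continuous (ga n).
Proof. by move=> t; apply: cvgD; apply: cvg_norm; exact: cG. Qed.
Let z0 n t : 0 <= z n t. Proof. exact: addr_ge0. Qed.
Let dz b n t : `|d b n t| <= z n t.
Proof. by rewrite /z; case: b; rewrite ?lerDr ?lerDl. Qed.
Let z_le n t : z n t <= ga n t + 2 * A n.
Proof.
have h b : `|d b n t| <= `|G b n t| + A n by apply: le_trans (ler_normB _ _) _; rewrite lerD2l.
by have := h false; have := h true; rewrite /z /ga; lra.
Qed.
Let e0 n m t : 0 <= e n m t.
Proof. by rewrite addr_ge0// !mulr_ge0. Qed.
Let ce n m : continuous (e n m).
Proof.
move=> t; apply: cvgD; apply: cvgMl_tmp; last exact: cz.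
by apply: cvgM; [exact: cz|exact: cga].
Qed.
Let A_le m : A m <= a.
Proof.
case: m => [|m]; first by rewrite A00.
apply: le_trans (term_le_sumby m.+1 _ Aa) => [|k]; last by rewrite mulr_ge0.
by rewrite ler_peMl// ler1n.
Qed.

Let v n : R := v1 n + (3 * C + 2 * a) * (n%:R * A n).
Let vB : sumby v (C ^+ 2 * (1 + (rho + rho)^-1) + (3 * C + 2 * a) * a).
Proof.
by apply: sumbyD v1B _; apply: sumbyZ => //; rewrite addr_ge0// mulr_ge0.
Qed.
Let v0 n : 0 <= v n.
Proof. by rewrite addr_ge0 ?mulr_ge0 ?sqr_ge0 ?powR_ge0// addr_ge0// mulr_ge0. Qed.

Let e_le n m t : e n m t <= v m.
Proof.
have h1 : m%:R * (z m t * ga (m + n) t) <=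
    m%:R * (ga m t * ga (m + n) t) + 2 * C * (m%:R * A m).
  rewrite (_ : 2 * C * _ = m%:R * (2 * A m * C)); last by ring.
  rewrite -mulrDr ler_wpM2l//; apply: le_trans (ler_wpM2r (ga0 _ _) (z_le m t)) _.
  by rewrite mulrDl lerD2l ler_wpM2l ?mulr_ge0.
have h2 : m%:R * A m * z (m + n) t <= m%:R * A m * (C + 2 * a).
  rewrite ler_wpM2l ?mulr_ge0//; apply: le_trans (z_le _ t) _; apply: lerD => //.
  by rewrite ler_wpM2l.
have h3 := ga_prod m n t; rewrite /e /v -/(v1 m) in h3 *.
move: (m%:R * A m) h1 h2 => p h1 h2; have := lerD h1 h2; lra.
Qed.

Let NL_difference b n t :
  `|NL (fun b m => G b m t) b n - NL (fun b m => F b m t) b n| <= tsum (fun m => e n m t).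
Proof.
have cGs := dom_cvg (NLG_term b n t) v1B.
have cFs : cvgn (series (NLt (fun b m => F b m t) b n)).
  apply: (dom_cvg (v := fun m => 2 * cvt A A n m) _ (sumbyZ (ler0n R 2) (cvt_sumby n A0 A0 Aa Aa))).
  by move=> m; apply: NLt_le2 => b' k; exact: FA.
rewrite -[NL _ b n]/(tsum (NLt (fun b m => G b m t) b n)).
rewrite -[NL (fun b m => F b m t) b n]/(tsum (NLt (fun b m => F b m t) b n)) -tsumB//.
have eB : sumby (fun m => e n m t) (C ^+ 2 * (1 + (rho + rho)^-1) + (3 * C + 2 * a) * a).
  exact: sumby_le vB.
apply: tsum_norm eB => m; rewrite /NLt -mulrBr normrM normr_nat /e -mulrA -mulrDr ler_wpM2l//.
set g0 := G false m t; set g1 := G true m t; set gb := G b _ t; set gc := G (~~ b) _ t.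
set f0 := F false m t; set f1 := F true m t; set fb := F b _ t; set fc_ := F (~~ b) _ t.
rewrite (_ : _ - _ = (g0 - f0) * gb + f0 * (gb - fb) +
  (-1) ^+ b * ((g1 - f1) * gc + f1 * (gc - fc_))); last by ring.
apply: le_trans (ler_normD _ _) _; rewrite normrM normrX normrN1 expr1n mul1r.
have k1 : `|(g0 - f0) * gb| <= `|d false m t| * ga (m + n) t
  by rewrite normrM; apply: ler_wpM2l => //; exact: gaG.
have k2 : `|f0 * (gb - fb)| <= A m * `|d b (m + n) t|
  by rewrite normrM; apply: ler_wpM2r => //; exact: FA.
have k3 : `|(g1 - f1) * gc| <= `|d true m t| * ga (m + n) t
  by rewrite normrM; apply: ler_wpM2l => //; exact: gaG.
have k4 : `|f1 * (gc - fc_)| <= A m * `|d (~~ b) (m + n) t|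
  by rewrite normrM; apply: ler_wpM2r => //; exact: FA.
have zE : z (m + n) t = `|d b (m + n) t| + `|d (~~ b) (m + n) t|.
  by rewrite /z; case: (b) => //=; rewrite addrC.
rewrite zE /z.
have := ler_normD ((g0 - f0) * gb) (f0 * (gb - fb)).
have := ler_normD ((g1 - f1) * gc) (f1 * (gc - fc_)).
move=> h1 h2; apply: le_trans (lerD h2 h1) _.
rewrite [X in _ <= X + _]mulrDl [X in _ <= _ + X]mulrDr.
by rewrite addrACA; exact: lerD (lerD k1 k3) (lerD k2 k4).
Qed.

(** The exponential weight in time improves the damping from n to n + la; n / (n + la) is the gain
    of [ode_l1], and the other n is the weight of the norm. *)
Let w n : R := n%:R * (n%:R / (n%:R + la)).

Let I_le n : n%:R * I n <= 2 * (w n * tsum (fun m => \int[mu]_(t in `[0, T]) (E t * e n m t))).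
Proof.
have [->|n0] := posnP n; first by rewrite /w !mul0r mulr0.
have cFn b := @NL_continuous R F A a b n cF FA Aa.
pose s b t := NL (fun b m => G b m t) b n - NL (fun b m => F b m t) b n.
have cs b : continuous (s b) by move=> t; apply: cvgB; [exact: NLG_continuous|exact: cFn].
have od b : ode n%:R (s b) (d b n) T.
  split=> [|t tT]; first exact: cd.
  apply: is_derive_eq (is_deriveB ((oG b n0).2 t tT) ((oF b n0).2 t tT)) _.
  by rewrite /s /d; ring.
have d0 b : d b n 0 = 0 by rewrite /d FG0 subrr.
have np : 0 < n%:R + la by rewrite ltr_wpDl.
have ln b := @ode_l1 R n%:R la T (d b n) (s b) (ler0n R n) (ltW la0) T0 (cs b) (od b) (d0 b).
have [|||ie sumE] := @Rintegral_tsum R `[0, T] (fun m t => E t * e n m t) v _ (fun=> 1) mI _ _ v0 vB.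
- by move=> m; apply: continuous_meas => // t; apply: cvgM; [exact: cE|exact: ce].
- move=> m t; rewrite /= in_itv/= mulr1 => /andP[t0 _]; rewrite ger0_norm ?mulr_ge0//.
  by apply: le_trans (ler_wpM2r (e0 _ _ _) (E1 t0)) _; rewrite mul1r.
- by apply: ci => t; exact: cvg_cst.
have sl b : \int[mu]_(t in `[0, T]) (E t * `|s b t|) <=
    tsum (fun m => \int[mu]_(t in `[0, T]) (E t * e n m t)).
  rewrite -sumE; apply: le_Rintegral => //.
    by apply: ci => t; apply: cvgM; [exact: cE|apply: cvg_norm; exact: cs].
  move=> t _; rewrite tsumZ; first by rewrite ler_wpM2l//; exact: NL_difference.
  by apply: (dom_cvg _ vB) => m; rewrite ger0_norm.
have {ln} db b : \int[mu]_(t in `[0, T]) (E t * `|d b n t|) <=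
    n%:R / (n%:R + la) * tsum (fun m => \int[mu]_(t in `[0, T]) (E t * e n m t)).
  rewrite mulrAC ler_pdivlMr// mulrC; apply: le_trans (ln b) _; exact: ler_wpM2l.
have -> : I n = \int[mu]_(t in `[0, T]) (E t * `|d false n t|) +
    \int[mu]_(t in `[0, T]) (E t * `|d true n t|).
  rewrite -RintegralD//; first by apply: eq_Rintegral => t _; rewrite -mulrDr.
  - by apply: ci => t; apply: cvgM; [exact: cE|apply: cvg_norm; exact: cd].
  - by apply: ci => t; apply: cvgM; [exact: cE|apply: cvg_norm; exact: cd].
rewrite /w -mulrA mulrCA ler_wpM2l// mulr2n mulrDl mul1r; exact: lerD.
Qed.

Let I0 n : 0 <= I n.
Proof. by apply: Rintegral_ge0 => t _; rewrite mulr_ge0. Qed.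

Let w_ge0 n : 0 <= w n.
Proof. by rewrite !mulr_ge0// invr_ge0 addr_ge0// ltW. Qed.

Let w_le n : w n <= n%:R.
Proof. by rewrite ler_piMr// ler_pdivrMr ?ltr_wpDl// mul1r lerDl ltW. Qed.

(* n / (n + la) <= (n / la)^rho, and la^rho = 8 C + 1. *)
Let w_small n : 8 * C * w n <= n%:R * n%:R `^ rho.
Proof.
rewrite /w mulrCA ler_wpM2l//.
have [->|n0] := posnP n; first by rewrite mul0r mulr0 powR_ge0.
have np : 0 < n%:R :> R by rewrite ltr0n.
have nl : 0 < n%:R + la by exact: addr_gt0.
have lr : la `^ rho = 8 * C + 1 by rewrite /la -powRrM mulVf ?gt_eqF// powRr1// addr_ge0// mulr_ge0.
have q : n%:R / (n%:R + la) <= (n%:R / (n%:R + la)) `^ rho.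
  rewrite -[X in X <= _]powRr1 ?divr_ge0 ?(ltW nl)//; apply: ger_powR; last by case/andP: rho01.
  by rewrite divr_gt0//= ler_pdivrMr// mul1r lerDl ltW.
have q2 : (n%:R / (n%:R + la)) `^ rho <= n%:R `^ rho / la `^ rho.
  rewrite ler_pdivlMr; last exact: powR_gt0.
  have x0 : 0 <= n%:R / (n%:R + la) by rewrite divr_ge0// ltW.
  rewrite -(powRM _ x0 (ltW la0)).
  rewrite ge0_ler_powR ?nnegrE ?mulr_ge0 ?invr_ge0 ?(ltW nl) ?(ltW la0) ?(ltW rho0)//.
  by rewrite mulrAC ler_pdivrMr// ler_wpM2l// lerDr ltW.
apply: (@le_trans _ _ (8 * C * (n%:R `^ rho / (8 * C + 1)))).
  by rewrite ler_wpM2l ?mulr_ge0// -lr; exact: le_trans q q2.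
rewrite mulrCA ler_piMr ?powR_ge0// ler_pdivrMr ?mul1r ?lerDl//.
by rewrite ltr_wpDl// mulr_ge0.
Qed.

(** Here la pays for the large solution: 8 C w_n is at most n^(1 + rho), hence at most (m + n)^(1 +
    rho), and the corresponding weighted sum of G is bounded by C, which cancels. The case C = 0 is
    apart since C is divided out. *)
Let w_ga N m t : 8 * series (fun n => w n * ga (m + n) t) N <= 1.
Proof.
have [CE|Cp] := eqVneq C 0.
  rewrite seriesE big1 ?mulr0 ?ler01// => i _.
  have : ga (m + i) t <= C by exact: ga_le.
  by rewrite CE => h; rewrite (@le_anti _ _ (ga (m + i) t) 0) ?mulr0// h ga0.
have Cpos : 0 < C by rewrite lt_def Cp C0.
rewrite -(ler_pM2l Cpos) mulr1 mulrCA.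
have sh := @shift_sumby R (fun n => n%:R * (n%:R `^ rho * ga n t)) C m _ (GC t) N.
apply: le_trans (sh _); last by move=> k; rewrite !mulr_ge0// powR_ge0.
rewrite !seriesE !mulr_sumr; apply: ler_sum => i _.
rewrite (_ : 8 * _ = 8 * C * w i * ga (m + i) t); last by ring.
rewrite [X in _ <= X]mulrA ler_wpM2r//; apply: le_trans (w_small i) _.
by rewrite ler_pM ?powR_ge0// ?ler_nat ?leq_addl// ge0_ler_powR ?nnegrE ?(ltW rho0)// ler_nat leq_addl.
Qed.

Let int_cst (c : R) : \int[mu]_(t in `[0, T]) (cst c t) = c * T.
Proof.
have mT : (mu `[0%R, T] = T%:E)%E.
  rewrite lebesgue_measure_itv/= lte_fin; case: ltgtP T0 => [T1|//|<-//] _.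
  by rewrite -EFinB subr0.
by rewrite Rintegral_cst// [X in fine X]mT.
Qed.

(** A priori finiteness: without it the final inequality between M and 3/4 M would be void. *)
Let I_finite : sumby (fun n => n%:R * I n) (T * (C + 2 * a)).
Proof.
move=> N.
have iz n : integrable_on `[0, T] (fun t => E t * z n t).
  by apply: ci => t; apply: cvgM; [exact: cE|exact: cz].
have iz' n : integrable_on `[0, T] (fun t => n%:R * (E t * z n t)) by exact: integrableZ.
have [iS Se] := Rintegral_series N mI iz'.
rewrite (_ : series _ N = \int[mu]_(t in `[0, T]) series (fun n => n%:R * (E t * z n t)) N); last first.
  by rewrite Se !seriesE; apply: eq_bigr => i _; rewrite RintegralZl.
have -> : T * (C + 2 * a) = \int[mu]_(t in `[0, T]) (cst (C + 2 * a) t).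
  by rewrite int_cst mulrC.
apply: le_Rintegral => //; first by apply: ci => t; exact: cvg_cst.
move=> t; rewrite /= in_itv/= => /andP[t0 _].
have gt : sumby (fun n => n%:R * ga n t) C.
  apply: sumby_le (GC t) => n; rewrite ler_wpM2l//.
  case: n => [|n]; first by rewrite /ga !G0 normr0 addr0 mulr0.
  by rewrite ler_peMl// -[X in X <= _](powRr0 n.+1%:R) ler_powR ?ler1n// ltW.
have S : sumby (fun n => n%:R * (E t * z n t)) (C + 2 * a); last exact: S.
apply: sumby_le (sumbyD gt (sumbyZ (ler0n R 2) Aa)) => n.
rewrite [X in _ + X]mulrCA -mulrDr ler_wpM2l//; apply: le_trans (z_le n t).
exact: (ler_piMl (z0 n t) (E1 t0)).
Qed.

Let J n m := \int[mu]_(t in `[0, T]) (E t * e n m t).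
Let K n m := \int[mu]_(t in `[0, T]) (E t * (m%:R * (z m t * ga (m + n) t))).

Let J_ge0 n m : 0 <= J n m.
Proof. by apply: Rintegral_ge0 => t _; rewrite mulr_ge0. Qed.

Let J_cvg n : cvgn (series (J n)).
Proof.
apply: (sumby_cvg (J_ge0 n)) (sumby_le _ (sumbyZ T0 vB)) => m.
rewrite mulrC -int_cst; apply: le_Rintegral => //.
- by apply: ci => t; apply: cvgM; [exact: cE|exact: ce].
- by apply: ci => t; exact: cvg_cst.
move=> t; rewrite /= in_itv/= => /andP[t0 _].
by apply: le_trans (ler_wpM2r (e0 _ _ _) (E1 t0)) _; rewrite mul1r.
Qed.

Let cEf f : continuous f -> integrable_on `[0, T] (fun t => E t * f t).
Proof. by move=> cf; apply: ci => t; apply: cvgM; [exact: cE|exact: cf]. Qed.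

Let czg m n : continuous (fun t => m%:R * (z m t * ga (m + n) t)).
Proof. by move=> t; apply: cvgMl_tmp; apply: cvgM; [exact: cz|exact: cga]. Qed.

Let J_split n m : J n m = K n m + m%:R * A m * I (m + n).
Proof.
rewrite /K /I -RintegralZl//; last exact: cEf.
rewrite -RintegralD//; last 2 first.
- by apply: cEf; exact: czg.
- by apply: integrableZ => //; exact: cEf.
by apply: eq_Rintegral => t _; rewrite /e; ring.
Qed.

Let K_sum N m : series (fun n => w n * K n m) N <= 8^-1 * (m%:R * I m).
Proof.
pose f n t := w n * (E t * (m%:R * (z m t * ga (m + n) t))).
have fi n : integrable_on `[0, T] (f n).
  by apply: integrableZ => //; apply: cEf; exact: czg.
have [iS Se] := Rintegral_series N mI fi.
rewrite (_ : series _ N = \int[mu]_(t in `[0, T]) series (f^~ t) N); last first.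
  by rewrite Se !seriesE; apply: eq_bigr => i _; rewrite RintegralZl//; apply: cEf; exact: czg.
rewrite /I -!RintegralZl//; last 2 first.
- by apply: integrableZ => //; exact: cEf.
- exact: cEf.
apply: le_Rintegral => //; first by do 2 apply: integrableZ => //; exact: cEf.
move=> t _; rewrite (_ : series _ N = E t * (m%:R * z m t) * series (fun n => w n * ga (m + n) t) N).
  rewrite (_ : 8^-1 * _ = E t * (m%:R * z m t) * 8^-1); last by ring.
  rewrite ler_wpM2l ?mulr_ge0// -[8^-1]mul1r ler_pdivlMr// mulrC; exact: w_ga.
by rewrite !seriesE mulr_sumr; apply: eq_bigr => i _; rewrite /f; ring.
Qed.

Lemma ode_system_unique b n t : 0 < t < T -> G b n t = F b n t.
Proof.
move=> tT; have nI0 k : 0 <= k%:R * I k by rewrite mulr_ge0.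
have [M ME] : {M | M = tsum (fun n => n%:R * I n)} by eexists.
have MB : sumby (fun n => n%:R * I n) M.
  by move=> N; rewrite ME; exact: le_series_tsum I_finite.
have wJ : sumby (fun k => w k * tsum (J k)) (8^-1 * M + a * M).
  apply: (@sumby_lim _ (fun P k => w k * series (J k) P)) => [k|P].
    by apply: cvgMl_tmp; exact: J_cvg.
  apply: (@sumby_le _ _ (fun k => w k * series (K k) P +
      k%:R * series (fun m => m%:R * A m * I (m + k)) P)) => [k|].
    rewrite (_ : series (J k) P = series (K k) P + series (fun m => m%:R * A m * I (m + k)) P).
      rewrite mulrDr lerD2l ler_wpM2r// series_ge0// => m.
      by rewrite !mulr_ge0.
    by rewrite !seriesE -big_split; apply: eq_bigr => m _; exact: J_split.
  apply: sumbyD => N; last exact: young_l1 A0 I0 Aa MB.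
  apply: (@le_trans _ _ (series (fun m => series (fun k => w k * K k m) N) P)).
    rewrite !seriesE; under eq_bigr do rewrite seriesE mulr_sumr.
    rewrite exchange_big/=; apply: ler_sum => m _; rewrite seriesE; exact: lexx.
  apply: le_trans (sumbyZ _ MB P); last by rewrite invr_ge0.
  by apply: ler_series => m; exact: K_sum.
have M2 : sumby (fun k => k%:R * I k) (2 * (8^-1 * M + a * M)).
  by apply: sumby_le (sumbyZ (ler0n R 2) wJ) => k; exact: I_le.
(* Since a <= 1/4 the right-hand side is at most 3/4 M. *)
have MM : M <= 2 * (8^-1 * M + a * M).
  by rewrite {1}ME; apply: tsum_le M2; exact: sumby_cvg I_finite.
have M0 := sumby_ge0 MB.
have {MM} M_0 : M = 0.
  have aM : 4 * a * M <= 1 * M by rewrite ler_wpM2r.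
  by apply/eqP; rewrite eq_le M0 andbT; lra.
have [->|n0] := posnP n; first by rewrite G0; apply/esym/eqP; rewrite -normr_le0 -A00.
have In : I n = 0.
  have : n%:R * I n <= 0 by rewrite -M_0; exact: (term_le_sumby n nI0 MB).
  rewrite pmulr_rle0 ?ltr0n// => h; apply/eqP; rewrite eq_le h I0//.
have cEz : continuous (fun t => E t * z n t) by move=> y; apply: cvgM; [exact: cE|exact: cz].
have Ez0 y : 0 <= E y * z n y by rewrite mulr_ge0.
have /eqP := integral0_continuous cEz Ez0 In tT.
rewrite mulf_eq0 gt_eqF ?expR_gt0//= => /eqP zt.
by apply/eqP; rewrite -subr_eq0 -normr_le0 -zt; exact: dz.
Qed.

End SystemUniqueness.

(** * Uniqueness in the solution class *)

Section SolutionCoefficients.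
Context {R : realType}.
Implicit Types (u v : R -> R) (s t T : R).

Lemma hs_sub_le s c c' n :
  hs s (fun b m => c b m - c' b m) n <= 2 * hs s c n + 2 * hs s c' n.
Proof.
rewrite /hs; have := powR_ge0 n%:R (2 * s).
move: (n%:R `^ _) (c false n) (c true n) (c' false n) (c' true n) => W x y x' y' W0.
rewrite (_ : 2 * _ + 2 * _ = W * (2 * (x ^+ 2 + y ^+ 2) + 2 * (x' ^+ 2 + y' ^+ 2))); last by ring.
by rewrite ler_wpM2l//; have := sqr_ge0 (x + x'); have := sqr_ge0 (y + y'); nra.
Qed.

Lemma sobolev_sub s u v : 0 < s -> sobolev s u -> sobolev s v -> sobolev s (u \- v).
Proof.
move=> s0 su sv; have [uT uZ _] := su; have [vT vZ _] := sv.
have uB := sumby_sobolev s0 su; have vB := sumby_sobolev s0 sv.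
have [] // := sobolev_sumby s0 (torus_sub uT vT) (zero_average_sub uT vT uZ vZ)
  (sumby_le _ (sumbyD (sumbyZ (ler0n R 2) uB) (sumbyZ (ler0n R 2) vB))).
move=> n; apply: le_trans (hs_sub_le s _ _ n).
by rewrite le_eqVlt; apply/orP; left; apply/eqP; rewrite /hs !coef_sub.
Qed.

Lemma coef_le_sobolev_norm s u b n : 0 < s -> sobolev s u -> `|coef u b n| <= sobolev_norm s u.
Proof.
move=> s0 su; have [uT uZ _] := su.
case: n => [|n]; first by rewrite coef0// normr0 sqrtr_ge0.
rewrite -(@ler_pXn2r _ 2)// ?nnegrE ?sqrtr_ge0// real_normK ?num_real//.
have := term_le_sumby n.+1 (hs_ge0 s _) (sumby_sobolev s0 su).
have pi1 : 1 <= pi :> R by apply: le_trans (pi_ge2 R); rewrite ler1n.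
have W1 : 1 <= n.+1%:R `^ (2 * s) :> R.
  by rewrite -[X in X <= _](powRr0 n.+1%:R) ler_powR ?ler1n// mulr_ge0// ltW.
set N2 := sobolev_norm s u ^+ 2; have N0 : 0 <= N2 by exact: sqr_ge0.
move=> h; have {}h : hs s (coef u) n.+1 <= N2.
  by apply: le_trans h _; rewrite ler_pdivrMr ?(lt_le_trans ltr01)// ler_peMr.
apply: le_trans h; rewrite /hs.
apply: (@le_trans _ _ (coef u false n.+1 ^+ 2 + coef u true n.+1 ^+ 2)).
  by case: b; rewrite ?lerDr ?lerDl sqr_ge0.
by rewrite ler_peMl// addr_ge0// sqr_ge0.
Qed.

Lemma holder_continuous (h : R -> R) K ga : 0 < ga ->
  (forall t t', `|h t - h t'| <= K * `|t - t'| `^ ga) -> continuous h.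
Proof.
move=> g0 hK t; apply/cvgrPdist_le => e e0.
have K1 : 0 < `|K| + 1 by rewrite ltr_wpDl.
have d0 : 0 < (e / (`|K| + 1)) `^ ga^-1 by rewrite powR_gt0// divr_gt0.
near=> y; apply: le_trans (hK t y) _.
have ty : `|t - y| <= (e / (`|K| + 1)) `^ ga^-1.
  by near: y; apply/nbhs_ballP; exists ((e / (`|K| + 1)) `^ ga^-1) => // y /ltW.
have {}ty : `|t - y| `^ ga <= e / (`|K| + 1).
  have := ge0_ler_powR (ltW g0) _ _ ty; rewrite !nnegrE => /(_ (normr_ge0 _) (powR_ge0 _ _)).
  by rewrite -powRrM mulVf ?gt_eqF// powRr1// divr_ge0// ltW.
apply: (@le_trans _ _ ((`|K| + 1) * (e / (`|K| + 1)))); last by rewrite mulrC divfK ?gt_eqF.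
apply: (@le_trans _ _ ((`|K| + 1) * `|t - y| `^ ga)); last by rewrite ler_wpM2l// ltW.
by rewrite ler_wpM2r ?powR_ge0//; have := ler_norm K; lra.
Unshelve. all: by end_near. Qed.

(** Time frozen at both ends: bounds on [0, T] become bounds on the whole line, and Hoelder
    continuity survives because the map is 1-Lipschitz. *)
Definition clampT T t : R := Num.min T (clamp t).

Lemma clampT_in T t : 0 <= T -> 0 <= clampT T t <= T.
Proof. by move=> T0; rewrite le_min T0 clamp_ge0 ge_min lexx. Qed.

Lemma clampTE T t : 0 <= t <= T -> clampT T t = t.
Proof. by move=> /andP[t0 tT]; rewrite /clampT clampE//; apply/min_idPr. Qed.

Lemma clampT_lipschitz T t t' : `|clampT T t - clampT T t'| <= `|t - t'|.
Proof.
rewrite /clampT /clamp /Num.min /Num.max.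
case: (ltP 0 t) => h1; case: (ltP 0 t') => h2;
  do ?[case: ifPn; rewrite -?leNgt => ?];
  case: (lerP t t') => h5; rewrite ?ler_norml ?lexx; try (apply/andP; split); lra.
Qed.

(** The Hoelder clause is used instead of the bound in L^oo because it speaks of every time, and
    gives continuity of the modes as well. It is invoked on [0, T + 1) to cover the closed
    interval. *)
Lemma class_coefficients (eps T : R) (g : R -> R -> R) : 0 < eps -> 0 <= T ->
  solution_class eps g ->
  exists C rho : R, let G b n t := coef (g (clampT T t)) b n in
   [/\ 0 < rho <= 1, forall b n, continuous (G b n), forall b t, G b 0%N t = 0 &
     forall t, sumby (fun n => n%:R * (n%:R `^ rho * (`|G false n t| + `|G true n t|))) C].
Proof.
move=> e0 T0 cl; have T1 : 0 < T + 1 by lra.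
have [H _ _] := cl _ T1.
(* Midpoint of the admissible range: strictly above the lower end the space exponent exceeds 3/2,
   namely 3/2 + eps/4; strictly below 1/2 the time exponent is positive. *)
pose th := ((2 * (eps + 1))^-1 + 2^-1) / 2.
have q0 : 0 < (2 * (eps + 1))^-1 by rewrite invr_gt0 mulr_gt0// addr_gt0.
have q1 : (2 * (eps + 1))^-1 < 2^-1.
  by rewrite ltf_pV2 ?posrE// ?mulr_gt0 ?addr_gt0// ltr_pMr// ltrDr.
have th1 : (2 * (eps + 1))^-1 <= th by rewrite /th; lra.
have th2 : th < 2^-1 by rewrite /th; lra.
have [gs [K HK]] := H th th1 th2.
pose s := 1 + th * (eps + 1).
have sE : s = 3 / 2 + eps / 4.
  by rewrite /s /th; field; rewrite gt_eqF// addr_gt0.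
rewrite -/s in gs HK; have s0 : 0 < s by rewrite sE; lra.
have tin t : 0 <= clampT T t < T + 1.
  by have /andP[-> h] := clampT_in t T0; rewrite (le_lt_trans h)// ltrDl.
have st t : sobolev s (g (clampT T t)) by exact: gs.
pose G b n t := coef (g (clampT T t)) b n.
have G0 b t : G b 0%N t = 0 by have [_ z _] := st t; exact: coef0.
(* The sign of the Hoelder constant is not part of the class; comparing the times 0 and 1/2 yields
   it. *)
have K0 : 0 <= K.
  have := HK 0 (2^-1); rewrite lexx/= T1 invr_ge0 ler0n/=.
  have -> : 2^-1 < T + 1 by lra.
  move=> /(_ isT isT)/(le_trans (sqrtr_ge0 _)).
  by rewrite pmulr_lge0// powR_gt0// normr_gt0 sub0r oppr_eq0 invr_eq0.
have ga0 : 0 < 2^-1 - th by lra.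
have cG b n : continuous (G b n).
  apply: (@holder_continuous _ K _ ga0) => t t'.
  have [uT _ _] := st t; have [vT _ _] := st t'.
  rewrite /G -coef_sub//; apply: le_trans (coef_le_sobolev_norm _ _ s0 (sobolev_sub s0 (st t) (st t'))) _.
  apply: le_trans (HK _ _ (tin t) (tin t')) _; rewrite ler_wpM2l//.
  by rewrite ge0_ler_powR ?nnegrE ?(ltW ga0)//; exact: clampT_lipschitz.
have g0 : sobolev s (g 0) by apply: gs; rewrite lexx.
pose N := (K * T `^ (2^-1 - th)) ^+ 2 / pi.
pose B := 2 * N + 2 * (sobolev_norm s (g 0) ^+ 2 / pi).
have GB t : sumby (hs s (fun b n => G b n t)) B.
  have [uT _ _] := st t; have [vT _ _] := g0.
  have sd := sobolev_sub s0 (st t) g0.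
  have dB : sumby (hs s (coef (g (clampT T t) \- g 0))) N.
    move=> M; apply: le_trans (sumby_sobolev s0 sd M) _.
    rewrite ler_wpM2r ?invr_ge0 ?pi_ge0// ler_pXn2r ?nnegrE ?sqrtr_ge0 ?mulr_ge0 ?powR_ge0//.
    have z0 : 0 <= (0 : R) < T + 1 by rewrite lexx.
    apply: le_trans (HK _ _ (tin t) z0) _; rewrite ler_wpM2l//.
    have /andP[h1 h2] := clampT_in t T0.
    by rewrite ge0_ler_powR ?nnegrE ?(ltW ga0)// subr0 ger0_norm.
  have gB := sumby_sobolev s0 g0.
  apply: sumby_le (sumbyD (sumbyZ (ler0n R 2) dB) (sumbyZ (ler0n R 2) gB)) => n.
  have := hs_sub_le s (coef (g (clampT T t) \- g 0)) (fun b m => - coef (g 0) b m) n.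
  rewrite /hs !sqrrN; apply: le_trans; rewrite le_eqVlt; apply/orP; left; apply/eqP.
  by rewrite !coef_sub// !opprK !subrK.
(* Below the margin eps/4 left by s, and at most 1 because [w_small] uses x <= x^rho on (0, 1]. *)
pose rho := Num.min 1 (eps / 8).
have rho01 : 0 < rho <= 1 by rewrite lt_min ltr01 divr_gt0//= ge_min lexx.
have rs : 3 / 2 + rho < s.
  have : rho <= eps / 8 by rewrite ge_min lexx orbT.
  by rewrite sE; lra.
exists (Num.sqrt (2 * (1 + (2 * (s - rho) - 3)^-1) * B)), rho; split=> // t.
have r0 : 0 <= rho by case/andP: rho01 => /ltW.
exact: weighted_embedding r0 rs (GB t).
Qed.

Lemma solution_unique (eps a : R) (f0 : R -> R) (g : R -> R -> R)
    (X : bool -> nat -> R -> R) (A : nat -> R) : 0 < eps ->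
  (forall b n, continuous (X b n)) -> (forall b n t, `|X b n t| <= A n) -> A 0%N = 0 ->
  sumby (fun n => n%:R * A n) a -> 4 * a <= 1 ->
  (forall b n T, ode n%:R (fun t => NL (fun b m => X b m t) b n) (X b n) T) ->
  torus_L1 f0 -> (forall b n, X b n 0 = coef f0 b n) ->
  is_solution f0 g -> solution_class eps g ->
  forall t, 0 <= t -> ae_equal (g t) (sol X t).
Proof.
move=> e0 cX XA A00 Aa a4 oX f0T X0 [gs [gl gL gx] weak g0] gc t t0.
have T0 : 0 <= t + 1 by lra.
have [C [rho [rho01 cG G0 GC]]] := class_coefficients e0 T0 gc.
pose G b n r := coef (g (clampT (t + 1) r)) b n.
have {}cG : forall b n, continuous (G b n) := cG.
have {}G0 : forall b r, G b 0%N r = 0 := G0.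
have {}GC : forall r, sumby (fun n => n%:R * (n%:R `^ rho * (`|G false n r| + `|G true n r|))) C := GC.
have gT s : 0 < s -> torus_L1 (g s) /\ zero_average (g s).
  by move=> /ltW/gs[].
have GE b n s : 0 < s < t + 1 -> G b n s = coef (g s) b n.
  by move=> /andP[s0 sT]; rewrite /G clampTE// !ltW.
have gC s : 0 < s < t + 1 -> sumby (fun n => n%:R * absm (coef (g s)) n) C.
  move=> sT; apply: sumby_le (GC s) => n; rewrite ler_wpM2l// !GE//.
  case: n => [|n].
    have /andP[s0 _] := sT; have [_ z] := gT s s0.
    by rewrite /absm !coef0// normr0 addr0 mulr0.
  rewrite ler_peMl ?absm_ge0// -[X in X <= _](powRr0 n.+1%:R) ler_powR ?ler1n//.
  by case/andP: rho01 => /ltW.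
have oG b n : (0 < n)%N -> ode n%:R (fun s => NL (fun b m => G b m s) b n) (G b n) (t + 1).
  move=> n0; apply: (mode_ode gT gC gL gx weak cG _ n0) => //.
  exact: NLG_continuous cG rho01 G0 GC b n.
have [g0T _ _] := gs 0 (lexx 0).
have XG b n : X b n 0 = G b n 0.
  by rewrite X0 /G clampTE ?lexx// /coef (ae_fc g0T f0T g0).
have eqc s : 0 < s < t + 1 -> forall b n, coef (g s) b n = X b n s.
  move=> sT b n; rewrite -GE//.
  exact: (ode_system_unique cX cG XA A00 Aa a4 rho01 G0 GC T0 (fun b n _ => oX b n _) oG XG).
have [gtT _ _] := gs t t0.
apply: fourier_unique => //; first exact: sol_torus XA A00 Aa t.
move=> b n; rewrite !fc_coef (coef_sol XA A00 Aa t); congr (_ * _).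
(* The comparison of modes concerns positive times; at t = 0 the common initial datum decides. *)
move: t0; rewrite le_eqVlt => /predU1P[<-|t0]; last by rewrite eqc// t0 ltrDl ltr01.
by rewrite XG /G clampTE ?lexx.
Qed.

End SolutionCoefficients.

(** * Global well-posedness for small data *)

Unset Implicit Arguments.

Theorem theorem2p4 (R : realType) (eps : R) (heps : 0 < eps) :
  exists C : R, 0 < C /\
    forall f0 : R -> R,
      sobolev (3 / 2) f0 -> sobolev (3 / 2 + eps) f0 ->
      sobolev_norm (3 / 2) f0 <
        Num.min 1
          (eps ^+ 2 /
             (C * (sobolev_norm (3 / 2 + eps) f0
                     * ln (sobolev_norm (3 / 2 + eps) f0) + 1) ^+ 2)) ->
      exists f : R -> R -> R,
        [/\ is_solution f0 f,
            solution_class eps f &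
            forall g : R -> R -> R,
              is_solution f0 g -> solution_class eps g ->
              forall t, 0 <= t -> ae_equal (g t) (f t)].
Proof.
have [C [C0 HC]] := small_data heps; exists C; split=> // f0 h1 h2 small.
have x0al b n : `|coef f0 b n| <= absm (coef f0) n.
  by rewrite /absm; case: b; rewrite ?lerDr ?lerDl.
have alde : sumby (fun n => n%:R * absm (coef f0) n) 8^-1.
  by apply: HC => //; apply: lt_le_trans small _; rewrite ge_min lexx orbT.
have de8 : 8 * 8^-1 <= 1 :> R by rewrite divff.
have [f0T f0Z _] := h1; have c00 := coef0 f0Z.
pose X := pXlim (coef f0); pose P := pAlim (absm (coef f0)).
(* P may be positive at index 0, where the solution vanishes. Resetting it to 0 gives A_n <= n A_n,
   so that the weighted sum controls the plain one. *)
pose A n : R := if n is 0%N then 0 else P n.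
have cX : forall b n, continuous (X b n) := pXlim_continuous x0al alde de8.
have XP b n t : `|X b n t| <= P n := pXlim_le x0al alde de8 b n t.
have XA b n t : `|X b n t| <= A n.
  case: n => [|n]; last exact: XP.
  by rewrite /A /X (pXlim_mode0 x0al alde de8)// normr0.
have P0 n : 0 <= P n by exact: le_trans (XP false n 0).
have AP n : A n <= P n by case: n.
have A0 n : 0 <= A n by case: n => [|n] //=.
have A00 : A 0%N = 0 by [].
have Aa : sumby (fun n => n%:R * A n) (2 * 8^-1).
  by apply: sumby_le (pAlim_l1 x0al alde de8) => n; rewrite ler_wpM2l.
have a4 : 4 * (2 * 8^-1) <= 1 :> R by lra.
have oX b n T : ode n%:R (fun t => NL (fun b m => X b m t) b n) (X b n) T.
  exact: pXlim_ode x0al alde de8 b n T.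
have cvA n : (0 < n)%N -> 2 * cv A n <= A n.
  case: n => // n _; apply: (@le_trans _ _ (P n.+1 - absm (coef f0) n.+1)); last first.
    by rewrite lerBlDr lerDl absm_ge0.
  (* The change at index 0 is invisible here: the term m = 0 has weight 0 and the index m + n is
     positive. *)
  rewrite (_ : cv A n.+1 = cv P n.+1); first exact: pAlim_cv x0al alde de8 n.+1.
  by apply: eq_tsum => -[|m]; rewrite /cvt ?mul0r.
have s0 : 0 < 3 / 2 + eps by lra.
have sal := sumby_sobolev s0 h2; set B := _ / pi in sal.
pose W n : R := n%:R `^ (2 * (3 / 2 + eps)).
have W0 n : 0 <= W n by exact: powR_ge0.
have Wm m n : W n <= W (m + n)%N.
  by rewrite /W ge0_ler_powR ?nnegrE// ?ler_nat ?leq_addl// mulr_ge0// ltW.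
have sal2 : sumby (fun n => W n * absm (coef f0) n ^+ 2) (2 * B).
  apply: sumby_le (sumbyZ (ler0n R 2) sal) => n; rewrite /hs [X in _ <= X]mulrCA ler_wpM2l//.
  rewrite /absm -[coef f0 false n ^+ 2]real_normK ?num_real// -[coef f0 true n ^+ 2]real_normK ?num_real//.
  by have := sqr_ge0 (`|coef f0 false n| - `|coef f0 true n|); lra.
have sA : sumby (fun n => W n * A n ^+ 2) (4 * (2 * B)).
  apply: sumby_le (pAlim_l2 x0al alde de8 W0 Wm sal2) => n.
  by rewrite ler_wpM2l// ler_pXn2r// nnegrE.
have X0 b n : X b n 0 = coef f0 b n by exact: pXlim0 x0al alde de8 b n 0 (lexx 0).
exists (sol X); split.
- split.
  + by move=> t _; exact: sol_sobolev1 XA A00 Aa t.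
  + exact: sol_L1_loc cX XA A00 Aa.
  + exact: sol_weak_form cX XA A00 Aa oX.
  + have fE := fourier_expansion f0T f0T f0Z (sumby_absm c00 alde).
    apply: ae_imp fE => x ->; rewrite /sol; congr (trig _ x).
    by apply/funext => b; apply/funext => n; exact: X0.
- move=> T T0; split.
  + move=> th th1 th2; apply: (sol_holder cX XA A00 Aa oX cvA sA).
    * have : 0 < th * (eps + 1); last by lra.
      rewrite mulr_gt0 ?addr_gt0//; apply: lt_le_trans th1.
      by rewrite invr_gt0 mulr_gt0// addr_gt0.
    * have : 0 < th; last by move=> ?; apply/andP; split; lra.
      by apply: lt_le_trans th1; rewrite invr_gt0 mulr_gt0// addr_gt0.
    (* The exponents add up to 1 + th (eps + 1) + 1/2 - th = 3/2 + th eps, which must not exceed 3/2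
       + eps. *)
    * have : th * eps <= eps; last by lra.
      by rewrite ler_piMl ?(ltW heps)//; lra.
  + exact: (sol_Linfty cX XA A00 Aa oX cvA s0 sA T0).
  + by apply: (sol_L2 cX XA A00 Aa oX cvA s0 sA a4) => //; lra.
- by move=> g gs gc t; exact: (solution_unique heps cX XA A00 Aa a4 oX f0T X0 gs gc).
Qed.
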